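(* Let $K$ be a field, let $\mathcal A\subseteq M_{\alpha,d}$ define the simplicial toric ideal $I_{\mathcal A}\subset K[x_1,\dots,x_c,y_1,\dots,y_d]$, and let $S$ be the semigroup generated by $\mathcal A$. The maximum degree in a minimal Gröbner basis of $I_{\mathcal A}$ with respect to the reverse lexicographic order is at most $\deg K[S]-\operatorname{codim}K[S]+1$ in each of the following cases: (i) $d=2$; (ii) $K[S]$ is a Buchsbaum ring; (iii) $K[S]$ is a simplicial semigroup ring with isolated singularity, or equivalently, $\mathcal A$ contains all points of $M_{\alpha,d}$ of type $(0,\dots,\alpha-1,\dots,1,\dots,0)$, where $\alpha-1$ and $1$ stand in the $i$-th and $j$-th positions, respectively (for all $i\neq j$ in $\{1,\dots,d\}$, in either order), and the other coordinates are zero.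
   Context: Setting. $K$ is an arbitrary field, $c\ge 2$, $\alpha\ge 2$ and $d$ are natural numbers, and $M_{\alpha,d}=\{(x_1,\dots,x_d)\in\mathbb N^d : x_1+\cdots+x_d=\alpha\}$ (with $0\in\mathbb N$). $\mathcal A=\{\mathbf e_1,\dots,\mathbf e_d,\mathbf a_1,\dots,\mathbf a_c\}\subseteq M_{\alpha,d}$ is a set of $d+c$ distinct elements, where $\mathbf e_1=(\alpha,0,\dots,0),\dots,\mathbf e_d=(0,\dots,0,\alpha)$. Writing $\mathbf a_i=(a_{i1},\dots,a_{id})$, the integers $a_{ij}$ ($1\le i\le c$, $1\le j\le d$) are assumed to be relatively prime (their overall gcd is $1$). $S\subseteq\mathbb N^d$ is the (homogeneous simplicial affine) semigroup (with $0$) generated by $\mathcal A$, and $K[S]\cong K[t_1^\alpha,\dots,t_d^\alpha,\mathbf t^{\mathbf a_1},\dots,\mathbf t^{\mathbf a_c}]\subseteq K[t_1,\dots,t_d]$, where $\mathbf t^{\mathbf a_i}=t_1^{a_{i1}}\cdots t_d^{a_{id}}$. $I_{\mathcal A}$ is the kernel of the $K$-algebra homomorphism $K[x_1,\dots,x_c,y_1,\dots,y_d]\to K[S]$, $x_i\mapsto \mathbf t^{\mathbf a_i}$, $y_j\mapsto t_j^\alpha$; it is called the simplicial toric ideal defined by $\mathcal A$. The grading is the standard one: $\deg x_i=\deg y_j=1$. One has $\dim K[S]=d$ and $\operatorname{codim}K[S]=c$; $\deg K[S]$ is the multiplicity of the standard graded algebra $K[S]$. Order. The reverse lexicographic order is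 the graded (degree) reverse lexicographic order with $x_1>\cdots>x_c>y_1>\cdots>y_d$. The maximum degree in a minimal Gröbner basis of $I_{\mathcal A}$ is the largest degree of a minimal generator of the initial ideal $\operatorname{in}(I_{\mathcal A})$. *)

(* Defs.v *)
From mathcomp Require Import all_boot all_order all_algebra fraction.
From mathcomp Require Import mpoly.
From mathcomp Require Import boolp classical_sets.

Set Implicit Arguments.
Unset Strict Implicit.
Unset Printing Implicit Defensive.

Import GRing.Theory.

Local Open Scope classical_set_scope.
Local Open Scope ring_scope.

(* A subring of an ambient ring [F] is represented by its carrier [A : set F];
   ideals of that subring are again subsets of [F]. *)
Section Ideals.
Variable F : comNzRingType.
Implicit Types (A I P M X : set F) (s : seq F).

Definition ideal A I :=
  [/\ I `<=` A, I 0, forall x y, I x -> I y -> I (x + y)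
    & forall a x, A a -> I x -> I (a * x)].

Definition prime_ideal A P :=
  [/\ ideal A P, ~ P 1
    & forall x y, A x -> A y -> P (x * y) -> P x \/ P y].

Definition ideal_span A X : set F :=
  [set x | exists s : seq (F * F),
     (forall u, u \in s -> A u.1 /\ X u.2) /\ x = \sum_(u <- s) u.1 * u.2].

Definition prime_chain A (n : nat) (p : nat -> set F) :=
  (forall i, (i <= n)%N -> prime_ideal A (p i)) /\
  (forall i, (i < n)%N -> p i `<` p i.+1).

Definition has_krull_dim A (n : nat) :=
  (exists p, prime_chain A n p) /\
  (forall k p, prime_chain A k p -> (k <= n)%N).

Definition krull_dim A : nat := xget 0%N [set n | has_krull_dim A n].

(* From here on [A] is meant to be a Noetherian local ring with maximal
   ideal [M]. *)

Definition system_of_parameters A M s :=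
  [/\ has_krull_dim A (size s), forall x, x \in s -> M x
    & forall y, M y -> exists k, ideal_span A [set` s] (y ^+ k)].

(* M * ((x_1, .., x_i) : x_(i+1)) is contained in (x_1, .., x_i) for all i *)
Definition weak_sequence A M s :=
  forall i, (i < size s)%N -> forall y a, M y -> A a ->
    ideal_span A [set` take i s] (a * s`_i) ->
    ideal_span A [set` take i s] (y * a).

Definition buchsbaum_local A M :=
  forall s, system_of_parameters A M s -> weak_sequence A M s.

Definition regular_local A M :=
  exists s, has_krull_dim A (size s) /\ M = ideal_span A [set` s].

End Ideals.

(* For a subring [A] of a field and a prime ideal [P] of [A], the localization
   of [A] at [P] and its maximal ideal are subsets of the same field. *)
Section Localization.
Variable F : fieldType.
Implicit Types (A P M : set F).

Definition localization A P : set F :=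
  [set z | exists x y, [/\ A x, A y, ~ P y & z = x / y]].

Definition localization_ideal A P : set F :=
  [set z | exists x y, [/\ P x, A y, ~ P y & z = x / y]].

(* For a graded algebra [A] with irrelevant maximal ideal [M]. *)
Definition graded_buchsbaum A M :=
  buchsbaum_local (localization A M) (localization_ideal A M).

Definition isolated_singularity A M :=
  forall P, prime_ideal A P -> P <> M ->
    regular_local (localization A P) (localization_ideal A P).

End Localization.

Section Dimension.
Variables (K : fieldType) (V : lmodType K).

Definition has_basis_of_size (U : set V) (n : nat) :=
  exists b : 'I_n -> V,
    [/\ forall i, U (b i),
        forall k : 'I_n -> K, \sum_i k i *: b i = 0 -> forall i, k i = 0
      & forall v, U v -> exists k : 'I_n -> K, v = \sum_i k i *: b i].

Definition subspace_dim (U : set V) : nat :=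
  xget 0%N [set n | has_basis_of_size U n].

End Dimension.

(* The multiplicity attached to a Hilbert function [H]: (deg P)! times the
   leading coefficient of the Hilbert polynomial [P]. *)
Definition has_multiplicity (H : nat -> nat) (e : nat) :=
  exists P : {poly rat},
    (exists n0, forall n, (n0 <= n)%N -> (H n)%:R = P.[n%:R]) /\
    e%:R = ((size P).-1)`!%:R * lead_coef P.

Definition multiplicity (H : nat -> nat) : nat :=
  xget 0%N [set e | has_multiplicity H e].

(* Degree reverse lexicographic order with 'X_0 > 'X_1 > ...  The order that
   multinomials declares on 'X_{1..n} is the degree lexicographic one, so it
   cannot be used here. *)
Definition grevlex_lt (n : nat) : rel 'X_{1..n} := fun m1 m2 =>
  (mdeg m1 < mdeg m2)%N ||
  (mdeg m1 == mdeg m2) &&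
  [exists i : 'I_n, (m2 i < m1 i)%N &&
     [forall j : 'I_n, (i < j)%N ==> (m1 j == m2 j)]].

Section InitialIdeal.
Variables (K : fieldType) (n : nat).
Implicit Types (I : set {mpoly K[n]}) (m : 'X_{1..n}).

Definition is_leading_monomial (f : {mpoly K[n]}) m :=
  m \in msupp f /\
  forall m', m' \in msupp f -> m' != m -> grevlex_lt m' m.

Definition initial_ideal I : set {mpoly K[n]} :=
  ideal_span [set: {mpoly K[n]}]
    [set g | exists f m, [/\ I f, is_leading_monomial f m & g = 'X_[m]]].

Definition minimal_monomial_generator I m :=
  I 'X_[m] /\ forall m', (m' <= m)%MM -> m' != m -> ~ I 'X_[m'].

(* The maximum degree in a minimal Groebner basis of [I] is the largest degree
   of a minimal generator of the initial ideal of [I]. *)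
Definition groebner_degree_at_most I (D : int) :=
  forall m, minimal_monomial_generator (initial_ideal I) m ->
    ((mdeg m)%:Z <= D)%R.

End InitialIdeal.

Section SimplicialToric.
Variable K : fieldType.
Variables (c d alpha : nat) (a : 'I_c -> 'X_{1..d}).

(* The elements a_1, .., a_c, e_1, .., e_d, listed in the order of the variables
   x_1, .., x_c, y_1, .., y_d of K[x, y] = {mpoly K[c + d]}. *)
Definition gens (k : 'I_(c + d)) : 'X_{1..d} :=
  match split k with
  | inl i => a i
  | inr j => (U_(j) *+ alpha)%MM
  end.

Definition simplicial_config :=
  [/\ forall i, mdeg (a i) = alpha,
      injective gens
    & \big[gcdn/0%N]_(i < c) \big[gcdn/0%N]_(j < d) a i j = 1%N].

Definition semigroup : set 'X_{1..d} :=
  [set s | exists k : 'I_(c + d) -> nat, s = (\sum_i gens i *+ k i)%MM].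

Definition contains_all_near_vertices :=
  forall i j : 'I_d, i != j ->
    exists k, gens k = (U_(i) *+ (alpha - 1) + U_(j))%MM.

Definition toric_map (p : {mpoly K[c + d]}) : {mpoly K[d]} :=
  p \mPo [tuple 'X_[gens k] | k < c + d].

Definition toric_ideal : set {mpoly K[c + d]} := [set p | toric_map p = 0].

(* K[S] as the span of the monomials t^s, s in S, inside K[t_1, .., t_d] *)
Definition semigroup_ring : set {mpoly K[d]} :=
  [set f | forall s, s \in msupp f -> semigroup s].

(* The generators t^(a_i) and t_j^alpha have degree 1 in the standard grading
   of K[S], and degree alpha in t. *)
Definition graded_piece (n : nat) : set {mpoly K[d]} :=
  [set f | semigroup_ring f /\ f \is (alpha * n).-homog].

Definition degKS : nat := multiplicity (fun n => subspace_dim (graded_piece n)).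

(* K[S] inside the field K(t_1, .., t_d), where its localizations live *)
Definition KS : set {fraction {mpoly K[d]}} := @tofrac _ @` semigroup_ring.

Definition KS_irrelevant : set {fraction {mpoly K[d]}} :=
  @tofrac _ @` [set f | semigroup_ring f /\ f@_0%MM = 0].

Definition codimKS : nat := (c + d - krull_dim KS)%N.

End SimplicialToric.

Arguments toric_ideal K {c d} alpha a.
Arguments degKS K {c d} alpha a.
Arguments KS K {c d} alpha a.
Arguments KS_irrelevant K {c d} alpha a.
Arguments codimKS K {c d} alpha a.

(* Main.v *)
Require Import Defs.
From mathcomp Require Import all_boot all_order all_algebra fraction.
From mathcomp Require Import mpoly.
From mathcomp Require Import boolp classical_sets.
From mathcomp Require Import zify ring.

(* The multiplicity is the number of classes of S modulo the lattice spanned by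
   e_1, .., e_d, and the codimension is c. If the value of x^u is not of the form
   s + e_j with s in S, then 0, the a_k and the partial sums of two or more terms
   of u lie in distinct classes, so |u| is at most deg - codim. For a minimal
   generator x^u y^v of the initial ideal, u is of this kind if v <> 0, and it is
   so without any one of its terms if v = 0; hence only |v| > 1 needs the
   hypotheses. In this case x^u y^v has the same value as a smaller
   x^u' y^v', and for y_i | y^v and the last y_j in y^v' the point
   q = (value of x^u y^v) - e_i - e_j is not in S, although q + e_i and q + e_j are.
   - d = 2: order u by the first and u' by the second coordinate; the partial sums
     of u' and the first v' partial sums of u are then pairwise incongruent.
   - Buchsbaum: q + s is in S for s <> 0, as is seen from parameters y_i^N, y_j^N;
     this property for q and for q - e_k contradicts |v| > 1.
   - Isolated singularity: all the points near the vertices are in A, so every q in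
     N^d of degree n with sum_i floor(q_i / (alpha - 1)) >= n is in S, which bounds
     the degree of q by a number of explicit classes outside A.
   If the points near the vertices are in A, then K[S] and the polynomial ring in
   t_j^alpha and the t_i / t_j agree once t_j^alpha is inverted. Conversely, the localization
   at the prime ideal of the ray N e_j has embedding dimension the number of
   irreducible elements of S modulo Z e_j, and if this is d - 1 for all j, then
   the irreducible element on the i-th axis divides all i-th coordinates. *)

Set Implicit Arguments.
Unset Strict Implicit.
Unset Printing Implicit Defensive.

Import GRing.Theory Num.Theory.

Local Open Scope ring_scope.

(** * The initial ideal of a toric ideal *)

(** The obstacle is the y-part. A vertex is zero modulo the lattice alpha Z^d, so counting classes
    of partial sums sees the x-factors only, and a generator with several y-factors escapes this
    count. The order enters in one way: the y-variables are the smallest, so a monomial without y_j,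
    y_(j+1), ... is larger than every monomial of its degree that contains one of them. This turns
    minimality in a fibre into indivisibility of the value by vertices. [isolated_singularity]
    quantifies over all primes, homogeneous or not. Regularity of a polynomial ring is therefore
    proved at an arbitrary prime, by induction on the variables, carrying two witnesses: a chain of
    primes, which bounds the height from below, and elements algebraically independent modulo the
    prime, which bound it from above. The same independence argument gives dim K[S] = d and bounds
    the dimension at the rays. For the multiplicity, S is a finite union of translates of alpha N^d,
    whose points in each degree are counted by inclusion-exclusion. *)

Definition mnm_simpl n := (@mnmDE n, @mnmBE n, @mulmnE n, @mnm1E n, @mnm0E n).

Section MonomialOrder.
Variable n : nat.
Implicit Types m w : 'X_{1..n}.

Lemma grevlex_ltP m1 m2 :
  reflect ((mdeg m1 < mdeg m2)%N \/ mdeg m1 = mdeg m2 /\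
    exists2 i : 'I_n, (m2 i < m1 i)%N & forall j : 'I_n, (i < j)%N -> m1 j = m2 j)
  (grevlex_lt m1 m2).
Proof.
apply: (iffP orP) => -[h|]; try by left.
  case/andP=> /eqP e /existsP[i /andP[h1 /forallP h2]].
  right; split=> //; exists i => // j ij; apply/eqP; exact: (implyP (h2 j)).
case=> e [i h1 h2]; right; rewrite e eqxx; apply/existsP; exists i; rewrite h1.
by apply/forallP=> j; apply/implyP=> /h2 ->.
Qed.

Lemma grevlex_ltD w m1 m2 : grevlex_lt m1 m2 -> grevlex_lt (m1 + w)%MM (m2 + w)%MM.
Proof.
move/grevlex_ltP=> h; apply/grevlex_ltP; rewrite !mdegD.
case: h => [|[e [i h1 h2]]]; first by left; rewrite ltn_add2r.
right; split; first by rewrite e.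
by exists i => [|j ij]; rewrite !mnm_simpl ?ltn_add2r // h2.
Qed.

Lemma grevlex_ltD2 w m1 m2 : grevlex_lt (m1 + w)%MM (m2 + w)%MM -> grevlex_lt m1 m2.
Proof.
move/grevlex_ltP=> h; apply/grevlex_ltP; move: h; rewrite !mdegD.
case=> [|[e [i h1 h2]]]; first by rewrite ltn_add2r; left.
right; split; first by apply/eqP; rewrite -(eqn_add2r (mdeg w)) e.
exists i; first by move: h1; rewrite !mnm_simpl ltn_add2r.
by move=> j /h2; rewrite !mnm_simpl => /addIn.
Qed.

Lemma grevlex_ltxx m : ~~ grevlex_lt m m.
Proof. by apply/negP=> /grevlex_ltP[|[_ [i]]]; rewrite ltnn. Qed.

Lemma grevlex_total m1 m2 : m1 != m2 -> grevlex_lt m1 m2 \/ grevlex_lt m2 m1.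
Proof.
move=> ne; case: (ltngtP (mdeg m1) (mdeg m2)) => e.
- by left; apply/grevlex_ltP; left.
- by right; apply/grevlex_ltP; left.
have [i0 h0] : exists i, m1 i != m2 i.
  by apply/existsP; apply: contraNT ne; rewrite negb_exists => /forallP h;
     apply/eqP/mnmP=> i; apply/eqP; have := h i; rewrite negbK.
pose i := [arg max_(i > i0 | m1 i != m2 i) (i : nat)].
have [hi hmax] : m1 i != m2 i /\ forall j, m1 j != m2 j -> (j <= i)%N.
  by rewrite /i; case: arg_maxnP.
have tail (j : 'I_n) : (i < j)%N -> m1 j = m2 j.
  by move=> ij; apply/eqP; case: eqP => // /eqP /hmax; rewrite leqNgt ij.
move: hi; rewrite neq_ltn => /orP[h|h]; [right|left]; apply/grevlex_ltP; right.
  by split=> //; exists i => // j /tail.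
by split=> //; exists i.
Qed.

End MonomialOrder.

(** Some summand must have [m] in its support, and the support of a multiple of a monomial consists
    of multiples of this monomial. *)
Lemma ideal_span_monomial (K : fieldType) n (G : set 'X_{1..n})
    (X : set {mpoly K[n]}) m :
  (forall g, X g -> exists2 m0, G m0 & g = 'X_[m0]) ->
  ideal_span [set: {mpoly K[n]}]%classic X 'X_[m] ->
  exists2 m0, G m0 & (m0 <= m)%MM.
Proof.
move=> hX [s [hs e]].
have : (\sum_(u <- s) u.1 * u.2)@_m != 0.
  by rewrite -e mcoeffX eqxx oner_neq0.
rewrite raddf_sum /= => ne.
have [u us hu] : exists2 u, u \in s & (u.1 * u.2)@_m != 0.
  apply/hasP; apply: contraNT ne; rewrite -all_predC => /allP h; apply/eqP.
  by rewrite big_seq big1 // => u /h /=; rewrite negbK => /eqP.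
have [_ /hX[m0 Gm0 e0]] := hs u us.
exists m0 => //; move: hu; rewrite e0 -mcoeff_msupp (perm_mem (msuppMX _ _)).
by case/mapP=> k _ ->; rewrite lem_addr.
Qed.

Section Toric.
Variable K : fieldType.
Variables (c d alpha : nat) (a : 'I_c -> 'X_{1..d}).

Local Notation S := (semigroup alpha a).
Local Notation gens := (gens alpha a).

(** The value of a monomial in x, y: the exponent of its image under [toric_map]. *)
Definition mval (m : 'X_{1..c + d}) : 'X_{1..d} := (\sum_i gens i *+ m i)%MM.

Lemma mval_sum m : mval m = (\sum_i gens i *+ m i)%MM.
Proof. by []. Qed.

Lemma mvalE m j : mval m j = (\sum_i gens i j * m i)%N.
Proof. by rewrite mnm_sumE; apply: eq_bigr => i _; rewrite mulmnE. Qed.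

Lemma mvalD m1 m2 : mval (m1 + m2) = (mval m1 + mval m2)%MM.
Proof.
apply/mnmP=> j; rewrite mnmDE !mvalE -big_split /=.
by apply: eq_bigr => i _; rewrite mnmDE mulnDr.
Qed.

Lemma mval0 : mval 0%MM = 0%MM.
Proof. by apply/mnmP=> j; rewrite mvalE big1 ?mnm0E // => i _; rewrite mnm0E muln0. Qed.

Lemma mval1 k : mval U_(k)%MM = gens k.
Proof.
apply/mnmP=> j; rewrite mvalE (bigD1 k) //= mnm1E eqxx muln1 big1 ?addn0 // => i ne.
by rewrite mnm1E eq_sym (negbTE ne) muln0.
Qed.

Lemma semigroupP s : S s <-> exists m, s = mval m.
Proof.
split=> [[k ->]|[m ->]]; last by exists m.
exists [multinom k i | i < c + d]; apply/mnmP=> j.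
by rewrite mvalE mnm_sumE; apply: eq_bigr => i _; rewrite mulmnE mnmE.
Qed.

Lemma semigroup_val m : S (mval m).
Proof. by apply/semigroupP; exists m. Qed.

Lemma semigroup0 : S 0%MM.
Proof. by rewrite -mval0; apply: semigroup_val. Qed.

Lemma semigroupD s t : S s -> S t -> S (s + t)%MM.
Proof.
by move=> /semigroupP[m ->] /semigroupP[m' ->]; rewrite -mvalD; apply: semigroup_val.
Qed.

Lemma semigroup_sum (I : Type) (r : seq I) (P : pred I) (F : I -> 'X_{1..d}) :
  (forall i, P i -> S (F i)) -> S (\sum_(i <- r | P i) F i)%MM.
Proof. by move=> h; apply: big_ind => //; [exact: semigroup0|exact: semigroupD]. Qed.

Lemma semigroupM s k : S s -> S (s *+ k)%MM.
Proof.
by move=> hs; elim: k => [|k IH]; rewrite ?mulm0n ?mulmS; [exact: semigroup0|exact: semigroupD].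
Qed.

Lemma semigroup_gens k : S (gens k).
Proof. by rewrite -mval1; apply: semigroup_val. Qed.

Lemma gens_lshift i : gens (lshift d i) = a i.
Proof. by rewrite /Defs.gens -[lshift d i]/(unsplit (inl i)) unsplitK. Qed.

Lemma gens_rshift j : gens (rshift c j) = (U_(j) *+ alpha)%MM.
Proof. by rewrite /Defs.gens -[rshift c j]/(unsplit (inr j)) unsplitK. Qed.

Lemma semigroup_vertex j : S (U_(j) *+ alpha)%MM.
Proof. by rewrite -gens_rshift; apply: semigroup_gens. Qed.

Lemma semigroup_config i : S (a i).
Proof. by rewrite -gens_lshift; apply: semigroup_gens. Qed.

Lemma toric_mapX m : toric_map (K := K) alpha a 'X_[m] = 'X_[mval m].
Proof.
rewrite /toric_map comp_mpolyX /mval -mprodXE; apply: eq_bigr => i _.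
by rewrite tnth_mktuple mpolyXn.
Qed.

Lemma toric_mapE p : toric_map alpha a p =
  \sum_(m <- msupp p) p@_m *: 'X_[K, mval m].
Proof.
rewrite {1}[p]mpolyE /toric_map linear_sum /=; apply: eq_bigr => m _.
by rewrite linearZ /=; congr (_ *: _); exact: toric_mapX.
Qed.

(** Standard monomials: the least elements of the fibres of [mval]. *)
Definition std (m : 'X_{1..c + d}) := forall m', mval m' = mval m -> ~~ grevlex_lt m' m.

(** If f maps to 0, the coefficient of f at its leading monomial must cancel against another
    monomial of the same value, which is smaller. Conversely, two monomials of equal value give a
    binomial in the ideal. *)
Lemma initial_toricP m :
  initial_ideal (toric_ideal K alpha a) 'X_[m] <-> ~ std m.
Proof.
split.
- pose G m0 := exists2 f, toric_ideal K alpha a f & is_leading_monomial f m0.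
  move/(@ideal_span_monomial _ _ G) => [|m0 [f If [m0f lead]] le0].
    by move=> g [f [m0 [If lm ->]]]; exists m0 => //; exists f.
  have [m1 [m1f ne1 e1]] : exists m1, [/\ m1 \in msupp f, m1 != m0 & mval m1 = mval m0].
    apply: contrapT => h.
    have : (toric_map alpha a f)@_(mval m0) = f@_m0.
      rewrite toric_mapE (bigD1_seq m0) ?msupp_uniq //= mcoeffD raddf_sum /=.
      rewrite mcoeffZ mcoeffX eqxx mulr1 big_seq_cond big1 ?addr0 // => m1 /andP[m1f ne].
      rewrite mcoeffZ mcoeffX; case: eqP => [e|]; last by rewrite mulr0.
      by case: h; exists m1.
    rewrite If mcoeff0 => /esym/eqP; rewrite mcoeff_eq0 => /negP; exact.
  move=> /(_ (m1 + (m - m0))%MM); rewrite mvalD e1 -mvalD addmC submK //.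
  move=> /(_ erefl)/negP; apply; rewrite -{2}(submK le0) [X in grevlex_lt _ X]addmC addmC.
  by rewrite addmC; apply: grevlex_ltD; apply: lead.
- move=> h; have [m' [e lt]] : exists m', mval m' = mval m /\ grevlex_lt m' m.
    apply: contrapT => h'; apply: h => m' e; apply/negP => lt; apply: h'.
    by exists m'.
  have ne : m' != m by apply: contraTneq lt => ->; apply: grevlex_ltxx.
  exists [:: (1, 'X_[m])]; split; last by rewrite big_seq1 mul1r.
  move=> u; rewrite inE => /eqP -> /=; split=> //.
  exists ('X_[m] - 'X_[m']), m; split=> //.
    by rewrite /toric_ideal /= /toric_map linearB /= -/(toric_map _ _ _)
       -[X in _ - X]/(toric_map _ _ _) !toric_mapX e subrr.
  split; first by rewrite mcoeff_msupp mcoeffB !mcoeffX eqxx (negbTE ne) subr0 oner_neq0.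
  move=> m1 /msuppB_le; rewrite mem_cat !msuppX !inE => /orP[/eqP-> /eqP//|/eqP-> _] //.
Qed.

(** With this the field disappears: from here to the multiplicity, only the fibres of [mval]
    matter. *)
Lemma minimal_toric_generator m :
  minimal_monomial_generator (initial_ideal (toric_ideal K alpha a)) m ->
  (exists2 m', mval m' = mval m & grevlex_lt m' m) /\
  (forall k, m k != 0%N -> std (m - U_(k))%MM).
Proof.
case=> /initial_toricP h hmin; split.
  by apply: contrapT => h'; apply: h => m' e; apply/negP => lt; apply: h'; exists m'.
move=> k mk; apply: contrapT => /initial_toricP; apply: hmin; first exact: lem_subr.
apply/negP=> /eqP/mnmP/(_ k); rewrite !mnm_simpl eqxx; lia.
Qed.

End Toric.

(** * Classes modulo the vertices *)

Section Residues.
Variables (c d alpha : nat) (a : 'I_c -> 'X_{1..d}).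
Hypothesis alpha_gt1 : (1 < alpha)%N.
Hypothesis hA : simplicial_config alpha a.

Local Notation S := (semigroup alpha a).
Local Notation gens := (gens alpha a).
Local Notation mval := (mval alpha a).
Local Notation std := (@std c d alpha a).
Local Notation crit m := ((exists2 m', mval m' = mval m & grevlex_lt m' m) /\
  (forall k, m k != 0%N -> std (m - U_(k))%MM)).

Let alpha_gt0 : (0 < alpha)%N. Proof. exact: ltnW. Qed.

(** The x-factors are listed with repetition because the bounds count partial sums of this list. *)
Definition xpart (m : 'X_{1..c + d}) : seq 'I_c :=
  flatten [seq nseq (m (lshift d i)) i | i <- enum 'I_c].
Definition ypart (m : 'X_{1..c + d}) : 'X_{1..d} := [multinom m (rshift c j) | j < d].
Definition mjoin (u : 'I_c -> nat) (v : 'I_d -> nat) : 'X_{1..c + d} :=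
  [multinom match split k with inl i => u i | inr j => v j end | k < c + d].
Definition sumseq (us : seq 'I_c) : 'X_{1..d} := (\sum_(k <- us) a k)%MM.

Definition res (s : 'X_{1..d}) : 'X_{1..d} := [multinom (s i %% alpha)%N | i < d].
(** Since alpha a_i is a sum of vertices, coefficients below alpha reach every class of S; this
    makes the set of classes finite. *)
Definition small_sums : seq 'X_{1..d} :=
  [seq (\sum_i a i *+ (k i : nat))%MM | k : {ffun 'I_c -> 'I_alpha}].
Definition residues : seq 'X_{1..d} := undup (map res small_sums).

(** For [s] in S this is membership in the Apery set of S with respect to the vertices. *)
Definition good (s : 'X_{1..d}) := forall j t, S t -> s <> (t + U_(j) *+ alpha)%MM.

Lemma mdeg_config i : mdeg (a i) = alpha.
Proof. by case: hA. Qed.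

Lemma mdeg_gens k : mdeg (gens k) = alpha.
Proof.
by rewrite /Defs.gens; case: split => [i|j]; rewrite ?mdeg_config // mdegMn mdeg1 mul1n.
Qed.

Lemma mdeg_mval m : mdeg (mval m) = (alpha * mdeg m)%N.
Proof.
rewrite mval_sum mdeg_sum mdegE big_distrr /=; apply: eq_bigr => i _.
by rewrite mdegMn mdeg_gens.
Qed.

Lemma mdeg_mval_eq m m' : mval m = mval m' -> mdeg m = mdeg m'.
Proof. by move/(congr1 mdeg); rewrite !mdeg_mval => /eqP; rewrite eqn_pmul2l // => /eqP. Qed.

Lemma mjoinl u v i : mjoin u v (lshift d i) = u i.
Proof. by rewrite mnmE -[lshift d i]/(unsplit (inl i)) unsplitK. Qed.

Lemma mjoinr u v j : mjoin u v (rshift c j) = v j.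
Proof. by rewrite mnmE -[rshift c j]/(unsplit (inr j)) unsplitK. Qed.

Lemma mval_split m :
  mval m = (\sum_i a i *+ m (lshift d i) + ypart m *+ alpha)%MM.
Proof.
rewrite mval_sum big_split_ord /=; congr (_ + _)%MM.
  by apply: eq_bigr => i _; rewrite gens_lshift.
apply/mnmP=> k; rewrite mnm_sumE mulmnE mnmE (bigD1 k) //= big1.
  by rewrite gens_rshift !mnm_simpl eqxx mul1n addn0 mulnC.
by move=> j ne; rewrite gens_rshift !mnm_simpl (negbTE ne).
Qed.

Lemma sumseqE us i : sumseq us i = (\sum_(k <- us) a k i)%N.
Proof. exact: mnm_sumE. Qed.

Lemma big_xpart (R : Type) (idx : R) (op : Monoid.com_law idx) m (F : 'I_c -> R) :
  \big[op/idx]_(k <- xpart m) F k =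
  \big[op/idx]_i iterop (m (lshift d i)) op (F i) idx.
Proof.
rewrite /xpart big_flatten big_map big_enum /=; apply: eq_bigr => i _.
by rewrite big_nseq Monoid.iteropE.
Qed.

Lemma sumseq_xpart m : sumseq (xpart m) = (\sum_i a i *+ m (lshift d i))%MM.
Proof. exact: big_xpart. Qed.

Lemma mval_xy m : mval m = (sumseq (xpart m) + ypart m *+ alpha)%MM.
Proof. by rewrite mval_split sumseq_xpart. Qed.

Lemma size_xpart m : size (xpart m) = (\sum_i m (lshift d i))%N.
Proof.
rewrite -sum1_size big_xpart; apply: eq_bigr => i _.
by rewrite Monoid.iteropE iter_addn_0 mul1n.
Qed.

Lemma mdeg_xy m : mdeg m = (size (xpart m) + mdeg (ypart m))%N.
Proof.
rewrite !mdegE big_split_ord size_xpart /=; congr (_ + _)%N.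
by apply: eq_bigr => i _; rewrite mnmE.
Qed.

Lemma mdeg_sumseq us : mdeg (sumseq us) = (alpha * size us)%N.
Proof.
rewrite /sumseq mdeg_sum (eq_bigr (fun=> alpha)) => [|i _]; last exact: mdeg_config.
by rewrite big_const_seq count_predT iter_addn_0.
Qed.

Lemma semigroup_sumseq us : S (sumseq us).
Proof. by apply: semigroup_sum => i _; apply: semigroup_config. Qed.

Lemma semigroup_mulalpha z : S (z *+ alpha)%MM.
Proof.
suff -> : (z *+ alpha = \sum_j (U_(j) *+ alpha) *+ z j)%MM.
  by apply: semigroup_sum => j _; apply/semigroupM/semigroup_vertex.
apply/mnmP=> k; rewrite mnm_sumE mulmnE (bigD1 k) //= big1 => [|j ne].
  by rewrite !mnm_simpl eqxx addn0 mul1n mulnC.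
by rewrite !mnm_simpl (negbTE ne).
Qed.

Lemma dvdn_mdeg s : S s -> (alpha %| mdeg s)%N.
Proof. by case/semigroupP=> m ->; rewrite mdeg_mval dvdn_mulr. Qed.

(** A coordinate equal to alpha would exhaust the degree and make a_k a vertex, against the
    distinctness of the generators. *)
Lemma config_lt k i : (a k i < alpha)%N.
Proof.
rewrite ltnNge; apply/negP => h.
suff : gens (lshift d k) = gens (rshift c i).
  by case: hA => _ inj _ /inj /(congr1 val) /=; have := ltn_ord k; lia.
rewrite gens_lshift gens_rshift; apply/mnmP => j.
have := mdeg_config k; rewrite mdegE (bigD1 i) //= => e.
have e0 : (\sum_(j | j != i) a k j = 0)%N.
  have le : (a k i <= alpha)%N by rewrite -e leq_addr.
  by apply/eqP; rewrite -(eqn_add2l (a k i)) e addn0 eqn_leq h le.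
rewrite !mnm_simpl; case: eqP => [<-|/eqP ne].
  by rewrite mul1n -e e0 addn0.
by move/eqP: e0; rewrite sum_nat_eq0 => /forallP/(_ j); rewrite eq_sym ne => /eqP.
Qed.

Lemma config_gt0 k i j : i != j -> (forall l, l != i -> l != j -> a k l = 0%N) ->
  (0 < a k i)%N.
Proof.
move=> ij h; have := mdeg_config k; have := config_lt k j.
rewrite mdegE (bigD1 i) //= (bigD1 j) //= 1?eq_sym // big1; first lia.
by move=> l /andP[]; apply: h.
Qed.

Lemma config_inj : injective a.
Proof.
move=> i j e; apply: (@lshift_inj c d); case: hA => _ inj _; apply: inj.
by rewrite !gens_lshift.
Qed.

Lemma res_small (s : 'X_{1..d}) : (forall i, (s i < alpha)%N) -> res s = s.
Proof. by move=> h; apply/mnmP=> i; rewrite mnmE modn_small. Qed.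

Lemma res_config k : res (a k) = a k.
Proof. by apply: res_small => i; apply: config_lt. Qed.

Lemma res0 : res 0%MM = 0%MM.
Proof. by apply: res_small => i; rewrite mnm0E. Qed.

Lemma res_addz s z : res (s + z *+ alpha)%MM = res s.
Proof. by apply/mnmP=> i; rewrite !mnmE mulmnE addnC modnMDl. Qed.

Lemma resP s t : res s = res t <-> forall i, s i = t i %[mod alpha].
Proof.
split=> [/mnmP h i|h]; first by have := h i; rewrite !mnmE.
by apply/mnmP=> i; rewrite !mnmE h.
Qed.

Lemma semigroup_small s : S s ->
  exists2 t, t \in small_sums & exists z, s = (t + z *+ alpha)%MM.
Proof.
case/semigroupP=> m ->; rewrite mval_split.
pose k := [ffun i => Ordinal (ltn_pmod (m (lshift d i)) alpha_gt0)].
exists (\sum_i a i *+ (k i : nat))%MM; first by apply/mapP; exists k; rewrite ?mem_enum.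
exists (\sum_i a i *+ (m (lshift d i) %/ alpha) + ypart m)%MM.
apply/mnmP=> j; rewrite !mnm_simpl !mnm_sumE mulnDl addnA; congr (_ + _)%N.
rewrite big_distrl -big_split /=; apply: eq_bigr => i _.
rewrite !mulmnE ffunE /= -mulnA -mulnDr; congr (_ * _)%N.
by rewrite [LHS](divn_eq _ alpha) addnC.
Qed.

Lemma res_residues s : S s -> res s \in residues.
Proof.
case/semigroup_small=> t ht [z ->].
by rewrite mem_undup res_addz map_f.
Qed.

Lemma leq_residues (X : seq 'X_{1..d}) :
  (forall x, x \in X -> S x) -> uniq (map res X) -> (size X <= size residues)%N.
Proof.
move=> h u; rewrite -(size_map res); apply: uniq_leq_size => // r /mapP[x xX ->].
by apply/res_residues/h.
Qed.

(** A reduced [t] is the coordinatewise remainder of [s], so [s] is [t] plus vertices; a single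
    vertex would already contradict [good s]. *)
Lemma good_res_eq s t : S t -> (forall i, (t i < alpha)%N) -> good s ->
  res s = res t -> s = t.
Proof.
move=> St lt gs /resP e; pose z : 'X_{1..d} := [multinom (s i %/ alpha)%N | i < d].
have es : s = (t + z *+ alpha)%MM.
  by apply/mnmP=> i; rewrite mnmDE mulmnE mnmE {1}(divn_eq (s i) alpha) addnC e modn_small.
have [z0|] := eqVneq z 0%MM.
  by rewrite es z0; apply/mnmP=> i; rewrite !mnm_simpl mul0n addn0.
rewrite -mdeg_eq0 mdegE sum_nat_eq0 negb_forall => /existsP[j /= zj].
case: (gs j (t + (z - U_(j)) *+ alpha)%MM).
  exact/semigroupD/semigroup_mulalpha.
rewrite {1}es; apply/mnmP=> i; rewrite !mnm_simpl -addnA -mulnDl; congr (_ + _ * _)%N.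
by case: eqP => [<-|_] /=; rewrite ?subn0 ?addn0 // subn1 addn1 prednK // lt0n.
Qed.

Lemma good_sub s t : S t -> good (s + t)%MM -> good s.
Proof.
move=> St g j u Su e; apply: (g j (u + t)%MM); first exact: semigroupD.
by rewrite e; apply/mnmP=> i; rewrite !mnmDE; lia.
Qed.

(** The c + 1 reduced elements that occur in every count; they account for the codimension in the
    bound. *)
Definition base : seq 'X_{1..d} := 0%MM :: [seq a k | k : 'I_c].

Lemma res_base t : t \in base -> res t = t.
Proof.
by rewrite inE => /orP[/eqP->|/mapP[k _ ->]]; [exact: res0|exact: res_config].
Qed.

Lemma semigroup_base t : t \in base -> S t.
Proof.
by rewrite inE => /orP[/eqP->|/mapP[k _ ->]]; [exact: semigroup0|exact: semigroup_config].
Qed.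

Lemma mdeg_base t : t \in base -> (mdeg t <= alpha)%N.
Proof. by rewrite inE => /orP[/eqP->|/mapP[k _ ->]]; rewrite ?mdeg0 // mdeg_config. Qed.

Lemma uniq_base : uniq base.
Proof.
rewrite /= map_inj_uniq ?enum_uniq ?andbT; last exact: config_inj.
apply/mapP=> -[k _ /(congr1 mdeg)]; rewrite mdeg0 mdeg_config; lia.
Qed.

Lemma leq_residues_base (X : seq 'X_{1..d}) :
  (forall x, x \in X -> S x /\ res x \notin base) -> uniq (map res X) ->
  (size X + c < size residues)%N.
Proof.
move=> h u; have -> : (size X + c).+1 = size (base ++ X).
  by rewrite size_cat /= size_map size_enum_ord addSn addnC.
apply: leq_residues.
  by move=> x; rewrite mem_cat => /orP[/semigroup_base|/h[]].
rewrite map_cat (eq_in_map _ id _).1; last exact: res_base.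
rewrite map_id cat_uniq uniq_base u andbT; apply/hasPn=> r /mapP[x /h[_ nb] ->].
exact: nb.
Qed.

(** By [good_res_eq] a good element in the class of 0 or of some a_k equals it, and these have
    degree at most alpha. *)
Lemma good_notin_base s : good s -> (2 * alpha <= mdeg s)%N -> res s \notin base.
Proof.
move=> gs ms; apply/negP => hb.
have e := res_base hb; have := mdeg_base hb.
suff -> : res s = s by lia.
apply/esym/good_res_eq => //; first exact: semigroup_base.
by move=> i; rewrite mnmE ltn_pmod.
Qed.

Lemma sumseq_cat us vs : sumseq (us ++ vs) = (sumseq us + sumseq vs)%MM.
Proof. exact: big_cat. Qed.

Lemma good_take us k : good (sumseq us) -> good (sumseq (take k us)).
Proof.
by rewrite -{1}(cat_take_drop k us) sumseq_cat; apply/good_sub/semigroup_sumseq.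
Qed.

(** The difference of two congruent partial sums is again good and lies in the class of 0, hence is
    0; but it has positive degree. *)
Lemma good_res_take us i k : good (sumseq us) -> (i < k <= size us)%N ->
  res (sumseq (take i us)) <> res (sumseq (take k us)).
Proof.
move=> /(@good_take _ k) g /andP[ik ks].
have [r r0 ek] : exists2 r, (0 < r)%N & k = (i + r)%N by exists (k - i)%N; lia.
move: g; rewrite ek takeD sumseq_cat [(sumseq _ + _)%MM]addmC.
move/(good_sub (semigroup_sumseq _)) => gD /resP e.
have := good_res_eq (semigroup0 alpha a) _ gD.
move=> /(_ _ _)/(congr1 mdeg); rewrite mdeg0 mdeg_sumseq size_takel; last first.
  by rewrite size_drop; lia.
move=> h; suff : (alpha * r = 0)%N by lia.
apply: h => [j|]; first by rewrite mnm0E.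
apply/resP=> j; have /eqP := e j; rewrite mnmDE addnC -{1}[X in X == _ %[mod _]]addn0.
by rewrite eqn_modDl mnm0E => /eqP ->.
Qed.

Lemma uniq_res_take us m n : good (sumseq us) -> (m + n <= (size us).+1)%N ->
  uniq (map res [seq sumseq (take i us) | i <- iota m n]).
Proof.
move=> g le; rewrite -map_comp map_inj_in_uniq ?iota_uniq // => i k.
rewrite !mem_iota => /andP[mi im] /andP[mk km] /= e.
case: (ltngtP i k) => // h; exfalso.
  by apply: (@good_res_take us i k g _ e); lia.
by apply: (@good_res_take us k i g _ (esym e)); lia.
Qed.

(** The partial sums of length 0 and 1 are in [base] already, so only the lengths 2, ..., |us| are
    added to its c + 1 classes. *)
Lemma good_size us : good (sumseq us) -> (size us + c <= size residues)%N.
Proof.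
move=> g; pose X := [seq sumseq (take i us) | i <- iota 2 (size us).-1].
have := @leq_residues_base X; rewrite size_map size_iota => h.
suff : ((size us).-1 + c < size residues)%N by lia.
apply: h => [x /mapP[i]|].
  rewrite mem_iota => ilt ->; split; first exact: semigroup_sumseq.
  apply: good_notin_base; first exact: good_take.
  rewrite mdeg_sumseq size_takel; last by lia.
  by rewrite mulnC leq_pmul2l //; lia.
case: (ltnP 0 (size us)) => h; first by apply: uniq_res_take => //; lia.
by rewrite /X (_ : (size us).-1 = 0%N) //; lia.
Qed.

(** Were [m2] the smaller one, the deciding index would lie below [k0], and the two monomials would
    agree from [k0] on. *)
Lemma grevlex_tail (m1 m2 : 'X_{1..c + d}) (k0 : nat) : mdeg m1 = mdeg m2 ->
  (forall k : 'I_(c + d), (k0 <= k)%N -> m2 k = 0%N) ->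
  (exists2 k : 'I_(c + d), (k0 <= k)%N & m1 k != 0%N) -> grevlex_lt m1 m2.
Proof.
move=> e h2 [k kk0 m1k].
have ne : m1 != m2 by apply: contra_neq m1k => ->; apply: h2.
case: (grevlex_total ne) => // /grevlex_ltP[|[_ [i lt tl]]]; first by rewrite e ltnn.
have ik0 : (i < k0)%N.
  by rewrite ltnNge; apply/negP => /h2; lia.
by move: m1k; rewrite -tl ?h2 //; lia.
Qed.

Lemma std_le m m0 : (m0 <= m)%MM -> std m -> std m0.
Proof.
move=> le h m' e; apply/negP => lt; have := h (m' + (m - m0))%MM.
rewrite mvalD e -mvalD [(m0 + _)%MM]addmC submK // => /(_ erefl)/negP; apply.
rewrite -[X in grevlex_lt _ X](submK le) [X in grevlex_lt _ X]addmC.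
exact: grevlex_ltD.
Qed.

(** Otherwise a monomial of value [t] times y_j would be a smaller monomial in the same fibre, by
    [grevlex_tail]. *)
Lemma std_tail m (j : 'I_d) : std m ->
  (forall j' : 'I_d, (j <= j')%N -> m (rshift c j') = 0%N) ->
  forall t, S t -> mval m <> (t + U_(j) *+ alpha)%MM.
Proof.
move=> h tl t /semigroupP[m1 ->]; rewrite -(gens_rshift alpha a) -mval1 -mvalD => e.
have /negP := h _ (esym e); apply; apply: (@grevlex_tail _ _ (c + j)).
- exact/mdeg_mval_eq.
- move=> k; case: (split_ordP k) => [i -> /=|j' -> /=]; first by have := ltn_ord i; lia.
  by rewrite leq_add2l; apply: tl.
- by exists (rshift c j) => //; rewrite mnmDE mnm1E eqxx addn1.
Qed.

Lemma std_good m : std m -> ypart m = 0%MM -> good (sumseq (xpart m)).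
Proof.
move=> h y0 j t St; have : mval m = sumseq (xpart m).
  by rewrite mval_xy y0; apply/mnmP=> i; rewrite !mnm_simpl mul0n addn0.
move=> <-; apply: std_tail => // j' _.
by move/mnmP/(_ j'): y0; rewrite mnmE mnm0E.
Qed.

Lemma std_good_xpart m : std m -> good (sumseq (xpart m)).
Proof.
move=> h; pose m0 := mjoin (fun i => m (lshift d i)) (fun=> 0%N).
have -> : sumseq (xpart m) = sumseq (xpart m0).
  by rewrite !sumseq_xpart; apply: eq_bigr => i _; rewrite mjoinl.
apply: std_good; last by apply/mnmP=> j; rewrite mnmE mjoinr mnm0E.
apply: std_le h; apply/mnm_lepP=> k.
by case: (split_ordP k) => [i ->|j ->]; rewrite ?mjoinl ?mjoinr.
Qed.

(** Removing one y-factor makes the monomial standard and leaves its x-part unchanged. *)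
Lemma crit_xpart m : crit m -> ypart m != 0%MM -> good (sumseq (xpart m)).
Proof.
case=> _ h; rewrite -mdeg_eq0 mdegE sum_nat_eq0 negb_forall => /existsP[j /=].
rewrite mnmE => mj; have := std_good_xpart (h _ mj).
suff -> : xpart (m - U_(rshift c j))%MM = xpart m by [].
rewrite /xpart; congr flatten; apply: eq_map => i; rewrite !mnm_simpl.
by case: eqP => [/(congr1 val) /=|_]; [have := ltn_ord i; lia|rewrite subn0].
Qed.

Lemma crit_y_le1 m : crit m -> (mdeg (ypart m) <= 1)%N ->
  (mdeg m + c <= size residues + 1)%N.
Proof.
move=> hm le1; rewrite mdeg_xy.
have [y0|yn0] := eqVneq (ypart m) 0%MM; last first.
  by have := good_size (crit_xpart hm yn0); lia.
rewrite y0 mdeg0 addn0; have [x0|] := posnP (size (xpart m)).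
  have g0 : good (sumseq [::]).
    move=> j t St /(congr1 mdeg); rewrite mdeg_sumseq mdegD mdegMn mdeg1 /=; lia.
  by have := good_size g0; rewrite x0; move: (size residues) => k /=; lia.
rewrite size_xpart lt0n sum_nat_eq0 negb_forall => /existsP[i /= mi].
have := good_size (std_good_xpart (hm.2 _ mi)); rewrite !size_xpart.
rewrite (bigD1 i) //= [X in (_ -> X + _ <= _)%N](bigD1 i) //= !mnm_simpl eqxx.
rewrite (eq_bigr (fun j => m (lshift d j))) => [|j ne]; first by lia.
by rewrite !mnm_simpl (inj_eq (@lshift_inj _ _)) eq_sym (negbTE ne) subn0.
Qed.

(* The second monomial is chosen with as many y-factors as possible, so that
   its x-part cannot be rewritten with a factor y_k. *)
Lemma crit_data m : crit m -> ypart m != 0%MM ->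
  exists us (v : 'X_{1..d}) (j : 'I_d),
    [/\ mval m = (sumseq us + v *+ alpha)%MM, (size us + mdeg v = mdeg m)%N,
        good (sumseq us), v j != 0%N &
     [/\ forall k : 'I_d, (j <= k)%N -> ypart m k = 0%N,
         forall k, ypart m k != 0%N -> v k = 0%N &
         forall i, ypart m i != 0%N -> forall t, S t ->
         (sumseq (xpart m) + (ypart m - U_(i)) *+ alpha <> t + U_(j) *+ alpha)%MM]].
Proof.
move=> [hm hstd] y0.
(* A smaller monomial of the fibre shares no variable with [m]: cancelling a common one would
   contradict that [m - U_(k)] is standard. *)
have cop m' k : mval m' = mval m -> grevlex_lt m' m -> m k != 0%N -> m' k = 0%N.
  move=> e lt mk; apply/eqP; case: eqP => // /eqP m'k.
  have le : (U_(k) <= m)%MM by rewrite lep1mP.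
  have le' : (U_(k) <= m')%MM by rewrite lep1mP.
  exfalso; apply: (negP (hstd k mk (m' - U_(k))%MM _)).
    apply: (@addIm _ (mval U_(k)%MM)).
    by rewrite -!mvalD !submK.
  by apply: (@grevlex_ltD2 _ U_(k)%MM); rewrite !submK.
(* The last variable at which the two differ is some y_j: were it an x, their y-parts would agree
   and so vanish by [cop], against [y0]. After y_j both are without factors, again by [cop]. *)
have top m' : mval m' = mval m -> grevlex_lt m' m -> exists2 j : 'I_d,
    m' (rshift c j) != 0%N & forall k : 'I_d, (j <= k)%N -> ypart m k = 0%N.
  move=> e lt; case/grevlex_ltP: (lt) => [|[_ [i lti tl]]].
    by rewrite (mdeg_mval_eq e) ltnn.
  have tl0 (k : 'I_(c + d)) : (i < k)%N -> m k = 0%N.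
    move=> /[dup] ik /tl e1; apply/eqP; case: eqP => // /eqP mk.
    by move: (mk); rewrite -e1 (cop _ _ e lt mk).
  case: (split_ordP i) lti tl0 => [i' -> lti tl0|j -> lti tl0].
    case/negP: y0; apply/eqP/mnmP => k; rewrite mnmE mnm0E tl0 //=.
    by have := ltn_ord i'; lia.
  exists j; first by lia.
  move=> k; rewrite mnmE leq_eqVlt => /orP[/eqP/val_inj <-|jk]; last first.
    by apply: tl0 => /=; lia.
  by apply/eqP; case: eqP => // /eqP mk; rewrite (cop _ _ e lt mk) in lti.
pose P n := `[< exists m', [/\ mval m' = mval m, grevlex_lt m' m & mdeg (ypart m') = n]>].
have exP : exists n, P n.
  by case: hm => m' e lt; exists (mdeg (ypart m')); apply/asboolP; exists m'.
have bndP n : P n -> (n <= mdeg m)%N.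
  by move/asboolP=> [m' [/mdeg_mval_eq <- _ <-]]; rewrite (mdeg_xy m') leq_addl.
case: (ex_maxnP exP bndP) => n /asboolP[m' [e lt en]] maxn.
have [j m'j tl] := top _ e lt.
exists (xpart m'), (ypart m'), j; split.
- by rewrite -e mval_xy.
- by rewrite -mdeg_xy (mdeg_mval_eq e).
- move=> k t /semigroupP[m1 ->] e1.
  (* Rewriting the x-part of [m'] with a factor y_k keeps the value and, because of y_j, stays below
     [m], but has more y-factors than the maximum [n]. *)
  pose m2 := (m1 + U_(rshift c k) + mjoin (fun=> 0%N) (ypart m'))%MM.
  have e2 : mval m2 = mval m.
    rewrite /m2 !mvalD mval1 gens_rshift -e1 -e [RHS]mval_xy; congr (_ + _)%MM.
    rewrite mval_split; apply/mnmP=> l; rewrite !mnm_simpl mnm_sumE big1.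
      by rewrite [ypart _ l]mnmE mjoinr.
    by move=> i _; rewrite mulmnE mjoinl muln0.
  have lt2 : grevlex_lt m2 m.
    apply: (@grevlex_tail _ _ (c + j)); first exact: mdeg_mval_eq.
      move=> l; case: (split_ordP l) => [i -> /=|l' -> /=]; first by have := ltn_ord i; lia.
      by rewrite leq_add2l => /tl; rewrite mnmE.
    by exists (rshift c j) => //; rewrite !mnm_simpl mjoinr mnmE; lia.
  have := maxn (mdeg (ypart m2)).
  have h : P (mdeg (ypart m2)) by apply/asboolP; exists m2.
  move/(_ h); suff : (n < mdeg (ypart m2))%N by lia.
  have hle l : (ypart m2 l = m1 (rshift c l) + (k == l) + ypart m' l)%N.
    by rewrite mnmE !mnm_simpl mjoinr (inj_eq (@rshift_inj _ _)).
  rewrite -en !mdegE (bigD1 k) //= [X in (_ < X)%N](bigD1 k) //= hle eqxx.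
  have : (\sum_(i | i != k) ypart m' i <= \sum_(i | i != k) ypart m2 i)%N.
    by apply: leq_sum => i _; rewrite hle leq_addl.
  move=> le; apply: leq_ltn_trans (leq_add (leqnn _) le) _; rewrite ltn_add2r; lia.
- by rewrite mnmE.
- split=> //.
    by move=> k; rewrite !mnmE; exact: cop.
  move=> i; rewrite mnmE => mi t St e1.
  have := @std_tail _ j (hstd _ mi) _ t St; apply.
    move=> k /tl; rewrite mnmE => mk; rewrite mnmBE mk //.
  rewrite -e1 mval_split sumseq_xpart; congr (_ + _)%MM.
    apply: eq_bigr => k _; rewrite !mnm_simpl; congr (_ *+ _)%MM.
    by case: eqP => [/(congr1 val) /=|_]; [have := ltn_ord k; lia|rewrite subn0].
  congr (_ *+ _)%MM; apply/mnmP=> k.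
  by rewrite !mnmE (inj_eq (@rshift_inj _ _)).
Qed.

End Residues.

(** * Dimension two *)

(** The difference of the two sides is a multiple of alpha, so it is nonnegative as soon as it
    exceeds -alpha. *)
Lemma congr_step (alpha k x y : nat) : x = y %[mod alpha] ->
  (y + k * alpha < x + alpha)%N -> (y + k * alpha <= x)%N.
Proof.
move=> e; rewrite (divn_eq x alpha) (divn_eq y alpha) e addnAC -mulnDl.
rewrite [(_ + _ + alpha)%N]addnAC -mulSnr ltn_add2r leq_add2r.
by have [->|a0] := posnP alpha; rewrite ?muln0 // ltn_pmul2r // leq_pmul2r.
Qed.

(** The mean of an initial segment of an ascending list is at most the mean of the whole list, with
    denominators multiplied out. *)
Lemma sum_take_sorted (T : Type) (f : T -> nat) (s : seq T) x :
  (x <= size s)%N -> sorted (fun k l => (f k <= f l)%N) s ->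
  ((\sum_(k <- take x s) f k) * size s <= x * \sum_(k <- s) f k)%N.
Proof.
move=> xs srt; have tr : transitive (fun k l => (f k <= f l)%N).
  by move=> l k m; apply: leq_trans.
move: srt; rewrite (sorted_pairwise tr) -{1}(cat_take_drop x s) pairwise_cat.
case/andP=> rel _; rewrite -{2 3}(cat_take_drop x s) size_cat big_cat /=.
rewrite size_takel // mulnDr mulnDr mulnC leq_add2l.
have := size_takel xs; move: rel; move: (take x s) (drop x s) => s1 s2.
move=> + <-; elim: s1 => [|k s1 IH]; first by rewrite big_nil !mul0n.
rewrite allrel_consl => /andP[h /IH le]; rewrite big_cons /= mulSn mulnDl leq_add //.
elim: s2 h {IH le} => [|l s2 IH] /=; first by rewrite muln0.
by case/andP=> kl /IH le; rewrite big_cons mulnS leq_add.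
Qed.

Section DimensionTwo.
Variables (c d alpha : nat) (a : 'I_c -> 'X_{1..d}).
Hypothesis alpha_gt1 : (1 < alpha)%N.
Hypothesis hA : simplicial_config alpha a.

Local Notation S := (semigroup alpha a).
Local Notation mval := (mval alpha a).
Local Notation std := (@std c d alpha a).
Local Notation sumseq := (sumseq a).
Local Notation residues := (residues alpha a).

(* [u] and [u'] are sorted by their i-th and j-th coordinates, so that the
   i-th coordinate of a partial sum of [u] and the j-th one of a partial sum of
   [u'] lie below the average; two congruent partial sums would contradict this
   or produce [q = b + (y - 1) e_i - e_j] in [S]. *)
Lemma partial_sums_not_congr (i j : 'I_d) (u u' : seq 'I_c) (y v p p' x x' : nat) :
  i != j -> (forall k : 'I_d, k = i \/ k = j) ->
  size u = p -> size u' = p' -> (0 < y)%N -> (0 < v)%N ->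
  (sumseq u i + y * alpha = sumseq u' i)%N ->
  (sumseq u j = sumseq u' j + v * alpha)%N ->
  (forall t, S t -> res alpha t = res alpha (sumseq u) ->
     ~ ((t i <= sumseq u i + y.-1 * alpha)%N /\ (t j + alpha <= sumseq u j)%N)) ->
  sorted (fun k l => (a k i <= a l i)%N) u ->
  sorted (fun k l => (a k j <= a l j)%N) u' ->
  (0 < x <= v)%N -> (0 < x' <= p')%N ->
  res alpha (sumseq (take x u)) <> res alpha (sumseq (take x' u')).
Proof.
move=> ij h2 szu szu' y0 v0 ei ej hq su su' /andP[x0 xv] /andP[x'0 x'p] /resP e.
have tot s : mdeg s = (s i + s j)%N.
  rewrite mdegE (bigD1 i) //= (bigD1 j) /= 1?eq_sym // big1 ?addn0 // => k /andP[].
  by case: (h2 k) => ->; rewrite eqxx.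
have totu us : (sumseq us i + sumseq us j = alpha * size us)%N.
  by rewrite -tot; apply: mdeg_sumseq.
have xp : (x <= p)%N.
  have := totu u; rewrite szu ej; move: (sumseq u' j) (sumseq u i) => A B; nia.
set W := sumseq (take x u); set W' := sumseq (take x' u').
set V := sumseq (drop x u); set V' := sumseq (drop x' u').
have eb : sumseq u = (W + V)%MM by rewrite -sumseq_cat cat_take_drop.
have eb' : sumseq u' = (W' + V')%MM by rewrite -sumseq_cat cat_take_drop.
have tW : (W i + W j = alpha * x)%N by rewrite totu size_takel ?szu.
have tW' : (W' i + W' j = alpha * x')%N by rewrite totu size_takel ?szu'.
have Wi : (0 < W i)%N.
  rewrite /W; case: u su szu xp {eb V W tW e ei ej hq} => [|k u] _ /= <-; first lia.
  case: x x0 {xv} => // x _ _; rewrite sumseqE /= big_cons.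
  rewrite ltn_addr //; apply: (@config_gt0 _ _ _ _ alpha_gt1 hA k i j) => // l li lj.
  by case: (h2 l) => el; rewrite el eqxx in li lj.
have SW us : S (sumseq us) by apply: semigroup_sumseq.
(* Exchanging the tails yields two elements of S in the class of [sumseq u], and [hq] applies to
   both. *)
have q1 := hq (W' + V)%MM (semigroupD (SW _) (SW _)).
have q2 := hq (W + V')%MM (semigroupD (SW _) (SW _)).
have r1 : res alpha (W' + V)%MM = res alpha (sumseq u).
  by apply/resP=> k; rewrite eb !mnmDE; apply/eqP; rewrite eqn_modDr -(e k).
have r2 : res alpha (W + V')%MM = res alpha (sumseq u).
  apply/resP=> k; rewrite mnmDE -modnDml (e k) modnDml -mnmDE -eb'.
  case: (h2 k) => ->; first by rewrite -ei addnC modnMDl.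
  by rewrite ej [(_ + v * _)%N]addnC modnMDl.
move: {q1 q2} (q1 r1) (q2 r2); rewrite !mnmDE => q1 q2.
have eiV : (W i + V i + y * alpha = W' i + V' i)%N by rewrite -!mnmDE -eb -eb'.
have ejV : (W j + V j = W' j + V' j + v * alpha)%N by rewrite -!mnmDE -eb -eb'.
rewrite eb !mnmDE in q1 q2.
have caseAB : (W i + y * alpha <= W' i)%N \/ (W j <= W' j)%N.
  case: (leqP (W' i) (W i + y.-1 * alpha)) => h; last first.
    left; apply: congr_step; first by rewrite -(e i).
    by case: (y) y0 h => // y' _ /=; rewrite mulSn; lia.
  right; rewrite -[W j]addn0 -(mul0n alpha); apply: congr_step; first by rewrite -(e j).
  rewrite mul0n addn0 ltnNge; apply/negP => h'; apply: q1; split; lia.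
(* Here x <= v is decisive: [W i] is positive, so [W j] is below alpha x <= alpha v and cannot reach
   [W' j + v * alpha]. *)
have caseA : ~ (W i + y * alpha <= W' i)%N.
  move=> hi; have : (W' j + v * alpha <= W j)%N.
    apply: congr_step; first exact: (e j).
    rewrite ltnNge; apply/negP => h'; apply: q2; split; last by lia.
    case: (y) y0 hi eiV => // y' _; rewrite mulSn /=; lia.
  have := leq_mul xv (leqnn alpha); lia.
case: caseAB => // hj.
have hi : (W' i <= W i)%N.
  rewrite -[W' i]addn0 -(mul0n alpha); apply: congr_step; first exact: (e i).
  rewrite mul0n addn0 ltnNge; apply/negP => h'; apply: q2; split.
    by case: (y) y0 eiV => // y' _; rewrite mulSn /=; lia.
  by case: (v) v0 ejV => // v' _; rewrite mulSn; lia.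
have avgW : (W i * p <= x * sumseq u i)%N.
  have := @sum_take_sorted _ (fun k => a k i) u x; rewrite szu => /(_ xp su).
  by rewrite /W !sumseqE.
have avgW' : (W' j * p' <= x' * sumseq u' j)%N.
  have := @sum_take_sorted _ (fun k => a k j) u' x'; rewrite szu' => /(_ x'p su').
  by rewrite /W' !sumseqE.
have := totu u; have := totu u'; rewrite szu szu' => t' t.
move: (sumseq u i) (sumseq u' j) (sumseq u j) (sumseq u' i) avgW avgW' t t' ei ej.
move: (W i) (W' j) (W j) (W' i) tW tW' hi hj Wi => A B A' B' tW tW' hi hj Wi.
move=> T T' T2 T2' avgW avgW' t t' ei ej {eb eb' eiV ejV q1 q2 caseA V V' W W' r1 r2 hq e}.
(* Both alpha x and alpha x' are at most A + B. The two mean values then give alpha <= T / p + T' /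
   p', whereas T + T' is smaller than alpha p and than alpha p'. *)
have hM : (alpha * maxn x x' <= A + B)%N by case: (leqP x x'); lia.
have M0 : (0 < maxn x x')%N by lia.
have le1 : (alpha * maxn x x' * (p * p') <= maxn x x' * (T * p' + T' * p))%N.
  apply: leq_trans (leq_mul hM (leqnn _)) _; rewrite mulnDl mulnDr.
  have lex : (x * T <= maxn x x' * T)%N by rewrite leq_mul2r leq_maxl orbT.
  have lex' : (x' * T' <= maxn x x' * T')%N by rewrite leq_mul2r leq_maxr orbT.
  apply: leq_add.
    by rewrite mulnA [leqRHS]mulnA leq_mul // (leq_trans avgW).
  by rewrite [(p * p')%N]mulnC mulnA [leqRHS]mulnA leq_mul // (leq_trans avgW').
have {le1} : (alpha * (p * p') <= T * p' + T' * p)%N.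
  by rewrite -(leq_pmul2l M0) mulnA [(maxn _ _ * alpha)%N]mulnC.
apply/negP; rewrite -ltnNge.
have e1 : (T + T' + v * alpha = alpha * p)%N by lia.
have e2 : (T + T' + y * alpha = alpha * p')%N by lia.
have p0 : (0 < p)%N by lia.
have p'0 : (0 < p')%N by lia.
have av : (0 < v * alpha)%N by rewrite muln_gt0 v0 ltnW.
have ay : (0 < y * alpha)%N by rewrite muln_gt0 y0 ltnW.
case: (leqP p p') => pp.
  apply: (@leq_ltn_trans ((T + T') * p')); first by rewrite mulnDl leq_add2l leq_mul2l pp orbT.
  by rewrite mulnA -e1 ltn_pmul2r //; lia.
apply: (@leq_ltn_trans ((T + T') * p)).
  by rewrite mulnDl leq_add2r leq_mul2l (ltnW pp) orbT.
by rewrite [(p * _)%N]mulnC mulnA -e2 ltn_pmul2r //; lia.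
Qed.

(** The degree is read off the second monomial as |u'| + v_j. The partial sums of u' of lengths 2,
    ..., |u'|, those of u of lengths 2, ..., v_j, and the c + 1 base classes are |u'| + v_j + c - 1
    distinct classes. *)
Lemma crit_dim2 m : d = 2%N ->
  (exists2 m', mval m' = mval m & grevlex_lt m' m) /\
    (forall k, m k != 0%N -> std (m - U_(k))%MM) ->
  (mdeg m + c <= size residues + 1)%N.
Proof.
move=> d2 hm; have [y0|yn0] := eqVneq (ypart m) 0%MM.
  by apply: (crit_y_le1 alpha_gt1) => //; rewrite y0 mdeg0.
have [us [v [j [ev edeg gus vj [tl cop hq]]]]] := crit_data alpha_gt1 hA hm yn0.
have gx := crit_xpart alpha_gt1 hA hm yn0.
have [i yi] : exists i, ypart m i != 0%N.
  by move: yn0; rewrite -mdeg_eq0 mdegE sum_nat_eq0 negb_forall => /existsP[i]; exists i.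
have ij : i != j by apply: contraNneq yi => ->; rewrite tl.
have h2 k : k = i \/ k = j.
  have [h|ki] := eqVneq k i; [by left|right]; apply/val_inj; move: ij ki.
  rewrite -!val_eqE /=; have := (ltn_ord i, ltn_ord j, ltn_ord k).
  by move: (nat_of_ord i) (nat_of_ord j) (nat_of_ord k) => x y z; rewrite d2 => -[[]]; lia.
pose u := sort (fun k l => (a k i <= a l i)%N) (xpart m).
pose u' := sort (fun k l => (a k j <= a l j)%N) us.
have pu : perm_eq (xpart m) u by rewrite perm_sym; apply/permEl/perm_sort.
have pu' : perm_eq us u' by rewrite perm_sym; apply/permEl/perm_sort.
have eu : sumseq (xpart m) = sumseq u by apply: perm_big.
have eu' : sumseq us = sumseq u' by apply: perm_big.
have su : sorted (fun k l => (a k i <= a l i)%N) u.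
  by apply: sort_sorted => k l; apply: leq_total.
have su' : sorted (fun k l => (a k j <= a l j)%N) u'.
  by apply: sort_sorted => k l; apply: leq_total.
have gu : good alpha a (sumseq u) by rewrite -eu.
have gu' : good alpha a (sumseq u') by rewrite -eu'.
have e := ev; rewrite mval_xy eu eu' in e.
have yj0 : ypart m j = 0%N by apply: tl.
have vi0 : v i = 0%N by apply: cop.
have ei : (sumseq u i + ypart m i * alpha = sumseq u' i)%N.
  by move/mnmP/(_ i): e; rewrite !mnm_simpl vi0 mul0n addn0.
have ej : (sumseq u j = sumseq u' j + v j * alpha)%N.
  by move/mnmP/(_ j): e; rewrite !mnm_simpl yj0 mul0n addn0.
have hq' t : S t -> res alpha t = res alpha (sumseq u) ->
   ~ ((t i <= sumseq u i + (ypart m i).-1 * alpha)%N /\ (t j + alpha <= sumseq u j)%N).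
  move=> St /resP er [le1 le2].
  (* Vertices fill [t] up to the point that [hq] keeps out of S; the two bounds on [t] make the
     coordinates of [z] nonnegative. *)
  pose z : 'X_{1..d} := [multinom if k == i then
    ((sumseq u i + (ypart m i).-1 * alpha - t i) %/ alpha)%N else
    ((sumseq u j - alpha - t j) %/ alpha)%N | k < d].
  apply: (hq i yi (t + z *+ alpha)%MM).
    exact/semigroupD/semigroup_mulalpha.
  rewrite eu; apply/mnmP=> k; rewrite !mnm_simpl [z k]mnmE.
  case: (h2 k) => ->; rewrite !eqxx /=.
    rewrite [j == i]eq_sym (negbTE ij) mul0n addn0 subn1 /= divnK; first by lia.
    by rewrite -eqn_mod_dvd // addnC modnMDl er.
  rewrite [j == i]eq_sym (negbTE ij) yj0 sub0n mul0n addn0 mul1n /= divnK; first by lia.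
  rewrite -eqn_mod_dvd; last by lia.
  by rewrite -(modnDr (_ - _)) subnK ?er //; lia.
have p'0 : (0 < size u')%N.
  move: ei; case: (u') => //=; rewrite [sumseq [::] i]sumseqE big_nil.
  have := lt0n (ypart m i); rewrite yi; nia.
have tot s : mdeg s = (s i + s j)%N.
  rewrite mdegE (bigD1 i) //= (bigD1 j) /= 1?eq_sym // big1 ?addn0 // => k /andP[].
  by case: (h2 k) => ->; rewrite eqxx.
have vp : (v j <= size u)%N.
  have := tot (sumseq u); rewrite (mdeg_sumseq hA) ej.
  move: (size u) (sumseq u' j) (sumseq u i) => A B C; nia.
have mv : mdeg v = v j by rewrite tot vi0.
rewrite -edeg mv (perm_size pu').
pose X := [seq sumseq (take x u') | x <- iota 2 (size u').-1] ++
          [seq sumseq (take x u) | x <- iota 2 (v j).-1].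
have := @leq_residues_base _ _ _ _ alpha_gt1 hA X.
rewrite size_cat !size_map !size_iota => hX.
suff : ((size u').-1 + (v j).-1 + c < size residues)%N.
  by move: (size residues) (v j) vj (size u') p'0 => *; lia.
have big w k : good alpha a (sumseq w) -> (1 < k <= size w)%N ->
    S (sumseq (take k w)) /\ res alpha (sumseq (take k w)) \notin base a.
  move=> gw kw; split; first exact: semigroup_sumseq.
  apply: (good_notin_base alpha_gt1 hA) => //; first exact: good_take.
  rewrite (mdeg_sumseq hA) size_takel; last by lia.
  by rewrite mulnC leq_pmul2l; lia.
apply: hX => [s|].
  rewrite mem_cat => /orP[] /mapP[x]; rewrite mem_iota => hx ->; apply: big => //; lia.
have lt0 := lt0n (v j); rewrite vj in lt0.
rewrite map_cat cat_uniq; apply/and3P; split.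
- by apply: (uniq_res_take alpha_gt1 hA gu'); lia.
- apply/hasPn=> r; rewrite -map_comp => /mapP[x]; rewrite mem_iota => hx -> /=.
  apply/negP; rewrite -map_comp => /mapP[x']; rewrite mem_iota => hx' /= er.
  apply: (partial_sums_not_congr ij h2 (erefl _) (erefl _) _ lt0 ei ej hq' su su' _ _ er).
  + by rewrite lt0n.
  + by lia.
  + by lia.
- by apply: (uniq_res_take alpha_gt1 hA gu); lia.
Qed.

End DimensionTwo.

(** * The Buchsbaum and the near-vertex case *)

Section Buchsbaum.
Variables (c d alpha : nat) (a : 'I_c -> 'X_{1..d}).
Hypothesis alpha_gt1 : (1 < alpha)%N.
Hypothesis hA : simplicial_config alpha a.

Local Notation S := (semigroup alpha a).
Local Notation mval := (mval alpha a).
Local Notation std := (@std c d alpha a).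
Local Notation residues := (residues alpha a).

(** The weak-sequence condition for the parameters y_j^N, y_i^N on exponents: if t^f y_i^N lies in
    the ideal of y_j^N, then so does t^f t^s for every monomial t^s other than 1. *)
Definition buchsbaum_semigroup := forall (i j : 'I_d) N f f' s,
  i != j -> (0 < N)%N -> S f -> S f' ->
  (f + U_(i) *+ (N * alpha) = f' + U_(j) *+ (N * alpha))%MM ->
  S s -> s != 0%MM -> exists2 g, S g & (g + U_(j) *+ (N * alpha) = f + s)%MM.

(* Applied to [q = b + (y - e_i) - e_j] and then to [q - e_i'], the Buchsbaum
   property excludes two factors y_i y_i' of a minimal generator. *)
Lemma crit_buchsbaum m : buchsbaum_semigroup ->
  (exists2 m', mval m' = mval m & grevlex_lt m' m) /\
    (forall k, m k != 0%N -> std (m - U_(k))%MM) ->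
  (mdeg m + c <= size residues + 1)%N.
Proof.
move=> hB hm; have [y0|yn0] := eqVneq (ypart m) 0%MM.
  by apply: (crit_y_le1 alpha_gt1) => //; rewrite y0 mdeg0.
have [us [v [j [ev edeg gus vj [tl cop hq]]]]] := crit_data alpha_gt1 hA hm yn0.
have supp_neq0 (z : 'X_{1..d}) : z != 0%MM -> exists i, z i != 0%N.
  by rewrite -mdeg_eq0 mdegE sum_nat_eq0 negb_forall => /existsP[i]; exists i.
have [i yi] := supp_neq0 _ yn0.
have neqj k : ypart m k != 0%N -> k != j by move=> h; apply: contraNneq h => ->; rewrite tl.
have [yi0|] := eqVneq (ypart m - U_(i))%MM 0%MM.
  apply: (crit_y_le1 alpha_gt1) => //.
  have -> : ypart m = U_(i)%MM; last by rewrite mdeg1.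
  by rewrite -[LHS](@submK _ U_(i)%MM) ?yi0 ?add0m ?lep1mP.
move/supp_neq0 => [i' yi']; exfalso.
have yi'0 : ypart m i' != 0%N by move: yi'; rewrite mnmBE; apply: contraNneq => ->.
pose b := sumseq a (xpart m).
have Sb : S b by apply: semigroup_sumseq.
(* In terms of the point q outside S, with e_k for the vertices: here f = q + e_j, f' = q + e_i and
   s = e_i', and the result is g1 = q + e_i'. *)
have hB1 := hB i j 1%N (b + (ypart m - U_(i)) *+ alpha)%MM
  (sumseq a us + (v - U_(j)) *+ alpha)%MM (U_(i') *+ alpha)%MM (neqj _ yi) isT.
have [||||| g1 Sg1 e1] := hB1.
- exact/semigroupD/semigroup_mulalpha.
- exact/semigroupD/semigroup_mulalpha/semigroup_sumseq.
- move/mnmP: ev => ev; apply/mnmP=> k; have := ev k; rewrite mval_xy.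
  rewrite -/b !mnm_simpl mul1n.
  have : ((i == k) <= ypart m k)%N by case: eqP => [<-|]; rewrite ?lt0n.
  have : ((j == k) <= v k)%N by case: eqP => [<-|]; rewrite ?lt0n.
  rewrite !mulnBl => h1 h2; have := leq_mul h1 (leqnn alpha).
  by have := leq_mul h2 (leqnn alpha); lia.
- exact: semigroup_vertex.
- by rewrite -mdeg_eq0 mdegMn mdeg1 mul1n -lt0n ltnW.
(* Now f = q - e_i' + 2 e_j and f' = q + e_i'. The exponent is N = 2 because N = 1 would require q
   itself as f'. The result is g2 = q, which [hq] excludes. *)
have hB2 := hB i' j 2%N (b + (ypart m - U_(i) - U_(i')) *+ alpha + U_(j) *+ alpha)%MM
  g1 (U_(i') *+ alpha)%MM (neqj _ yi'0) isT.
have le2 k : ((i' == k) <= (ypart m - U_(i))%MM k)%N by case: eqP => [<-|]; rewrite ?lt0n.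
have [||||| g2 Sg2 e2] := hB2.
- exact/semigroupD/semigroup_vertex/semigroupD/semigroup_mulalpha.
- exact: Sg1.
- move/mnmP: e1 => e1; apply/mnmP=> k; have := e1 k; have := leq_mul (le2 k) (leqnn alpha).
  rewrite !mnm_simpl !mulnBl; lia.
- exact: semigroup_vertex.
- by rewrite -mdeg_eq0 mdegMn mdeg1 mul1n -lt0n ltnW.
apply: (hq i yi g2 Sg2).
move/mnmP: e2 => e2; apply/mnmP=> k; have := e2 k; have := leq_mul (le2 k) (leqnn alpha).
rewrite -/b !mnm_simpl !mulnBl; lia.
Qed.

End Buchsbaum.

(** * Semigroups containing all points near the vertices *)

Section NearVertices.
Variables (c d alpha : nat) (a : 'I_c -> 'X_{1..d}).
Hypothesis alpha_gt1 : (1 < alpha)%N.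
Hypothesis hA : simplicial_config alpha a.
Hypothesis near : contains_all_near_vertices alpha a.

Local Notation S := (semigroup alpha a).
Local Notation mval := (mval alpha a).
Local Notation std := (@std c d alpha a).
Local Notation residues := (residues alpha a).

Lemma mnm_neq0 (n : nat) (z : 'X_{1..n}) : z != 0%MM -> exists i, z i != 0%N.
Proof.
by rewrite -mdeg_eq0 mdegE sum_nat_eq0 negb_forall => /existsP[i]; exists i.
Qed.

(* A near vertex (alpha - 1) e_i + e_j, or a vertex if i = j, is a "transport"
   from i to j, so only the two marginals matter. *)
Lemma near_transport (s t : 'X_{1..d}) : mdeg s = mdeg t -> S (s *+ (alpha - 1) + t)%MM.
Proof.
have S2 i j : S (U_(i) *+ (alpha - 1) + U_(j))%MM.
  have [->|ij] := eqVneq i j; last by have [k <-] := near ij; apply: semigroup_gens.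
  have -> : (U_(j) *+ (alpha - 1) + U_(j) = U_(j) *+ alpha)%MM; last exact: semigroup_vertex.
  by apply/mnmP=> k; rewrite !mnm_simpl; case: eqP => _; lia.
move en : (mdeg s) => n; elim: n s t en => [|n IH] s t es et.
  have -> : s = 0%MM by apply/eqP; rewrite -mdeg_eq0 es.
  have -> : t = 0%MM by apply/eqP; rewrite -mdeg_eq0 -et.
  rewrite (_ : (_ + _)%MM = 0%MM); first exact: semigroup0.
  by apply/mnmP=> k; rewrite !mnm_simpl.
have [i si] : exists i, s i != 0%N by apply: mnm_neq0; rewrite -mdeg_eq0 es.
have [j tj] : exists j, t j != 0%N by apply: mnm_neq0; rewrite -mdeg_eq0 -et.
have les : (U_(i) <= s)%MM by rewrite lep1mP.
have let_ : (U_(j) <= t)%MM by rewrite lep1mP.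
rewrite -(submK les) -(submK let_).
have -> : ((s - U_(i) + U_(i)) *+ (alpha - 1) + (t - U_(j) + U_(j)) =
  (s - U_(i)) *+ (alpha - 1) + (t - U_(j)) + (U_(i) *+ (alpha - 1) + U_(j)))%MM.
  by apply/mnmP=> k; rewrite !mnm_simpl; lia.
apply: semigroupD => //; apply: IH.
  by have := congr1 mdeg (submK les); rewrite mdegD mdeg1 es; lia.
by have := congr1 mdeg (submK let_); rewrite mdegD mdeg1 -et; lia.
Qed.

Lemma exists_submnm (b : 'X_{1..d}) n : (n <= mdeg b)%N ->
  exists2 s : 'X_{1..d}, mdeg s = n & (s <= b)%MM.
Proof.
elim: n => [|n IH] h.
  by exists 0%MM; [rewrite mdeg0|apply/mnm_lepP=> i; rewrite mnm0E].
have [s es /mnm_lepP le] := IH (ltnW h).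
have [i si] : exists i, (s i < b i)%N.
  apply: contrapT => hn; move: h; rewrite -es ltnNge => /negP; apply.
  rewrite !mdegE; apply: leq_sum => i _; rewrite leqNgt; apply/negP => lt.
  by apply: hn; exists i.
exists (s + U_(i))%MM; first by rewrite mdegD mdeg1 es addn1.
apply/mnm_lepP=> k; rewrite !mnm_simpl; case: eqP => [<-|_]; first by rewrite addn1.
by rewrite addn0.
Qed.

(** The hypothesis leaves room for some [s] of degree n with (alpha - 1) s <= q. The rest of q has
    degree n as well, so [near_transport] applies. *)
Lemma near_floor (q : 'X_{1..d}) n : mdeg q = (alpha * n)%N ->
  (n <= \sum_i q i %/ (alpha - 1))%N -> S q.
Proof.
move=> eq le; pose b : 'X_{1..d} := [multinom (q i %/ (alpha - 1))%N | i < d].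
have [|s es /mnm_lepP sb] := @exists_submnm b n.
  by rewrite mdegE; apply: leq_trans le _; apply: leq_sum => i _; rewrite mnmE.
have sq : (s *+ (alpha - 1) <= q)%MM.
  apply/mnm_lepP=> i; rewrite mulmnE; apply: leq_trans (leq_trunc_div _ (alpha - 1)).
  by rewrite leq_mul2r; have := sb i; rewrite mnmE => ->; rewrite orbT.
rewrite -(submK sq) addmC; apply: near_transport; rewrite es.
have := congr1 mdeg (submK sq); rewrite mdegD mdegMn es eq; nia.
Qed.

(** For a gap the floors add up to at most n - 1, and every remainder is at most alpha - 2. Hence
    alpha n <= (n - 1)(alpha - 1) + d (alpha - 2), which rearranges to the bound. *)
Lemma near_gap_bound (q : 'X_{1..d}) n : (0 < d)%N -> mdeg q = (alpha * n)%N -> ~ S q ->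
  (n < (d - 1) * (alpha - 2))%N.
Proof.
move=> d0 eq nS; have lt : (\sum_i q i %/ (alpha - 1) < n)%N.
  by rewrite ltnNge; apply/negP => /(near_floor eq).
have : (mdeg q <= \sum_i (q i %/ (alpha - 1) * (alpha - 1) + (alpha - 2)))%N.
  rewrite mdegE; apply: leq_sum => i _; rewrite {1}(divn_eq (q i) (alpha - 1)) leq_add2l.
  by rewrite -ltnS -subSn // subSS ltn_pmod // subn_gt0.
rewrite big_split /= -big_distrl /= sum_nat_const card_ord eq.
move: lt; move: (\sum_i _)%N => A lt.
case: d d0 => // d' _; case: (alpha) alpha_gt1 => [|[|al]] // _.
rewrite !subSS !subn0 mulSn => h.
have := leq_mul lt (leqnn al); lia.
Qed.

(** Besides [base], (d - 1)(alpha - 2) - 1 reduced vectors of degree 2 alpha are exhibited: being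
    reduced they represent distinct classes, and their degree keeps them out of [base]. *)
Lemma near_residues_bound : (2 < d)%N -> (2 < alpha)%N ->
  (c + (d - 1) * (alpha - 2) <= size residues)%N.
Proof.
move=> d3 al3; have d0 : (0 < d)%N by apply: ltn_trans d3.
pose o := Ordinal d0; pose k1 := Ordinal (ltnW d3).
have ld : (d.-1 < d)%N by rewrite prednK.
pose l := Ordinal ld.
pose W (x z : nat) (k : 'I_d) (y : nat) : 'X_{1..d} :=
  (U_(o) *+ x + U_(k) *+ y + U_(l) *+ (z - y))%MM.
pose ks := [seq k <- enum 'I_d | (k != o) && (k != l)].
have ol : o != l by rewrite -val_eqE /=; lia.
have szks : size ks = (d - 2)%N.
  have := count_predC (fun k => (k != o) && (k != l)) (enum 'I_d).
  rewrite size_enum_ord /ks size_filter.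
  suff -> : count (predC (fun k => (k != o) && (k != l))) (enum 'I_d) = 2%N by lia.
  rewrite (eq_count (a2 := predU (pred1 o) (pred1 l))); last first.
    by move=> k /=; rewrite negb_and !negbK.
  have e0 : count (predI (pred1 o) (pred1 l)) (enum 'I_d) = 0%N.
    rewrite (eq_count (a2 := pred0)) ?count_pred0 // => k /=.
    by case: eqP => //= ->; rewrite (negbTE ol).
  have := count_predUI (pred1 o) (pred1 l) (enum 'I_d).
  rewrite !count_uniq_mem ?enum_uniq // !mem_enum !inE.
  by rewrite e0 addn0.
(* The ranges of y keep the coordinates below alpha: alpha + 1 - y < alpha needs y >= 2, and alpha +
   2 - y < alpha needs y >= 3. This gives (d - 2)(alpha - 2) + (alpha - 3) vectors. *)
pose X := [seq W (alpha - 1)%N (alpha + 1)%N k y | k <- ks, y <- iota 2 (alpha - 2)%N] ++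
  [seq W (alpha - 2)%N (alpha + 2)%N k1 y | y <- iota 3 (alpha - 3)%N].
have Wo x z k y : k != o -> W x z k y o = x.
  by move=> ko; rewrite /W !mnm_simpl eqxx (negbTE ko) [l == o]eq_sym (negbTE ol); lia.
have Wk x z k y : k != o -> k != l -> W x z k y k = y.
  move=> ko kl; rewrite /W !mnm_simpl eqxx [o == k]eq_sym (negbTE ko).
  by rewrite [l == k]eq_sym (negbTE kl); lia.
have Wk' x z k k' y : k' != o -> k' != l -> k != k' -> W x z k y k' = 0%N.
  move=> ko kl kk; rewrite /W !mnm_simpl [o == k']eq_sym (negbTE ko).
  by rewrite [l == k']eq_sym (negbTE kl) (negbTE kk); lia.
have k1o : k1 != o by rewrite -val_eqE.
have k1l : k1 != l by rewrite -val_eqE /=; lia.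
have hW x z k y : k != o -> k != l -> (x + z = 2 * alpha)%N -> (x < alpha)%N ->
    (y < alpha)%N -> (z - y < alpha)%N -> (y <= z)%N ->
    (forall i, (W x z k y i < alpha)%N) /\ mdeg (W x z k y) = (2 * alpha)%N.
  move=> ko kl exz xa ya za yz; split; last first.
    by rewrite /W !mdegD !mdegMn !mdeg1; lia.
  move=> i; rewrite /W !mnm_simpl.
  case: (eqVneq o i) => [<-|oi]; first by rewrite (negbTE ko) eq_sym (negbTE ol); lia.
  case: (eqVneq k i) => [<-|ki]; first by rewrite eq_sym (negbTE kl); lia.
  by case: eqP; lia.
have hX w : w \in X -> (forall i, (w i < alpha)%N) /\ mdeg w = (2 * alpha)%N.
  rewrite mem_cat => /orP[/allpairsP[[k y] /= [kks]]|/mapP[y]]; rewrite mem_iota => hy ->.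
    by move: kks; rewrite mem_filter => /andP[/andP[ko kl] _]; apply: hW => //; lia.
  by apply: hW => //; lia.
have uX : uniq X.
  rewrite cat_uniq; apply/and3P; split.
  - apply: allpairs_uniq; [exact/filter_uniq/enum_uniq|exact: iota_uniq|].
    move=> [k y] [k' y'] /allpairsP[[k2 y2] /= [kks hy [ek ey]]].
    move=> /allpairsP[[k2' y2'] /= [kks' hy' [ek' ey']]] /= /mnmP e.
    move: kks kks' hy hy'; rewrite -{}ek -{}ek' -{}ey -{}ey' !mem_filter !mem_iota.
    move=> /andP[/andP[ko kl] _] /andP[/andP[ko' kl'] _] hy hy'.
    have := e k; rewrite Wk //; have [<-|kk] := eqVneq k k'; first by rewrite Wk // => ->.
    by rewrite (Wk' _ _ k' k y' ko kl) 1?eq_sym // => y0; move: hy; rewrite y0.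
  - apply/hasPn=> w /mapP[y hy ->]; apply/negP => /allpairsP[[k y'] /= [kks _ /mnmP/(_ o)]].
    move: kks; rewrite mem_filter => /andP[/andP[ko _] _].
    by rewrite !Wo //; lia.
  - rewrite map_inj_in_uniq ?iota_uniq // => y y' _ _ /mnmP/(_ k1).
    by rewrite !Wk.
(* The vectors themselves may be gaps. Adding K vertices at [o] keeps the class, and K alpha /
   (alpha - 1) = 2 alpha = K + 2 meets the degree required by [near_floor]. *)
pose K := (2 * (alpha - 1))%N.
have := @leq_residues_base _ _ _ _ alpha_gt1 hA [seq (w + (U_(o) *+ K) *+ alpha)%MM | w <- X].
have eX : map (res alpha) [seq (w + (U_(o) *+ K) *+ alpha)%MM | w <- X] = X.
  rewrite -map_comp -[RHS]map_id; apply/eq_in_map => w /hX[h _] /=.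
  by rewrite res_addz; apply: res_small.
rewrite eX size_map => h.
have szX : size X = ((d - 1) * (alpha - 2) - 1)%N.
  rewrite size_cat size_allpairs size_map !size_iota szks.
  have ar n al : (2 < n)%N -> (2 < al)%N ->
      ((n - 2) * (al - 2) + (al - 3) = (n - 1) * (al - 2) - 1)%N.
    by move=> *; nia.
  exact: ar.
have : (0 < (d - 1) * (alpha - 2))%N by rewrite muln_gt0 !subn_gt0 (ltnW d3).
suff : (size X + c < size residues)%N by rewrite szX; lia.
apply: h => // x /mapP[w wX ->]; have [lt e] := hX _ wX; split; last first.
  rewrite res_addz res_small //; apply/negP => /(mdeg_base hA).
  by rewrite e; lia.
apply: (@near_floor _ (2 + K)).
  by rewrite mdegD !mdegMn mdeg1 e mul1n; lia.
rewrite (bigD1 o) //= !mnm_simpl eqxx mul1n; apply: leq_trans (leq_addr _ _).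
rewrite leq_divRL ?subn_gt0 //; apply: leq_trans (leq_addl _ _).
by rewrite /K; case: (alpha) alpha_gt1 => [|[|al]] // _; rewrite !subSS !subn0; nia.
Qed.

(** For d > 2 and a nonzero y-part, the gap q has degree alpha (deg m - 2), so the two preceding
    bounds compare deg m with the number of classes directly; if alpha = 2, the gap bound is
    contradictory. *)
Lemma crit_near m :
  (exists2 m', mval m' = mval m & grevlex_lt m' m) /\
    (forall k, m k != 0%N -> std (m - U_(k))%MM) ->
  (mdeg m + c <= size residues + 1)%N.
Proof.
move=> hm; have [y0|yn0] := eqVneq (ypart m) 0%MM.
  by apply: (crit_y_le1 alpha_gt1) => //; rewrite y0 mdeg0.
have [us [v [j [ev edeg gus vj [tl cop hq]]]]] := crit_data alpha_gt1 hA hm yn0.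
have [i yi] := mnm_neq0 yn0.
have ij : i != j by apply: contraNneq yi => ->; rewrite tl.
have [d2|dn2] := eqVneq d 2%N; first exact: (crit_dim2 alpha_gt1 hA d2 hm).
have d3 : (2 < d)%N.
  by move: ij; rewrite -val_eqE /=; have := ltn_ord i; have := ltn_ord j; lia.
pose q0 := (sumseq a (xpart m) + (ypart m - U_(i)) *+ alpha)%MM.
have leq : (U_(j) *+ alpha <= q0)%MM.
  apply/mnm_lepP=> k; rewrite !mnm_simpl; case: eqP => [<-|//]; rewrite mul1n.
  move/mnmP/(_ j): ev; rewrite mval_xy !mnm_simpl (negbTE ij) tl // subn0 => ->.
  by apply: leq_trans (leq_addl _ _); rewrite leq_pmull // lt0n.
have eq0 : (mdeg q0 + alpha = alpha * mdeg m)%N.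
  have e : (q0 + U_(i) *+ alpha = mval m)%MM.
    rewrite mval_xy; apply/mnmP=> k; rewrite !mnm_simpl -addnA -mulnDl subnK //.
    by case: eqP => [<-|]; rewrite ?lt0n.
  by rewrite -(mdeg_mval hA) -e mdegD mdegMn mdeg1 mul1n.
have eq1 : (mdeg (q0 - U_(j) *+ alpha)%MM + alpha + alpha = alpha * mdeg m)%N.
  by rewrite -eq0; have := congr1 mdeg (submK leq); rewrite mdegD mdegMn mdeg1 mul1n => ->.
have dm : (2 <= mdeg m)%N by move: eq1; case: (mdeg m) => [|[|n]]; lia.
have := @near_gap_bound (q0 - U_(j) *+ alpha)%MM (mdeg m - 2).
have d0 : (0 < d)%N by apply: ltn_trans d3.
move=> /(_ d0); rewrite mulnBr -eq1 => /(_ _ _)/wrap[].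
- lia.
- by move=> Sq; apply: (hq i yi _ Sq); rewrite submK.
move=> lt; have al3 : (2 < alpha)%N.
  by rewrite ltnNge; apply/negP => le; move: lt; rewrite (_ : (alpha - 2)%N = 0%N) ?muln0 //; lia.
have := near_residues_bound d3 al3.
by move: ((d - 1) * _)%N (size residues) lt => A B; lia.
Qed.

End NearVertices.

(** * The multiplicity *)

Lemma exists_left_kernel (K : fieldType) m n (M : 'M[K]_(m, n)) : (n < m)%N ->
  exists2 v : 'rV_m, v != 0 & v *m M = 0.
Proof.
move=> lt; have /rowV0Pn[v /sub_kermxP e v0] : kermx M != 0.
  rewrite kermx_eq0 /row_free; apply/negP => /eqP r.
  by have := rank_leq_col M; rewrite r leqNgt lt.
by exists v.
Qed.

Section BasisSize.
Variables (K : fieldType) (V : lmodType K).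
Implicit Type U : set V.

Lemma basis_size_le U m n : has_basis_of_size U m -> has_basis_of_size U n -> (m <= n)%N.
Proof.
move=> [b [Ub free _]] [b' [_ _ span]]; rewrite leqNgt; apply/negP => lt.
have [k hk] := boolp.choice (fun i => span _ (Ub i)).
have [v v0 e] := @exists_left_kernel _ _ _ (\matrix_(i, j) k i j) lt.
case/negP: v0; apply/eqP/rowP => i; rewrite mxE; move: i; apply: free.
rewrite (eq_bigr (fun i => \sum_j (v 0 i * k i j) *: b' j)) => [|i _]; last first.
  by rewrite hk scaler_sumr; apply: eq_bigr => j _; rewrite scalerA.
rewrite exchange_big /= big1 // => j _; rewrite -scaler_suml.
move/rowP/(_ j): e; rewrite !mxE => e.
by rewrite [X in X *: _](_ : _ = 0) ?scale0r // -[RHS]e; apply: eq_bigr => i _; rewrite mxE.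
Qed.

Lemma subspace_dimE U n : has_basis_of_size U n -> subspace_dim U = n.
Proof.
move=> h; rewrite /subspace_dim; case: xgetP => [k _ hk|/(_ n)]; last by case.
by apply/eqP; rewrite eqn_leq (basis_size_le hk h) (basis_size_le h hk).
Qed.

End BasisSize.

Lemma multiplicityE (H : nat -> nat) e : has_multiplicity H e -> multiplicity H = e.
Proof.
move=> h; rewrite /multiplicity; case: xgetP => [e' _|/(_ e)]; last by case.
move: h => [P [[n0 hP] eP]] [Q [[n1 hQ] eQ]].
suff PQ : P = Q by apply/eqP; rewrite -(eqr_nat rat) eP eQ PQ.
apply/eqP; rewrite -subr_eq0; apply/negPn/negP => PQ0.
pose s := [seq k%:R : rat | k <- iota (n0 + n1) (size (P - Q))].
have := @max_poly_roots _ (P - Q) s PQ0; rewrite size_map size_iota ltnn => h.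
suff: false by []; apply: h.
  apply/allP => x /mapP[k]; rewrite mem_iota => /andP[hk _] ->.
  by rewrite /root !hornerE -hP ?hQ ?subrr //; lia.
rewrite map_inj_uniq ?iota_uniq // => x y /eqP; rewrite eqr_nat => /eqP; exact.
Qed.

Definition monomials_of_degree n k : seq 'X_{1..n} :=
  [seq s2m (val t) | t <- enum (basis n k)].

Lemma mem_monomials n k m : (m \in monomials_of_degree n k) = (mdeg m == k).
Proof. by rewrite basis_cover. Qed.

Lemma uniq_monomials n k : uniq (monomials_of_degree n k).
Proof. exact: uniq_basis. Qed.

(** * Counting the points of a finite union of cones t + alpha N^d *)

Section Hilbert.
Variables (d' alpha : nat).
Let d := d'.+1.
Hypothesis alpha_gt0 : (0 < alpha)%N.
Implicit Types (t x : 'X_{1..d}) (T : seq 'X_{1..d}).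
Local Notation res := (res alpha).

Definition in_cone x t := (t <= x)%MM && (res t == res x).

Lemma in_coneP x t : reflect (exists z, x = (t + z *+ alpha)%MM) (in_cone x t).
Proof.
apply: (iffP andP) => [[/mnm_lepP le /eqP/resP e]|[z ->]].
  exists [multinom ((x i - t i) %/ alpha)%N | i < d]; apply/mnmP=> i.
  rewrite !mnm_simpl mnmE divnK ?subnKC //.
  by rewrite -eqn_mod_dvd // e.
by rewrite lem_addr res_addz.
Qed.

Definition cone_count T n :=
  count (fun x => has (in_cone x) T) (monomials_of_degree d (alpha * n)).

Lemma res_mdeg x t : res x = res t -> mdeg x = mdeg t %[mod alpha].
Proof.
move/resP=> e; rewrite !mdegE; apply/eqP.
apply: (big_ind2 (fun p q => p == q %[mod alpha])) => // [p1 p2 q1 q2 /eqP e1 /eqP e2|i _].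
  by rewrite -modnDm e1 e2 modnDm.
by apply/eqP.
Qed.

Lemma res_mlcm t t' : res t = res t' -> res (mlcm t t') = res t.
Proof.
move/resP=> e; apply/resP=> i; rewrite mnmE /maxn.
by case: ifP => // _; rewrite -(e i).
Qed.

Lemma cone_count1 t n : (mdeg t <= alpha * n)%N -> (alpha %| mdeg t)%N ->
  cone_count [:: t] n = 'C(n - mdeg t %/ alpha + d', d').
Proof.
move=> le dv; set k := (n - _)%N.
have ek : (mdeg t + k * alpha = alpha * n)%N.
  by rewrite /k mulnBl divnK // [(n * alpha)%N]mulnC subnKC.
have -> : 'C(k + d', d') = size (monomials_of_degree d k).
  by rewrite /monomials_of_degree size_basis -(bin_sub (leq_addl k d')) addnK.
rewrite /cone_count -size_filter -[RHS](size_map (fun z => t + z *+ alpha)%MM).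
apply/perm_size/uniq_perm; first exact/filter_uniq/uniq_monomials.
  rewrite map_inj_uniq ?uniq_monomials // => z z' /addmI /mnmP e.
  by apply/mnmP=> i; have := e i; rewrite !mulmnE => /eqP; rewrite eqn_pmul2r // => /eqP.
move=> x; rewrite mem_filter mem_monomials /= orbF.
apply/andP/mapP => [[/in_coneP[z ez] /eqP dx]|[z]].
  exists z => //; rewrite mem_monomials -(eqn_pmul2r alpha_gt0).
  by move: dx; rewrite ez mdegD mdegMn -ek => /addnI ->.
rewrite mem_monomials => /eqP dz ->; split; first by apply/in_coneP; exists z.
by rewrite mdegD mdegMn dz ek.
Qed.

(** Prescribing the coefficient of degree d' = d - 1, instead of the leading one, makes the
    statement additive under inclusion-exclusion and true for empty [T], where P = 0. *)
Definition has_cone_poly T (r : nat) := exists P : {poly rat},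
  [/\ exists n0, forall n, (n0 <= n)%N -> (cone_count T n)%:R = P.[n%:R],
      (size P <= d)%N & P`_d' = r%:R / d'`!%:R].

Lemma cone_poly1 t : (alpha %| mdeg t)%N -> has_cone_poly [:: t] 1.
Proof.
move=> dv; pose k := (mdeg t %/ alpha)%N.
pose B : {poly rat} := \prod_(i < d') ('X - (k%:R - d'%:R + (i : nat)%:R)%:P).
have szB : size B = d by rewrite /B size_prod_XsubC [size _](_ : _ = d') // /index_enum -enumT size_enum_ord.
have f0 : d'`!%:R != 0 :> rat by rewrite (eqr_nat rat _ 0) -lt0n fact_gt0.
exists (d'`!%:R^-1 *: B); split.
- exists k => n kn; rewrite cone_count1 //; last first.
    by rewrite -(divnK dv) mulnC leq_mul2l kn orbT.
  apply: (mulfI f0); rewrite hornerZ mulVKf // -natrM mulnC bin_ffact ffact_prod.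
  rewrite natr_prod /B horner_prod; apply: eq_bigr => i _.
  rewrite !hornerE natrB; last by have := ltn_ord i; lia.
  by rewrite natrD natrB //; ring.
- by apply: leq_trans (size_scale_leq _ _) _; rewrite szB.
- have -> : (d'`!%:R^-1 *: B)`_d' = d'`!%:R^-1 * lead_coef B by rewrite coefZ lead_coefE szB.
  by rewrite (eqP (monic_prod_XsubC _ _ _)) mulr1 mul1r.
Qed.

(* Inclusion-exclusion: the cone of [t] meets the cone of [t'] in the cone of
   their least common multiple if they are congruent, and not at all otherwise. *)
Lemma cone_poly T : all (fun t => alpha %| mdeg t)%N T ->
  has_cone_poly T (size (undup (map res T))).
Proof.
(* The induction is on a length bound, because it is also applied to [J], which is no sublist of
   [T]. *)
move: {2}(size T) (leqnn (size T)) => n.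
elim: n T => [|n IH] [|t T] //=; [| | move=> szT].
- by move=> _ _; exists 0; rewrite size_poly0 coef0 mul0r; split=> //; exists 0%N => k _;
     rewrite horner0 /cone_count (eq_count (a2 := pred0)) ?count_pred0.
- by move=> _ _; exists 0; rewrite size_poly0 coef0 mul0r; split=> //; exists 0%N => k _;
     rewrite horner0 /cone_count (eq_count (a2 := pred0)) ?count_pred0.
case/andP=> dt dT; pose J := [seq mlcm t t' | t' <- T & res t == res t'].
have dJ : all (fun t => alpha %| mdeg t)%N J.
  apply/allP=> x /mapP[t']; rewrite mem_filter => /andP[/eqP e t'T] ->.
  by rewrite /dvdn (res_mdeg (res_mlcm e)) -/(dvdn _ _).
have szJ : (size J <= n)%N.
  by rewrite size_map size_filter (leq_trans (count_size _ _)).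
have [P [[nP hP] sP lP]] := cone_poly1 dt.
have [Q [[nQ hQ] sQ lQ]] := IH _ szT dT.
have [R [[nR hR] sR lR]] := IH _ szJ dJ.
exists (P + Q - R); split.
- exists (nP + nQ + nR)%N => k hk; rewrite !hornerE -hP -?hQ -?hR; try lia.
  apply/eqP; rewrite eq_sym subr_eq -!natrD eqr_nat; apply/eqP.
  rewrite /cone_count -count_predUI; congr (_ + _)%N; apply: eq_count => x /=.
    by rewrite orbF.
  rewrite orbF; apply/andP/hasP => [[tx /hasP[t' t'T t'x]]|[y /mapP[t']]].
    exists (mlcm t t').
      apply: map_f; rewrite mem_filter t'T andbT.
      by case/andP: tx => _ /eqP ->; case/andP: t'x => _ /eqP ->.
    case/andP: tx => le /eqP e; case/andP: t'x => le' /eqP e'.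
    by rewrite /in_cone lem_mlcm le le' /= res_mlcm e // e'.
  rewrite mem_filter => /andP[/eqP e t'T] ->; rewrite /in_cone lem_mlcm.
  rewrite res_mlcm // => /andP[/andP[le le'] /eqP ex].
  by rewrite le ex eqxx; split=> //; apply/hasP; exists t'; rewrite // /in_cone le' -ex e eqxx.
- rewrite (leq_trans (size_polyD _ _)) // geq_max size_polyN sR andbT.
  by rewrite (leq_trans (size_polyD _ _)) // geq_max sP sQ.
- rewrite coefB coefD lP lQ lR -!mulrDl -mulrBl; congr (_ / _).
  (* All least common multiples are congruent to [t], so [J] removes exactly one class if that of
     [t] already occurs in [T], and none otherwise. *)
  have hJ : undup (map res J) = if res t \in map res T then [:: res t] else [::].
    case: ifPn => [/mapP[t' t'T e]|ntT]; last first.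
      suff -> : J = [::] by [].
      rewrite /J (eq_in_filter (a2 := pred0)) ?filter_pred0 // => t' t'T /=.
      by apply: contraNF ntT => /eqP ->; apply: map_f.
    have cJ : map res J = nseq (size J) (res t).
      rewrite -[in RHS](size_map res J); apply/all_pred1P/allP => y /mapP[x /mapP[t2]]; rewrite mem_filter => /andP[/eqP e2 _] ->.
      by move=> -> /=; rewrite res_mlcm.
    have Jm : mlcm t t' \in J by apply: map_f; rewrite mem_filter t'T e eqxx.
    have : size J != 0%N by apply: contraTneq Jm => /size0nil ->.
    rewrite cJ; case: (size J) => // k _.
    by elim: k => //= k ->; rewrite inE eqxx.
  rewrite hJ; case: ifP => _ /=; first by rewrite addrAC subrr add0r.
  by rewrite subr0 addrC natr1.
Qed.

End Hilbert.

Section GradedPiece.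
Variables (K : fieldType) (c d alpha : nat) (a : 'I_c -> 'X_{1..d}).
Local Notation S := (semigroup alpha a).

Lemma graded_piece_basis n (L : seq 'X_{1..d}) : uniq L ->
  (forall x, x \in L <-> S x /\ mdeg x = (alpha * n)%N) ->
  has_basis_of_size (graded_piece (K := K) alpha a n) (size L).
Proof.
move=> uL hL; pose t := in_tuple L.
have inj : injective (tnth t) by apply/tuple_uniqP.
have coef (k : 'I_(size L) -> K) i :
    (\sum_j k j *: 'X_[K, tnth t j])@_(tnth t i) = k i.
  rewrite raddf_sum /= (bigD1 i) //= mcoeffZ mcoeffX eqxx mulr1 big1 ?addr0 // => j ne.
  by rewrite mcoeffZ mcoeffX (inj_eq inj) (negbTE ne) mulr0.
exists (fun i => 'X_[tnth t i]); split.
- move=> i; have [Si di] := (hL _).1 (mem_tnth i t); split; last by rewrite dhomogX; apply/eqP; exact: di.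
  by move=> s; rewrite msuppX inE => /eqP ->.
- by move=> k e i; rewrite -(coef k i) e mcoeff0.
- move=> v [Sv /dhomogP hv]; exists (fun i => v@_(tnth t i)).
  apply/mpolyP => m; case: (boolP (m \in L)) => [/(tnthP t)[i ->]|nL].
    by rewrite (coef (fun i => v@_(tnth t i))).
  rewrite raddf_sum /= big1 => [|i _].
    apply: memN_msupp_eq0; apply: contra nL => mv; apply/hL; split; first exact: Sv.
    exact: hv.
  rewrite mcoeffZ mcoeffX; case: eqP => [e|]; last by rewrite mulr0.
  by move: nL; rewrite -e mem_tnth.
Qed.

End GradedPiece.

Section Degree.
Variables (K : fieldType) (c d alpha : nat) (a : 'I_c -> 'X_{1..d}).
Hypothesis c_gt1 : (1 < c)%N.
Hypothesis alpha_gt1 : (1 < alpha)%N.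
Hypothesis hA : simplicial_config alpha a.

Local Notation S := (semigroup alpha a).

Lemma dim_gt1 : (1 < d)%N.
Proof.
have c0 : (0 < c)%N by apply: ltnW.
rewrite ltnNge; apply/negP => d1.
suff : a (Ordinal c0) = a (Ordinal c_gt1) by move/(config_inj hA)/(congr1 val).
apply/mnmP=> i; have hi k : a k i = alpha.
  rewrite -(mdeg_config hA k) mdegE (bigD1 i) //= big1 ?addn0 // => j.
  by rewrite -val_eqE /=; have := ltn_ord i; have := ltn_ord j; lia.
by rewrite !hi.
Qed.

(** S is the union of the cones over [small_sums], so [cone_poly] yields the Hilbert polynomial.
    There is at least the class of 0, hence its degree is exactly d - 1. *)
Lemma degKS_residues : degKS K alpha a = size (residues alpha a).
Proof.
have a0 : (0 < alpha)%N by apply: ltnW.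
case: d a hA dim_gt1 => [//|d'] b hb _; rewrite /degKS.
have dv : all (fun t => alpha %| mdeg t)%N (small_sums alpha b).
  apply/allP=> t /mapP[k _ ->]; rewrite mdeg_sum; apply: dvdn_sum => i _.
  by rewrite mdegMn (mdeg_config hb) dvdn_mulr.
have [P [[n0 hP] sP lP]] := cone_poly a0 dv.
have E0 : (0 < size (residues alpha b))%N.
  have := res_residues alpha_gt1 (semigroup0 alpha b).
  by case: (residues _ _).
have f0 : d'`!%:R != 0 :> rat by rewrite (eqr_nat rat _ 0) -lt0n fact_gt0.
have lP0 : P`_d' != 0.
  by rewrite lP mulf_neq0 ?invr_eq0 // (eqr_nat rat _ 0) -lt0n.
have szP : size P = d'.+1.
  by apply/eqP; rewrite eqn_leq sP ltnNge; apply: contraNN lP0 => /leq_sizeP ->.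
apply: multiplicityE; exists P; split; last first.
  by rewrite lead_coefE szP /= lP mulrC divfK.
exists n0 => n /hP <-; congr (_%:R).
pose L := [seq x <- monomials_of_degree d'.+1 (alpha * n) |
  has (in_cone alpha x) (small_sums alpha b)].
rewrite /cone_count -size_filter -/L; apply: subspace_dimE; apply: graded_piece_basis.
  exact/filter_uniq/uniq_monomials.
move=> x; rewrite mem_filter mem_monomials; split.
  case/andP=> /hasP[t ht /in_coneP[z ->]] /eqP ->; split=> //.
  apply: semigroupD; last exact: semigroup_mulalpha.
  by case/mapP: ht => k _ ->; apply: semigroup_sum => i _; apply/semigroupM/semigroup_config.
case=> /(semigroup_small alpha_gt1)[t ht [z ez]] ->; rewrite eqxx andbT.
by apply/hasP; exists t => //; apply/in_coneP => //; exists z.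
Qed.

End Degree.

(** * Localizations and chains of primes *)

Local Open Scope classical_set_scope.

Section Subring.
Variable F : fieldType.
Implicit Types (A P Q : set F).

Definition subring A :=
  [/\ A 1, forall x y, A x -> A y -> A (x - y) & forall x y, A x -> A y -> A (x * y)].

Lemma subring1 A : subring A -> A 1. Proof. by case. Qed.
Lemma subring0 A : subring A -> A 0.
Proof. by case=> a1 aB _; rewrite -(subrr 1); apply: aB. Qed.
Lemma subringB A x y : subring A -> A x -> A y -> A (x - y).
Proof. by case=> _ + _; apply. Qed.
Lemma subringN A x : subring A -> A x -> A (- x).
Proof. by move=> sA Ax; rewrite -sub0r; apply: subringB => //; apply: subring0. Qed.
Lemma subringD A x y : subring A -> A x -> A y -> A (x + y).
Proof. by move=> sA Ax Ay; rewrite -[y]opprK; apply: subringB => //; apply: subringN. Qed.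
Lemma subringM A x y : subring A -> A x -> A y -> A (x * y).
Proof. by case=> _ _; apply. Qed.
Lemma subringX A x n : subring A -> A x -> A (x ^+ n).
Proof.
move=> sA Ax; elim: n => [|n IH]; first exact: subring1.
by rewrite exprS; apply: subringM.
Qed.
Lemma subring_sum A (I : eqType) (r : seq I) (f : I -> F) : subring A ->
  (forall i, i \in r -> A (f i)) -> A (\sum_(i <- r) f i).
Proof.
move=> sA h; rewrite big_seq; apply: (big_ind A) => //; first exact: subring0.
by move=> x y; apply: subringD.
Qed.
Lemma subring_prod A (I : Type) (r : seq I) (f : I -> F) : subring A ->
  (forall i, A (f i)) -> A (\prod_(i <- r) f i).
Proof.
move=> sA h; apply: (big_ind A) => //; first exact: subring1.
by move=> x y; apply: subringM.
Qed.

Section Prime.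
Variables (A P : set F).
Hypotheses (sA : subring A) (pP : prime_ideal A P).

Lemma primeS x : P x -> A x. Proof. by case: pP => -[h _ _ _] _ _; apply: h. Qed.
Lemma prime0 : P 0. Proof. by case: pP => -[]. Qed.
Lemma primeD x y : P x -> P y -> P (x + y). Proof. by case: pP => -[_ _ h _] _ _; apply: h. Qed.
Lemma primeMl x y : A x -> P y -> P (x * y).
Proof. by case: pP => -[_ _ _ h] _ _; apply: h. Qed.
Lemma primeMr x y : P x -> A y -> P (x * y).
Proof. by move=> Px Ay; rewrite mulrC; apply: primeMl. Qed.
Lemma primeN x : P x -> P (- x).
Proof. by rewrite -mulN1r; apply: primeMl; apply: subringN => //; apply: subring1. Qed.
Lemma primeB x y : P x -> P y -> P (x - y).
Proof. by move=> Px Py; apply: primeD => //; apply: primeN. Qed.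
Lemma prime1 : ~ P 1. Proof. by case: pP. Qed.
Lemma primeM x y : A x -> A y -> P (x * y) -> P x \/ P y.
Proof. by case: pP => _ _; apply. Qed.
Lemma prime_nM x y : A x -> A y -> ~ P x -> ~ P y -> ~ P (x * y).
Proof. by move=> Ax Ay nx ny /primeM[]. Qed.
Lemma primeX x n : A x -> P (x ^+ n) -> P x.
Proof.
move=> Ax; elim: n => [|n IH]; first by rewrite expr0 => /prime1.
by rewrite exprS => /primeM[]//; apply: subringX.
Qed.
Lemma prime_nX x n : A x -> ~ P x -> ~ P (x ^+ n).
Proof. by move=> Ax nx /(primeX Ax). Qed.
Lemma prime_neq0 x : ~ P x -> x != 0.
Proof. by move=> nx; apply/eqP => x0; apply: nx; rewrite x0; apply: prime0. Qed.
Lemma prime_addr x y : P y -> P (x + y) -> P x.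
Proof. by move=> Py Pxy; rewrite -(addrK y x); apply: primeB. Qed.
Lemma prime_sum (I : eqType) (r : seq I) (f : I -> F) :
  (forall i, i \in r -> P (f i)) -> P (\sum_(i <- r) f i).
Proof.
move=> h; rewrite big_seq; apply: (big_ind P) => //; first exact: prime0.
by move=> x y; apply: primeD.
Qed.

End Prime.

(** The extension of Q to the localization at P; for Q = P it is convertible with
    [localization_ideal]. *)
Definition extension A P Q : set F :=
  [set z | exists x y, [/\ Q x, A y, ~ P y & z = x / y]].

Lemma extension_incl A P Q x : subring A -> prime_ideal A P -> Q x -> extension A P Q x.
Proof.
move=> sA pP Qx; exists x, 1; split=> //; rewrite ?divr1 //; first exact: subring1.
exact: prime1 pP.
Qed.

Lemma addf_frac (x1 x2 y1 y2 : F) : y1 != 0 -> y2 != 0 ->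
  x1 / y1 + x2 / y2 = (y2 * x1 + y1 * x2) / (y1 * y2).
Proof. by move=> h1 h2; field; rewrite h1 h2. Qed.

Lemma localization_subring A P : subring A -> prime_ideal A P ->
  subring (localization A P).
Proof.
move=> sA pP; split.
- exact: (extension_incl sA pP (subring1 sA)).
- move=> _ _ [x1 [y1 [Ax1 Ay1 ny1 ->]]] [x2 [y2 [Ax2 Ay2 ny2 ->]]].
  exists (y2 * x1 + y1 * - x2), (y1 * y2); split; first 1 last.
  + exact: subringM.
  + exact: (prime_nM pP).
  + by rewrite -addf_frac ?mulNr //; apply: (prime_neq0 pP).
  + by apply: subringD => //; apply: subringM => //; apply: subringN.
- move=> _ _ [x1 [y1 [Ax1 Ay1 ny1 ->]]] [x2 [y2 [Ax2 Ay2 ny2 ->]]].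
  exists (x1 * x2), (y1 * y2); split; first exact: subringM.
  + exact: subringM.
  + exact: (prime_nM pP).
  + by rewrite invfM mulrACA.
Qed.

Lemma extension_contract A P Q x : subring A -> prime_ideal A P -> prime_ideal A Q ->
  Q `<=` P -> A x -> extension A P Q x -> Q x.
Proof.
move=> sA pP pQ QP Ax [y [z [Qy Az nz e]]].
have z0 : z != 0 by apply: (prime_neq0 pP).
have : Q (x * z) by rewrite e divfK.
by case/(primeM pQ Ax Az) => // /QP.
Qed.

Lemma extension_prime A P Q : subring A -> prime_ideal A P -> prime_ideal A Q ->
  Q `<=` P -> prime_ideal (localization A P) (extension A P Q).
Proof.
move=> sA pP pQ QP; split.
- split.
  + move=> _ [x [y [Qx Ay ny ->]]]; exists x, y; split=> //; exact: (primeS pQ).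
  + exact: (extension_incl sA pP (prime0 pQ)).
  + move=> _ _ [x1 [y1 [Qx1 Ay1 ny1 ->]]] [x2 [y2 [Qx2 Ay2 ny2 ->]]].
    exists (y2 * x1 + y1 * x2), (y1 * y2); split; first 1 last.
    * exact: subringM.
    * exact: (prime_nM pP).
    * by rewrite -addf_frac //; apply: (prime_neq0 pP).
    * by apply: (primeD pQ); apply: (primeMl pQ).
  + move=> _ _ [x1 [y1 [Ax1 Ay1 ny1 ->]]] [x2 [y2 [Qx2 Ay2 ny2 ->]]].
    exists (x1 * x2), (y1 * y2); split; first exact: (primeMl pQ).
    * exact: subringM.
    * exact: (prime_nM pP).
    * by rewrite invfM mulrACA.
- by move/(extension_contract sA pP pQ QP (subring1 sA)); apply: prime1 pQ.
- move=> _ _ [x1 [y1 [Ax1 Ay1 ny1 ->]]] [x2 [y2 [Ax2 Ay2 ny2 ->]]] h.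
  have : Q (x1 * x2).
    apply: (extension_contract sA pP pQ QP); first exact: subringM.
    case: h => [x [y [Qx Ay ny e]]].
    exists (y1 * y2 * x), y; split=> //; first by apply: (primeMl pQ) => //; apply: subringM.
    have [h1 h2] : y1 != 0 /\ y2 != 0 by split; apply: (prime_neq0 pP).
    rewrite -mulrA -e; field; by rewrite h1 h2.
  by case/(primeM pQ Ax1 Ax2) => Qx; [left; exists x1, y1|right; exists x2, y2].
Qed.

Lemma localization_inv A P x : subring A -> prime_ideal A P -> A x -> ~ P x ->
  localization A P x^-1.
Proof. by move=> sA pP Ax nx; exists 1, x; split=> //; rewrite ?div1r //; apply: subring1. Qed.

Lemma contraction_prime A P Q : subring A -> prime_ideal A P ->
  prime_ideal (localization A P) Q -> prime_ideal A (Q `&` A) /\ (Q `&` A `<=` P).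
Proof.
move=> sA pP pQ; have inc x : A x -> localization A P x.
  by move=> Ax; apply: extension_incl.
split; first split.
- split.
  + by move=> x [].
  + by split; [exact: prime0 pQ|exact: subring0].
  + by move=> x y [Qx Ax] [Qy Ay]; split; [apply: (primeD pQ)|apply: subringD].
  + by move=> x y Ax [Qy Ay]; split; [apply: (primeMl pQ) => //; apply: inc|apply: subringM].
- by case=> /(prime1 pQ).
- move=> x y Ax Ay [Qxy _]; case/(primeM pQ (inc _ Ax) (inc _ Ay)): Qxy; first by left.
  by right.
- move=> x [Qx Ax]; apply: contrapT => nx; apply: (prime1 pQ).
  rewrite -(@mulVf _ x) ?(prime_neq0 pP) //.
  by apply: (primeMl pQ) => //; apply: localization_inv.
Qed.

Lemma localization_clear A P x : subring A -> prime_ideal A P -> localization A P x ->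
  exists y, [/\ A y, ~ P y & A (x * y)].
Proof.
move=> sA pP [z [y [Az Ay ny ->]]]; exists y; split=> //.
by rewrite divfK // (prime_neq0 pP).
Qed.

Lemma localization_chain A P n p : subring A -> prime_ideal A P -> prime_chain A n p ->
  p n `<=` P -> prime_chain (localization A P) n (fun i => extension A P (p i)).
Proof.
move=> sA pP [hp hlt] hP.
have hsub i : (i <= n)%N -> p i `<=` P.
  move=> le; have [m em] : exists m, n = (i + m)%N by exists (n - i)%N; lia.
  elim: m i le em => [|m IH] i le em; first by rewrite em addn0 in hP.
  by move=> x px; apply: (IH i.+1); [lia|lia|apply: (hlt i _).1 => //; lia].
split=> i hi; first by apply: extension_prime => //; [apply: hp|apply: hsub].
split.
  move=> _ [x [y [px Ay ny ->]]]; exists x, y; split=> //.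
  exact: (hlt i hi).1.
move=> h; have [_ nn] := hlt i hi; apply: nn => x px.
have Ax : A x by apply: (primeS (hp i.+1 hi)).
apply: (extension_contract sA pP (hp i (ltnW hi)) (hsub i (ltnW hi)) Ax); apply: h.
exact: extension_incl.
Qed.

Lemma localization_unchain A P n p : subring A -> prime_ideal A P ->
  prime_chain (localization A P) n p ->
  prime_chain A n (fun i => p i `&` A) /\ (p n `&` A `<=` P).
Proof.
move=> sA pP [hp hlt]; split; last by apply: (contraction_prime sA pP (hp n (leqnn n))).2.
split=> i hi; first by apply: (contraction_prime sA pP (hp i hi)).1.
have [le nn] := hlt i hi; split; first by move=> x [/le px Ax].
move=> h; apply: nn => x px.
have Lx : localization A P x by apply: (primeS (hp i.+1 hi)).
have [y [Ay ny Axy]] := localization_clear sA pP Lx.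
have inc z : A z -> localization A P z by move=> Az; apply: extension_incl.
have [pxy _] : (p i `&` A) (x * y).
  apply: h; split=> //; apply: (primeMr (hp i.+1 hi)) => //; exact: inc.
rewrite -(@mulfK _ y _ x) ?(prime_neq0 pP) //.
by apply: (primeMr (hp i (ltnW hi))) => //; apply: localization_inv.
Qed.

(** Chains of the localization correspond to chains of A whose largest prime lies inside P, so
    dimensions are always computed in A. *)
Lemma localization_krull_dim A P n : subring A -> prime_ideal A P ->
  (exists2 p, prime_chain A n p & p n `<=` P) ->
  (forall k p, prime_chain A k p -> p k `<=` P -> (k <= n)%N) ->
  has_krull_dim (localization A P) n.
Proof.
move=> sA pP [p hp hP] hmax; split.
  by exists (fun i => extension A P (p i)); apply: localization_chain.
move=> k q /(localization_unchain sA pP)[hq qP]; exact: (hmax _ _ hq qP).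
Qed.

Lemma has_krull_dim_uniq A m n : has_krull_dim A m -> has_krull_dim A n -> m = n.
Proof.
move=> [[p hp] hm] [[q hq] hn].
by apply/eqP; rewrite eqn_leq (hn _ _ hp) (hm _ _ hq).
Qed.

Lemma krull_dimE A n : has_krull_dim A n -> krull_dim A = n.
Proof.
move=> h; rewrite /krull_dim; case: xgetP => [m _ hm|/(_ n)]; last by case.
exact: has_krull_dim_uniq hm h.
Qed.

End Subring.

(** * Algebraic independence modulo primes *)

Section AlgebraicDependence.
Variable K : fieldType.

Definition deg_le n (p : {mpoly K[n]}) k := forall m, m \in msupp p -> (mdeg m <= k)%N.

Lemma deg_leM n (p q : {mpoly K[n]}) k l : deg_le p k -> deg_le q l -> deg_le (p * q) (k + l).
Proof.
move=> hp hq m /msuppM_le /allpairsP[[m1 m2] /= [/hp h1 /hq h2 ->]].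
by rewrite mdegD leq_add.
Qed.

Lemma deg_leX n (p : {mpoly K[n]}) k e : deg_le p k -> deg_le (p ^+ e) (k * e).
Proof.
move=> hp; elim: e => [|e IH]; last by rewrite exprS mulnS; apply: deg_leM.
by move=> m; rewrite expr0 msupp1 inE => /eqP ->; rewrite mdeg0.
Qed.

Lemma deg_le_mmap1 n d (x : 'I_n -> {mpoly K[d]}) k (m : 'X_{1..n}) :
  (forall i, deg_le (x i) k) -> deg_le (mmap1 x m) (k * mdeg m).
Proof.
move=> hx; rewrite /mmap1 mdegE big_distrr /=.
apply: (big_ind2 (fun p l => deg_le p l)) => [|p1 l1 p2 l2|i _].
- by move=> m'; rewrite msupp1 inE => /eqP ->; rewrite mdeg0.
- exact: deg_leM.
- exact/deg_leX/hx.
Qed.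

(* There are more monomials with exponents below [N] in n > d variables than
   monomials of K[t_1, .., t_d] that can occur in their values. *)
Lemma algebraically_dependent n d (x : 'I_n -> {mpoly K[d]}) : (d < n)%N ->
  exists2 p : {mpoly K[n]}, p != 0 & mmap (@mpolyC d K) x p = 0.
Proof.
move=> dn; pose k := (\max_i msize (x i))%N.
have hx i : deg_le (x i) k.
  move=> m /msize_mdeg_lt h; apply: ltnW; apply: leq_trans h _.
  exact: (leq_bigmax (F := fun i => msize (x i))).
(* There are N^n >= N^(d+1) monomials, and their values have exponents below B. As N exceeds (n k +
   1)^d, this is more than B^d = N^d (n k + 1)^d. *)
pose N := ((n * k).+1 ^ d).+1; pose B := (N * (n * k).+1)%N.
pose T1 : finType := {ffun 'I_n -> 'I_N}; pose T2 : finType := {ffun 'I_d -> 'I_B}.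
pose e1 (f : T1) : 'X_{1..n} := [multinom f i : nat | i < n].
pose e2 (f : T2) : 'X_{1..d} := [multinom f i : nat | i < d].
pose M := \matrix_(i < #|T1|, j < #|T2|) (mmap1 x (e1 (enum_val i)))@_(e2 (enum_val j)).
have lt : (#|T2| < #|T1|)%N.
  rewrite /T1 /T2 !card_ffun !card_ord /B expnMn.
  apply: (@leq_trans (N ^ d.+1)); last by rewrite leq_pexp2l.
  by rewrite expnSr ltn_pmul2l ?expn_gt0.
have [v v0 vM] := exists_left_kernel M lt.
have e1_inj : injective e1.
  by move=> f g /mnmP e; apply/ffunP => i; apply/val_inj; have := e i; rewrite !mnmE.
pose p : {mpoly K[n]} := \sum_i v 0 i *: 'X_[e1 (enum_val i)].
have pcoef i : p@_(e1 (enum_val i)) = v 0 i.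
  rewrite raddf_sum /= (bigD1 i) //= mcoeffZ mcoeffX eqxx mulr1 big1 ?addr0 // => j ne.
  by rewrite mcoeffZ mcoeffX (inj_eq e1_inj) (inj_eq enum_val_inj) (negbTE ne) mulr0.
exists p.
  apply: contra_neq v0 => p0; apply/rowP=> i.
  by rewrite mxE -pcoef p0 mcoeff0.
have -> : mmap (@mpolyC d K) x p = \sum_i v 0 i *: mmap1 x (e1 (enum_val i)).
  rewrite raddf_sum /=; apply: eq_bigr => i _.
  by rewrite mmapZ mmapX mul_mpolyC.
apply/mpolyP => m; rewrite mcoeff0 raddf_sum /=.
case: (boolP [forall i, (m i < B)%N]) => [/forallP h|].
  pose f : T2 := [ffun i => Ordinal (h i)].
  have em : m = e2 f by apply/mnmP=> i; rewrite mnmE ffunE.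
  move/rowP/(_ (enum_rank f)): vM; rewrite !mxE => e.
  by rewrite -[RHS]e; apply: eq_bigr => i _; rewrite mcoeffZ mxE enum_rankK -em.
rewrite negb_forall => /existsP[j]; rewrite -leqNgt => hj.
rewrite big1 // => i _; rewrite mcoeffZ memN_msupp_eq0 ?mulr0 //.
apply/negP => /(deg_le_mmap1 hx); apply/negP; rewrite -ltnNge.
have mj : (m j <= mdeg m)%N by rewrite mdegE (bigD1 j) //= leq_addr.
apply: leq_trans mj; apply: leq_trans hj.
apply: (@leq_ltn_trans (k * (n * N))).
  rewrite leq_mul2l; apply/orP; right; rewrite mdegE.
  apply: (@leq_trans (\sum_(i < n) N)); last by rewrite sum_nat_const card_ord.
  by apply: leq_sum => l _; rewrite mnmE ltnW.
by rewrite /B mulnS mulnCA mulnA [(N * _)%N]mulnC -[ltnLHS]add0n ltn_add2r.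
Qed.

End AlgebraicDependence.

Section Independence.
Variables (K : fieldType) (F : fieldType) (iota : {rmorphism K -> F}).
Implicit Types (A P Q : set F).

Local Notation ev := (mmap iota).

(** Algebraic independence over K of the residues modulo [P]; for [[set 0]] it is independence in
    F. *)
Definition indep n P (x : 'I_n -> F) := forall p : {mpoly K[n]}, P (ev x p) -> p = 0.

(** The new element comes last because [muni] singles out the last variable. *)
Definition snoc n (u : 'I_n -> F) (z : F) (i : 'I_n.+1) : F :=
  if unlift ord_max i is Some j then u j else z.

Lemma snoc_max n (u : 'I_n -> F) z : snoc u z ord_max = z.
Proof. by rewrite /snoc unlift_none. Qed.

Lemma snoc_widen n (u : 'I_n -> F) z i : snoc u z (widen_ord (leqnSn n) i) = u i.
Proof.
have -> : widen_ord (leqnSn n) i = lift ord_max i by apply/val_inj; rewrite [RHS]lift_max.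
by rewrite /snoc liftK.
Qed.

Lemma ev_in n A (x : 'I_n -> F) p : subring A -> (forall k, A (iota k)) ->
  (forall i, A (x i)) -> A (ev x p).
Proof.
move=> sA Ak Ax; apply: subring_sum => // m _; apply: subringM => //.
by apply: subring_prod => // i; apply: subringX.
Qed.

Lemma ev_snoc n (u : 'I_n -> F) z p : ev (snoc u z) p = (map_poly (ev u) (muni p)).[z].
Proof.
rewrite muniE rmorph_sum horner_sum /mmap; apply: eq_bigr => m _.
rewrite -/(mmap iota u) -mul_polyC rmorphM /= map_polyC map_polyXn hornerM hornerC hornerXn.
rewrite /= -mul_mpolyC rmorphM /= mmapC mmapX -mulrA; congr (_ * _).
rewrite /mmap1 big_ord_recr /= snoc_max; congr (_ * _).
by apply: eq_bigr => i _; rewrite snoc_widen mnmE.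
Qed.

Lemma muni_coef n (p : {mpoly K[n.+1]}) (m : 'X_{1..n.+1}) :
  ((muni p)`_(m ord_max))@_[multinom m (widen_ord (leqnSn n) i) | i < n] = p@_m.
Proof.
rewrite muniE coef_sum raddf_sum /= [in RHS](mpolyE p) raddf_sum /=.
apply: eq_bigr => m' _; rewrite coefZ coefXn !mcoeffZ mcoeffX.
case: (eqVneq m' m) => [->|ne]; first by rewrite eqxx mulr1 mcoeffZ mcoeffX eqxx.
case: eqP => [e|_]; last by rewrite mulr0 mcoeff0 mulr0.
rewrite mulr1 mcoeffZ mcoeffX; case: eqP => // /mnmP e'.
case/negP: ne; apply/eqP/mnmP=> i; case: (unliftP ord_max i) => [j ->|-> //].
have -> : lift ord_max j = widen_ord (leqnSn n) j by apply/val_inj; rewrite [LHS]lift_max.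
by have := e' j; rewrite !mnmE.
Qed.

Lemma muni_inj0 n (p : {mpoly K[n.+1]}) : muni p = 0 -> p = 0.
Proof. by move=> e; apply/mpolyP => m; rewrite -muni_coef e coef0 !mcoeff0. Qed.

(** Write a relation as a polynomial in z. Powers of z cancel modulo P, so its lowest coefficient
    may be taken to be the constant one. Modulo Q, where z vanishes, this coefficient is a relation
    between the u_i, hence 0, a contradiction. *)
Lemma indep_snoc n A P Q (u : 'I_n -> F) z : subring A -> (forall k, A (iota k)) ->
  prime_ideal A P -> prime_ideal A Q -> P `<=` Q -> (forall i, A (u i)) ->
  Q z -> ~ P z -> indep Q u -> indep P (snoc u z).
Proof.
move=> sA Ak pP pQ PQ Au Qz nPz ind p; rewrite ev_snoc => h.
apply/muni_inj0/eqP/negPn/negP => q0.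
have Az : A z by apply: (primeS pQ).
have [k [q' rq' eq]] := multiplicity_XsubC (muni p) 0.
rewrite subr0 in eq; move: rq'; rewrite q0 /= => /negP; apply.
have Aev l : A ((map_poly (ev u) l).[z]).
  rewrite horner_coef; apply: subring_sum => // i _.
  by apply: subringM; rewrite ?coef_map //; [exact: ev_in|exact: subringX].
have {h} Pq : P (map_poly (ev u) q').[z].
  move: h; rewrite eq rmorphM /= rmorphXn /= map_polyX hornerM hornerXn.
  by case/(primeM pP (Aev _) (subringX _ sA Az)) => // /(primeX sA pP Az).
have [r er] : exists r, q' = r * 'X + (q'`_0)%:P.
  elim/poly_ind: q' {eq Pq} => [|r c _]; first by exists 0; rewrite mul0r coef0 add0r.
  by exists r; rewrite coefD coefMX eqxx add0r coefC eqxx.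
rewrite /root horner_coef0; apply/eqP/ind.
have := PQ _ Pq; rewrite {1}er rmorphD rmorphM /= map_polyX map_polyC !hornerE.
by rewrite addrC => h; apply: (prime_addr sA pQ _ h); apply: (primeMl pQ).
Qed.

Lemma indep_false n d P (psi : {rmorphism {mpoly K[d]} -> F}) (x : 'I_n -> F) :
  (forall k, psi k%:MP = iota k) -> (forall i, exists y, x i = psi y) -> P 0 ->
  (d < n)%N -> ~ indep P x.
Proof.
move=> hpsi /boolp.choice[y hy] P0 dn ind.
have [p p0 e] := algebraically_dependent y dn.
case/negP: p0; apply/eqP/ind.
suff -> : ev x p = psi (mmap (@mpolyC d K) y p) by rewrite e rmorph0.
rewrite /mmap rmorph_sum; apply: eq_bigr => m _; rewrite rmorphM hpsi; congr (_ * _).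
by rewrite /mmap1 rmorph_prod; apply: eq_bigr => i _; rewrite hy rmorphXn.
Qed.

(* Elements x_i of p_i but not of p_(i-1), together with elements that are
   algebraically independent modulo the largest prime, are independent. *)
Lemma chain_bound d A n r p (psi : {rmorphism {mpoly K[d]} -> F}) (u : 'I_r -> F) :
  subring A -> (forall k, A (iota k)) -> (forall k, psi k%:MP = iota k) ->
  (forall x, A x -> exists y, x = psi y) -> prime_chain A n p ->
  (forall i, A (u i)) -> indep (p n) u -> (n + r <= d)%N.
Proof.
move=> sA Ak hpsi hA [hp hlt]; elim: n r u p hp hlt => [|n IH] r u p hp hlt Au ind.
  rewrite leqNgt; apply/negP => dr; apply: (@indep_false _ _ (p 0%N) psi u) => //.
    by move=> i; apply: hA.
  exact: (prime0 (hp 0%N isT)).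
have [le nn] := hlt n (ltnSn n).
have [z Qz nPz] : exists2 z, p n.+1 z & ~ p n z.
  by apply: contrapT => h; apply: nn => z Qz; apply: contrapT => nPz; apply: h; exists z.
rewrite addSnnS; apply: (IH r.+1 (snoc u z) p).
- by move=> i hi; apply: hp; apply: leq_trans hi _.
- by move=> i hi; apply: hlt; apply: leq_trans hi _.
- move=> i; rewrite /snoc; case: unlift => [j|] //; exact: (primeS (hp n.+1 (leqnn _))).
- apply: (indep_snoc sA Ak (hp n (leqnSn n)) (hp n.+1 (leqnn _))) => //.
Qed.

End Independence.

(** * Regularity of polynomial rings *)

Section Span.
Variable F : fieldType.
Implicit Types (A X Y : set F).

Lemma span_in A X x : A 1 -> X x -> ideal_span A X x.
Proof.
by move=> A1 Xx; exists [:: (1, x)]; rewrite big_seq1 mul1r; split=> // u; rewrite inE => /eqP ->.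
Qed.

Lemma span0 A X : ideal_span A X 0.
Proof. by exists [::]; rewrite big_nil. Qed.

Lemma spanD A X x y : ideal_span A X x -> ideal_span A X y -> ideal_span A X (x + y).
Proof.
move=> [s [hs ->]] [t [ht ->]]; exists (s ++ t); rewrite big_cat; split=> // u.
by rewrite mem_cat => /orP[/hs|/ht].
Qed.

Lemma spanM A X a x : subring A -> A a -> ideal_span A X x -> ideal_span A X (a * x).
Proof.
move=> sA Aa [s [hs ->]]; exists [seq (a * u.1, u.2) | u <- s]; split.
  by move=> _ /mapP[u /hs[h1 h2] ->]; split=> //=; apply: subringM.
by rewrite big_map mulr_sumr; apply: eq_bigr => u _; rewrite mulrA.
Qed.

Lemma spanS A A' X Y x : A `<=` A' -> X `<=` Y -> ideal_span A X x -> ideal_span A' Y x.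
Proof.
by move=> h1 h2 [s [hs ->]]; exists s; split=> // u /hs[/h1 a /h2 b].
Qed.

Lemma span_prime A P X x : prime_ideal A P -> X `<=` P -> ideal_span A X x -> P x.
Proof.
move=> pP XP [s [hs ->]]; apply: (prime_sum pP) => u /hs[Au /XP Pu].
exact: (primeMl pP).
Qed.

End Span.

Section PolynomialExtension.
Variables (K F : fieldType) (iota : {rmorphism K -> F}).
Implicit Types (A B P Q : set F) (q : {poly F}).

Definition over B q := forall i, B q`_i.
Definition adjoin B z : set F := [set x | exists2 q, over B q & x = q.[z]].
Definition transcendental B z := forall q, over B q -> q.[z] = 0 -> q = 0.

(* Every localization of [B] at a prime ideal [P] is regular, of dimension [n]
   minus the transcendence degree of [B / P]. *)
Definition regular_data B n := forall P, prime_ideal B P ->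
  exists h r (p : nat -> set F) (f : seq F) (u : 'I_r -> F),
  [/\ prime_chain B h p, p h = P, size f = h, (h + r = n)%N &
  [/\ forall x, x \in f -> P x, forall i, B (u i), indep iota P u &
    forall g, P g -> exists s, [/\ B s, ~ P s & ideal_span B [set` f] (s * g)]]].

Section Step.
Variables (B : set F) (z : F).
Hypotheses (sB : subring B) (Bk : forall k, B (iota k)) (tz : transcendental B z).
Let C := adjoin B z.

Lemma over_sub Q q : Q `<=` B -> over Q q -> over B q.
Proof. by move=> h oq i; apply/h/oq. Qed.

Lemma overB q1 q2 : over B q1 -> over B q2 -> over B (q1 - q2).
Proof. by move=> h1 h2 i; rewrite coefB; apply: subringB. Qed.

Lemma overM q1 q2 : over B q1 -> over B q2 -> over B (q1 * q2).
Proof.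
by move=> h1 h2 i; rewrite coefM; apply: subring_sum => // j _; apply: subringM.
Qed.

Lemma overC Q b : Q 0 -> Q b -> over Q b%:P.
Proof. by move=> Q0 Qb i; rewrite coefC; case: eqP. Qed.

Lemma overXn k : over B 'X^k.
Proof. by move=> i; rewrite coefXn; case: eqP => _; [exact: subring1|exact: subring0]. Qed.

Lemma adjoin_inj q1 q2 : over B q1 -> over B q2 -> q1.[z] = q2.[z] -> q1 = q2.
Proof.
move=> h1 h2 e; apply/eqP; rewrite -subr_eq0; apply/eqP/tz; first exact: overB.
by rewrite hornerD hornerN e subrr.
Qed.

Lemma adjoin_incl b : B b -> C b.
Proof. by move=> Bb; exists b%:P; rewrite ?hornerC //; apply: overC => //; apply: subring0. Qed.

Lemma adjoin_gen : C z.
Proof. by exists 'X; rewrite ?hornerX // -['X]expr1; apply: overXn. Qed.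

Lemma adjoin_subring : subring C.
Proof.
split; first by apply: adjoin_incl; apply: subring1.
  by move=> _ _ [q1 h1 ->] [q2 h2 ->]; exists (q1 - q2); [exact: overB|rewrite !hornerE].
by move=> _ _ [q1 h1 ->] [q2 h2 ->]; exists (q1 * q2); [exact: overM|rewrite !hornerE].
Qed.

Lemma adjoin_constant Q b : Q `<=` B -> B b -> adjoin Q z b -> Q b.
Proof.
move=> QB Bb [q oq e].
suff eq : q = b%:P by have := oq 0%N; rewrite eq coefC.
apply: adjoin_inj; [exact: over_sub oq|exact: overC (subring0 sB) Bb|].
by rewrite hornerC.
Qed.

(** Gauss's argument: if i and j are the first degrees with coefficients outside Q, the coefficient
    of the product in degree i + j is the product of these two modulo Q. *)
Lemma adjoin_prime Q : prime_ideal B Q -> prime_ideal C (adjoin Q z).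
Proof.
move=> pQ; have QB := primeS pQ; split.
- split.
  + by move=> _ [q oq ->]; exists q => //; apply: over_sub oq.
  + by exists 0; rewrite ?horner0 // => i; rewrite coef0; apply: prime0 pQ.
  + move=> _ _ [q1 h1 ->] [q2 h2 ->]; exists (q1 + q2); rewrite ?hornerD // => i.
    by rewrite coefD; apply: (primeD pQ).
  + move=> _ _ [q1 h1 ->] [q2 h2 ->]; exists (q1 * q2); rewrite ?hornerM // => i.
    by rewrite coefM; apply: (prime_sum pQ) => j _; apply: (primeMl pQ).
- by move/(adjoin_constant QB (subring1 sB)); apply: prime1 pQ.
- move=> _ _ [q1 h1 ->] [q2 h2 ->] [q3 h3 e].
  apply: contrapT => /not_orP[n1 n2].
  have e3 : q3 = q1 * q2.
    by apply: adjoin_inj; [exact: over_sub h3|exact: overM|rewrite hornerM].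
  have low q : over B q -> ~ adjoin Q z q.[z] ->
      exists2 i, ~ Q q`_i & forall j, (j < i)%N -> Q q`_j.
    move=> oq nq; have ex : exists i, `[< ~ Q q`_i >].
      apply: contrapT => hn; apply: nq; exists q => // i; apply: contrapT => nQ.
      by apply: hn; exists i; apply/asboolP.
    case: (ex_minnP ex) => i /asboolP ni hmin; exists i => // j ji.
    by apply: contrapT => nj; have := hmin j (introT (asboolP _) nj); rewrite leqNgt ji.
  have [i ni li] := low _ h1 n1; have [j nj lj] := low _ h2 n2.
  have : Q (q1 * q2)`_(i + j) by rewrite -e3.
  rewrite coefM (bigD1 (inord i)) //= inordK ?ltnS ?leq_addr // addKn.
  move=> hs; have {hs} : Q (q1`_i * q2`_j).
    apply: (prime_addr sB pQ _ hs); rewrite big_mkcond; apply: (prime_sum pQ) => l _.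
    case: eqP => [_|nl]; first exact: prime0 pQ.
    have nli : (l : nat) <> i.
      by move=> el; apply: nl; apply/val_inj; rewrite /= inordK ?el // ltnS leq_addr.
    case: (ltngtP l i) => // hl; first exact: (primeMr pQ (li _ hl)).
    by apply: (primeMl pQ) => //; apply: lj; have := ltn_ord l; lia.
  by case/(primeM pQ) => //.
Qed.

Lemma adjoin_chain h p : prime_chain B h p -> prime_chain C h (fun i => adjoin (p i) z).
Proof.
move=> [hp hlt]; split=> i hi; first exact/adjoin_prime/hp.
have [le nn] := hlt i hi; split.
  by move=> _ [q oq ->]; exists q => // j; apply/le/oq.
move=> h'; apply: nn => x px; apply: (adjoin_constant (primeS (hp i (ltnW hi)))).
  exact: (primeS (hp i.+1 hi)).
apply: h'; exists x%:P; rewrite ?hornerC //; apply: overC => //; exact: prime0 (hp i.+1 hi).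
Qed.

Lemma contract_prime P : prime_ideal C P -> prime_ideal B (P `&` B).
Proof.
move=> pP; split; first split.
- by move=> x [].
- by split; [exact: prime0 pP|exact: subring0].
- by move=> x y [Px Bx] [Py By]; split; [apply: (primeD pP)|apply: subringD].
- by move=> x y Bx [Py By]; split;
    [apply: (primeMl pP) => //; apply: adjoin_incl|apply: subringM].
- by case=> /(prime1 pP).
- move=> x y Bx By [Pxy _]; case/(primeM pP (adjoin_incl Bx) (adjoin_incl By)): Pxy.
    by left.
  by right.
Qed.

Lemma span_adjoin Q (f : seq F) q : prime_ideal B Q ->
  (forall g, Q g -> exists s, [/\ B s, ~ Q s & ideal_span B [set` f] (s * g)]) ->
  over Q q -> exists s, [/\ B s, ~ Q s & ideal_span C [set` f] (s * q.[z])].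
Proof.
move=> pQ hQ; elim/poly_ind: q => [|q b IH] oq.
  exists 1; split; [exact: subring1|exact: prime1 pQ|].
  by rewrite horner0 mulr0; apply: span0.
have [|s [Bs ns hs]] := IH.
  by move=> i; have := oq i.+1; rewrite coefD coefMX coefC /= addr0.
have Qb : Q b by have := oq 0%N; rewrite coefD coefMX coefC /= add0r.
have [t [Bt nt ht]] := hQ _ Qb.
exists (s * t); split; [exact: subringM|exact: (prime_nM pQ)|].
have -> : s * t * (q * 'X + b%:P).[z] = (t * z) * (s * q.[z]) + s * (t * b).
  by rewrite hornerD hornerM hornerX hornerC; ring.
have sC := adjoin_subring; apply: spanD; apply: spanM => //.
- by apply: subringM => //; [exact: adjoin_incl|exact: adjoin_gen].
- exact: adjoin_incl.
- by apply: spanS ht => //; exact: adjoin_incl.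
Qed.

(** Let Q be the contraction of P. Either P is the extension of Q; then chain and generators carry
    over and z joins the independent elements. Or P contains the value of a polynomial not over Q;
    then one of least degree is a new generator and P itself lengthens the chain. In both cases h +
    r grows by one. *)
Lemma regular_data_adjoin n : regular_data B n -> regular_data C n.+1.
Proof.
move=> hB P pP; have pQ := contract_prime pP; set Q := P `&` B in pQ *.
have [h [r [p [f [u [ch ep szf hr [fQ Bu ind gen]]]]]]] := hB Q pQ.
have QP : adjoin Q z `<=` P.
  move=> _ [q oq ->]; rewrite horner_coef; apply: (prime_sum pP) => i _.
  apply: (primeMr pP); first by case: (oq i).
  by apply: (subringX _ adjoin_subring); apply: adjoin_gen.
have nPB x : B x -> ~ Q x -> ~ P x by move=> Bx nQ Px; apply: nQ.
have [alg|talg] := pselect (forall q, over B q -> P q.[z] -> over Q q).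
  exists h, r.+1, (fun i => adjoin (p i) z), f, (snoc u z); split.
  - exact: adjoin_chain.
  - rewrite ep; apply/seteqP; split=> // x Px.
    have [q oq e] := primeS pP Px; exists q => //; apply: alg => //.
    by rewrite -e.
  - exact: szf.
  - by rewrite addnS hr.
  - split.
    + by move=> x /fQ[].
    + by move=> i; rewrite /snoc; case: unlift => [j|]; [exact: adjoin_incl|exact: adjoin_gen].
    + move=> q; rewrite ev_snoc => /alg h0; apply: muni_inj0; apply/polyP => i.
      rewrite coef0; apply: ind; rewrite -coef_map; apply: h0 => j.
      by rewrite coef_map; apply: ev_in.
    + move=> g Pg; have [q oq e] := primeS pP Pg.
      have [|s [Bs ns hs]] := span_adjoin pQ gen (alg q oq _); first by rewrite -e.
      by exists s; split; [exact: adjoin_incl|exact: nPB|rewrite e].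
have [q0 [oq0 Pq0 nq0] qmin] : exists2 q0, [/\ over B q0, P q0.[z] & ~ over Q q0] &
    forall q, over B q -> P q.[z] -> (size q < size q0)%N -> over Q q.
  have ex : exists k, `[< exists q, [/\ over B q, P q.[z], ~ over Q q & size q = k] >].
    apply: contrapT => hn; apply: talg => q oq Pq; apply: contrapT => nq.
    by apply: hn; exists (size q); apply/asboolP; exists q.
  case: (ex_minnP ex) => k /asboolP[q0 [oq0 Pq0 nq0 szq0]] hmin.
  exists q0; first by split.
  move=> q oq Pq lt; apply: contrapT => nq.
  have : (k <= size q)%N by apply: hmin; apply/asboolP; exists q.
  by rewrite -szq0 leqNgt lt.
have sC := adjoin_subring.
pose lc := lead_coef q0.
have Blc : B lc by apply: oq0.
have szq0 : (0 < size q0)%N.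
  rewrite lt0n size_poly_eq0; apply/eqP => q00; apply: nq0 => i.
  by rewrite q00 coef0; apply: prime0 pQ.
(* If the leading coefficient were in Q, dropping the leading term would leave a smaller polynomial
   with value in P; it would be over Q by [qmin], and [q0] with it. *)
have nlc : ~ Q lc.
  move=> Qlc; apply: nq0; pose m := lc%:P * 'X^((size q0).-1).
  have om : over Q m.
    move=> i; rewrite coefCM coefXn; case: eqP => _; first by rewrite mulr1.
    by rewrite mulr0; apply: prime0 pQ.
  have om' : over B (q0 - m) by apply: overB => //; apply: over_sub om; apply: (primeS pQ).
  have Pm : P (q0 - m).[z].
    by rewrite hornerD hornerN; apply: (primeB sC pP) => //; apply: QP; exists m.
  have lt : (size (q0 - m)%R < size q0)%N.
    rewrite -(prednK szq0) ltnS; apply/leq_sizeP => j hj.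
    rewrite coefB coefCM coefXn; case: eqP => [->|ne]; first by rewrite mulr1 subrr.
    by rewrite mulr0 subr0 nth_default // -(prednK szq0) ltn_neqAle eq_sym hj andbT; apply/eqP.
  have oqm := qmin _ om' Pm lt; move=> i.
  by rewrite -(subrK m q0) coefD; apply: (primeD pQ).
pose f' := q0.[z] :: f.
(* Pseudo-division by [q0]: multiplying by [lc], which lies outside Q, replaces division by it, and
   [qmin] takes over once the degree is below that of [q0]. *)
have gen' q : over B q -> P q.[z] ->
    exists s, [/\ B s, ~ Q s & ideal_span C [set` f'] (s * q.[z])].
  move: {2}(size q) (leqnn (size q)) => k; elim: k q => [|k IH] q sz oq Pq.
    move: sz; rewrite size_poly_leq0 => /eqP ->; exists 1; split.
    - exact: subring1.
    - exact: prime1 pQ.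
    - by rewrite horner0 mulr0; apply: span0.
  case: (ltnP (size q) (size q0)) => [lt|ge].
    have [s [Bs ns hs]] := span_adjoin pQ gen (qmin _ oq Pq lt).
    exists s; split=> //; apply: spanS hs => // x /=; rewrite inE => ->; exact: orbT.
  pose e := (size q - size q0)%N; pose l := lead_coef q.
  have Bl : B l by apply: oq.
  pose q1 := lc%:P * q - l%:P * 'X^e * q0.
  have B0 := subring0 sB.
  have ol : over B (l%:P * 'X^e) by apply: overM; [exact: overC|exact: overXn].
  have oq1 : over B q1 by apply: overB; apply: overM => //; exact: overC.
  have eq1 : q1.[z] = lc * q.[z] - l * z ^+ e * q0.[z] by rewrite hornerD hornerN !hornerM !hornerC hornerXn.
  have Clz : C (l * z ^+ e).
    by apply: subringM => //; [exact: adjoin_incl|apply: subringX => //; exact: adjoin_gen].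
  have Pq1 : P q1.[z].
    rewrite eq1; apply: (primeB sC pP); apply: (primeMl pP) => //; exact: adjoin_incl.
  have sz1 : (size q1 <= k)%N.
    apply/leq_sizeP => j kj; rewrite coefB -mulrA !coefCM coefXnM.
    have [lt|ge'] := ltnP j (size q).-1; first by exfalso; lia.
    have je : (e <= j)%N by rewrite /e; lia.
    rewrite ltnNge je /=; have [->|ne] := eqVneq j (size q).-1.
      have -> : ((size q).-1 - e)%N = (size q0).-1 by rewrite /e; lia.
      by rewrite -!/(lead_coef _) -/l -/lc mulrC subrr.
    have hj : (size q <= j)%N by move: ne ge ge' szq0; clear; move: (size q) (size q0) => x y; lia.
    have hj' : (size q0 <= j - e)%N by rewrite /e; lia.
    by rewrite !nth_default // !mulr0 subrr.
  have [s [Bs ns hs]] := IH q1 sz1 oq1 Pq1.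
  exists (s * lc); split; [exact: subringM|exact: (prime_nM pQ)|].
  have -> : s * lc * q.[z] = s * q1.[z] + s * (l * z ^+ e) * q0.[z] by rewrite eq1; ring.
  apply: spanD => //; apply: spanM => //; first by apply: subringM => //; exact: adjoin_incl.
  by apply: span_in; [exact: subring1|rewrite /= inE eqxx].
exists h.+1, r, (fun i => if (i <= h)%N then adjoin (p i) z else P), f', u.
have [hp hlt] := adjoin_chain ch.
split; [split=> i hi | | | |split].
- by case: ifP => // ih; apply: hp.
- move: hi; rewrite /= ltnS leq_eqVlt => /orP[/eqP ->|ih]; last first.
    by rewrite ih orbT; apply: hlt.
  rewrite eqxx ltnn ep; split=> // h'.
  have [q oq e] := h' _ Pq0.
  by apply: nq0; rewrite (adjoin_inj oq0 (over_sub (primeS pQ) oq) e).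
- by rewrite ltnn.
- by rewrite /= szf.
- by rewrite addSn hr.
- by move=> x; rewrite inE => /orP[/eqP ->|/fQ[]].
- by move=> i; apply: adjoin_incl.
- by move=> q Pq; apply: ind; split=> //; apply: ev_in.
- move=> g Pg; have [q oq e] := primeS pP Pg.
  have [|s [Bs ns hs]] := gen' q oq; first by rewrite -e.
  by exists s; split; [exact: adjoin_incl|exact: nPB|rewrite e].
Qed.

End Step.

Local Notation ev := (mmap iota).

Definition polynomials n (z : 'I_n -> F) : set F := [set x | exists p, x = ev z p].

Lemma polynomials_subring n (z : 'I_n -> F) : subring (polynomials z).
Proof.
split; first by exists 1; rewrite rmorph1.
  by move=> _ _ [p ->] [q ->]; exists (p - q); rewrite rmorphB.
by move=> _ _ [p ->] [q ->]; exists (p * q); rewrite rmorphM.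
Qed.

Lemma polynomials_constant n (z : 'I_n -> F) k : polynomials z (iota k).
Proof. by exists k%:MP; rewrite mmapC. Qed.

Lemma ev_mwiden n (z : 'I_n.+1 -> F) p :
  ev z (mwiden p) = ev (fun i => z (widen_ord (leqnSn n) i)) p.
Proof.
rewrite [p in LHS]mpolyE [mwiden _]raddf_sum rmorph_sum /= /mmap; apply: eq_bigr => m _.
rewrite -/(mmap _ _ _) mwidenZ -mul_mpolyC rmorphM /= mmapC mwidenX mmapX; congr (_ * _).
rewrite /mmap1 big_ord_recr /= mnmwiden_ordmax expr0 mulr1.
by apply: eq_bigr => i _; rewrite mnmwiden_widen.
Qed.

Lemma muni_mwiden n (p : {mpoly K[n]}) : muni (mwiden p) = p%:P.
Proof.
rewrite [p in LHS]mpolyE [mwiden _]raddf_sum rmorph_sum /= [p in RHS]mpolyE rmorph_sum /=.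
apply: eq_bigr => m _; rewrite mwidenZ muniZ mwidenX muniE msuppX big_seq1 mcoeffX eqxx.
rewrite scale1r mnmwiden_ordmax expr0 alg_polyC -mul_polyC -polyCM.
rewrite mul_mpolyC; congr ((_ *: 'X_[_])%:P).
by apply/mnmP=> i; rewrite mnmE mnmwiden_widen.
Qed.

Lemma polynomials_adjoin n (z : 'I_n.+1 -> F) :
  polynomials z = adjoin (polynomials (fun i => z (widen_ord (leqnSn n) i))) (z ord_max).
Proof.
set u := fun i => _.
have ez : snoc u (z ord_max) =1 z.
  move=> i; case: (unliftP ord_max i) => [j ->|->]; last by rewrite snoc_max.
  have -> : lift ord_max j = widen_ord (leqnSn n) j by apply/val_inj; rewrite [LHS]lift_max.
  by rewrite snoc_widen.
have ev_ez p : ev (snoc u (z ord_max)) p = ev z p.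
  by apply: eq_bigr => m _; congr (_ * _); apply: eq_bigr => i _; rewrite ez.
apply/seteqP; split=> [_ [p ->]|_ [q oq ->]].
  exists (map_poly (ev u) (muni p)); last by rewrite -ev_snoc ev_ez.
  by move=> i; rewrite coef_map /=; exists (muni p)`_i.
have [c hc] := boolp.choice oq.
exists (\sum_(i < size q) mwiden (c i) * 'X_ord_max ^+ i).
rewrite horner_coef rmorph_sum /=; apply: eq_bigr => i _.
by rewrite rmorphM rmorphXn /= mmapX mmap1U ev_mwiden -/u -hc.
Qed.

Lemma polynomials_transcendental n (z : 'I_n.+1 -> F) : indep iota [set 0] z ->
  transcendental (polynomials (fun i => z (widen_ord (leqnSn n) i))) (z ord_max).
Proof.
set u := fun i => _; move=> ind q oq e.
have [c hc] := boolp.choice oq.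
pose p := \sum_(i < size q) mwiden (c i) * 'X_ord_max ^+ i.
have p0 : p = 0.
  apply: ind; rewrite /= -e horner_coef rmorph_sum /=; apply: eq_bigr => i _.
  by rewrite rmorphM rmorphXn /= mmapX mmap1U ev_mwiden -/u -hc.
have : muni p = \sum_(i < size q) c i *: 'X^i.
  rewrite rmorph_sum /=; apply: eq_bigr => i _.
  rewrite rmorphM rmorphXn /= muni_mwiden -mul_polyC; congr (_ * _ ^+ _).
  rewrite muniE msuppX big_seq1 mcoeffX eqxx scale1r mnm1E eqxx expr1.
  rewrite (_ : [multinom _ | i < n] = 0%MM) ?mpolyX0 ?scale1r //.
  apply/mnmP=> j; rewrite mnmE mnm0E mnm1E -val_eqE /= eq_sym.
  by have := ltn_ord j; case: eqP => //; lia.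
rewrite p0 rmorph0 => /esym e0; apply/polyP => i; rewrite coef0.
case: (ltnP i (size q)) => hi; last by rewrite nth_default.
rewrite hc; have : (\sum_(i < size q) c i *: 'X^i)`_i = c i.
  rewrite coef_sum (bigD1 (Ordinal hi)) //= coefZ coefXn eqxx mulr1 big1 ?addr0 // => j ne.
  rewrite coefZ coefXn; case: eqP => [ij|]; last by rewrite mulr0.
  by case/eqP: ne; apply/val_inj.
by rewrite e0 coef0 => <-; rewrite rmorph0.
Qed.

Lemma regular_data_polynomials n (z : 'I_n -> F) : indep iota [set 0] z ->
  regular_data (polynomials z) n.
Proof.
elim: n z => [|n IH] z ind.
  move=> P pP; have sB := polynomials_subring z.
  have P0 x : P x -> x = 0.
    move=> Px; have [p ex] := primeS pP Px; apply/eqP/negPn/negP => x0; apply: (prime1 pP).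
    rewrite -(mulVf x0); apply: (primeMl pP) => //.
    rewrite ex (nvar0_mpolyC p) mmapC -fmorphV; exact: polynomials_constant.
  exists 0%N, 0%N, (fun=> P), [::], z; split=> //; split=> //.
  - by move=> i; case: i.
  - by move=> p /P0 h; apply: ind.
  - move=> g /P0 ->; exists 1; split; [exact: subring1|exact: prime1 pP|].
    by rewrite mulr0; apply: span0.
rewrite polynomials_adjoin; apply: regular_data_adjoin.
- exact: polynomials_subring.
- exact: polynomials_constant.
- exact: polynomials_transcendental.
apply: IH => p h; have : mwiden p = 0 by apply: ind; rewrite ev_mwiden.
by move/eqP; rewrite -(mwiden0 n) (inj_eq (@inj_mwiden _ _)) => /eqP.
Qed.

(** The chain of length h bounds the local dimension from below, and the r independent elements with
    h + r = n bound it from above. So the h local generators are as many as the dimension. *)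
Lemma polynomials_regular n (z : 'I_n -> F) P : indep iota [set 0] z ->
  prime_ideal (polynomials z) P ->
  regular_local (localization (polynomials z) P) (localization_ideal (polynomials z) P).
Proof.
move=> ind pP; have sB := polynomials_subring z.
have [h [r [p [f [u [ch ep szf hr [fP Bu indu gen]]]]]]] := regular_data_polynomials ind pP.
have pE := extension_prime sB pP pP (fun x h => h).
exists f; split.
  apply: (localization_krull_dim sB pP).
    by exists p; rewrite szf // ep.
  move=> k q cq qP; have : (k + r <= n)%N; last by rewrite szf -hr leq_add2r.
  apply: (@chain_bound _ _ iota n (polynomials z) k r q (mmap iota z) u sB) => //.
  - exact: polynomials_constant.
  - by move=> x; apply: mmapC.
  - by move=> v /qP; apply: indu.
apply/seteqP; split=> [_ [x [y [Px By ny ->]]]|x].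
  have [s [Bs ns [t [ht e]]]] := gen x Px.
  exists [seq (v.1 / (s * y), v.2) | v <- t]; split.
    move=> _ /mapP[v /ht[Bv fv] ->]; split=> //=; exists v.1, (s * y); split=> //.
      exact: subringM.
    exact: (prime_nM pP).
  rewrite big_map /= -(mulKf (prime_neq0 pP ns) x) e mulr_sumr mulr_suml.
  by apply: eq_bigr => v _ /=; rewrite invfM; ring.
apply: (span_prime pE) => y /= fy; apply: (extension_incl sB pP); exact: fP.
Qed.

End PolynomialExtension.

(** * The semigroup ring *)

Section SemigroupRing.
Variables (K : fieldType) (c d alpha : nat) (a : 'I_c -> 'X_{1..d}).

Local Notation R := {mpoly K[d]}.
Local Notation F := {fraction R}.
Local Notation phi := (@tofrac R).
Local Notation S := (semigroup alpha a).
Local Notation SR := (semigroup_ring (K := K) alpha a).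
Local Notation A := (KS K alpha a).
Local Notation M := (KS_irrelevant K alpha a).

Definition iota : {rmorphism K -> F} := (phi \o @mpolyC d K : {rmorphism K -> F}).

Lemma phi_inj : injective phi.
Proof. by move=> x y /eqP; rewrite tofrac_eq => /eqP. Qed.

Lemma semigroup_ringX s : S s -> SR 'X_[s].
Proof. by move=> Ss m; rewrite msuppX inE => /eqP ->. Qed.

Lemma semigroup_ringZ k f : SR f -> SR (k *: f).
Proof. by move=> Sf m /msuppZ_le /Sf. Qed.

Lemma semigroup_ringB f g : SR f -> SR g -> SR (f - g).
Proof. by move=> Sf Sg m /msuppB_le; rewrite mem_cat => /orP[/Sf|/Sg]. Qed.

Lemma semigroup_ringM f g : SR f -> SR g -> SR (f * g).
Proof.
move=> Sf Sg m /msuppM_le /allpairsP[[m1 m2] /= [/Sf h1 /Sg h2 ->]].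
exact: semigroupD.
Qed.

Lemma semigroup_ringC k : SR k%:MP.
Proof.
rewrite -[_%:MP]mulr1 mul_mpolyC -mpolyX0; apply/semigroup_ringZ/semigroup_ringX.
exact: semigroup0.
Qed.

Lemma KS_subring : subring A.
Proof.
split; first by exists 1; rewrite ?rmorph1 // -mpolyC1; apply: semigroup_ringC.
  move=> _ _ [f Sf <-] [g Sg <-]; exists (f - g); rewrite ?rmorphB //.
  exact: semigroup_ringB.
move=> _ _ [f Sf <-] [g Sg <-]; exists (f * g); rewrite ?rmorphM //.
exact: semigroup_ringM.
Qed.

Lemma KS_iota k : A (iota k).
Proof. by exists k%:MP => //; apply: semigroup_ringC. Qed.

Lemma KS_phi f : A (phi f) <-> SR f.
Proof. by split=> [[g Sg /phi_inj <-]|Sf]; [exact: Sg|exists f]. Qed.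

Lemma KS_phiX s : S s -> A (phi 'X_[s]).
Proof. by move=> Ss; apply/KS_phi/semigroup_ringX. Qed.

(** The common source of the primes used below: the irrelevant ideal is the kernel of the constant
    coefficient, and a face that of setting variables to 0. *)
Lemma kernel_prime (D : idomainType) (g : {rmorphism R -> D}) :
  prime_ideal A (phi @` [set f | SR f /\ g f = 0]).
Proof.
split.
- split.
  + by move=> _ [f [Sf _] <-]; exists f.
  + by exists 0; rewrite ?rmorph0 //; split; [rewrite -mpolyC0; apply: semigroup_ringC|rewrite rmorph0].
  + move=> _ _ [f [Sf f0] <-] [h [Sh h0] <-]; exists (f + h); rewrite ?rmorphD //.
    split; last by rewrite rmorphD f0 h0 addr0.
    by move=> m /msuppD_le; rewrite mem_cat => /orP[/Sf|/Sh].
  + move=> _ _ [f Sf <-] [h [Sh h0] <-]; exists (f * h); rewrite ?rmorphM //.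
    by split; [apply: semigroup_ringM|rewrite rmorphM h0 mulr0].
- move=> [f [_ f0]]; rewrite -(rmorph1 phi) => /phi_inj f1.
  by move/eqP: f0; rewrite f1 rmorph1 oner_eq0.
- move=> _ _ [f Sf <-] [h Sh <-] [l [_ l0]]; rewrite -rmorphM => /phi_inj e.
  move/eqP: l0; rewrite e rmorphM mulf_eq0 => /orP[]/eqP h0; [left|right].
    by exists f.
  by exists h.
Qed.

Lemma KS_irrelevant_prime : prime_ideal A M.
Proof. exact: (@kernel_prime K (@mcoeff d K 0%MM)). Qed.

(* The face t_j = 0 for j in J. *)
Definition face_map (J : pred 'I_d) (f : R) : R :=
  f \mPo [tuple (if J j then 0 else 'X_j) | j < d].

Definition face (J : pred 'I_d) : set F := phi @` [set f | SR f /\ face_map J f = 0].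

Lemma face_mapX J m :
  face_map J 'X_[m] = if [forall j, J j ==> (m j == 0%N)] then 'X_[m] else 0.
Proof.
rewrite /face_map comp_mpolyX; case: ifPn => [/forallP h|].
  rewrite [RHS]mpolyXE_id; apply: eq_bigr => j _; rewrite tnth_mktuple.
  by case: ifP => // Jj; move: (h j); rewrite Jj => /eqP ->; rewrite !expr0.
rewrite negb_forall => /existsP[j]; rewrite negb_imply => /andP[Jj mj].
by rewrite (bigD1 j) //= tnth_mktuple Jj expr0n (negbTE mj) mul0r.
Qed.

Lemma face_map_coef J f m :
  (face_map J f)@_m = if [forall j, J j ==> (m j == 0%N)] then f@_m else 0.
Proof.
rewrite [f in LHS]mpolyE /face_map [X in X@__]raddf_sum raddf_sum /=.
transitivity (\sum_(m' <- msupp f) if [forall j, J j ==> (m j == 0%N)] then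
   f@_m' * (m' == m)%:R else 0).
  apply: eq_bigr => m' _; rewrite linearZ /= -/(face_map _ _) face_mapX mcoeffZ.
  case: (eqVneq m' m) => [->|ne]; first by case: ifP => _; rewrite ?mcoeffX ?eqxx ?mcoeff0 ?mulr0.
  by rewrite mulr0 if_same; case: ifP => _; rewrite ?mcoeffX ?(negbTE ne) ?mcoeff0 mulr0.
case: ifP => _; last by rewrite big1.
rewrite [f in RHS]mpolyE raddf_sum /=; apply: eq_bigr => m' _.
by rewrite mcoeffZ mcoeffX.
Qed.

Lemma face_map_eq0 J f : face_map J f = 0 <->
  forall m, m \in msupp f -> exists2 j, J j & m j != 0%N.
Proof.
split=> [e m mf|h].
  have := face_map_coef J f m; rewrite e mcoeff0; case: ifPn => [_ /esym/eqP|].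
    by rewrite mcoeff_eq0 mf.
  by rewrite negb_forall => /existsP[j]; rewrite negb_imply => /andP[Jj mj] _; exists j.
apply/mpolyP=> m; rewrite face_map_coef mcoeff0; case: ifP => // /forallP hm.
apply: memN_msupp_eq0; apply/negP => /h[j Jj]; have := hm j.
by rewrite Jj => /= ->.
Qed.

Lemma face_prime J : prime_ideal A (face J).
Proof. exact: (@kernel_prime R (comp_mpoly [tuple (if J j then 0 else 'X_j) | j < d])). Qed.

Lemma face_phi J f : face J (phi f) <-> SR f /\ face_map J f = 0.
Proof. by split=> [[g h /phi_inj <-]|h]; [exact: h|exists f]. Qed.

Lemma irrelevant_phi f : M (phi f) <-> SR f /\ f@_0%MM = 0.
Proof. by split=> [[g h /phi_inj <-]|h]; [exact: h|exists f]. Qed.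

Hypothesis alpha_gt0 : (0 < alpha)%N.

(** Consecutive primes are separated by y_i, which vanishes once t_i = 0 is imposed and not
    before. *)
Lemma face_chain : prime_chain A d (fun i => face (fun j => (j < i)%N)).
Proof.
split=> i hi; first exact: face_prime.
split.
  move=> _ [f [Sf /face_map_eq0 h] <-]; apply/face_phi; split=> //.
  by apply/face_map_eq0 => m /h[j ji mj]; exists j; rewrite // ltnW.
have SX := semigroup_vertex alpha a (Ordinal hi).
move=> /(_ (phi 'X_[U_(Ordinal hi) *+ alpha])); case.
  apply/face_phi; split; first exact: semigroup_ringX.
  apply/face_map_eq0 => m; rewrite msuppX inE => /eqP ->; exists (Ordinal hi) => /=.
    exact: ltnSn.
  by rewrite !mnm_simpl eqxx mul1n -lt0n.
move=> f [Sf /face_map_eq0 h] /phi_inj e.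
have [] := h (U_(Ordinal hi) *+ alpha)%MM; first by rewrite e msuppX inE.
move=> j ji; rewrite !mnm_simpl -val_eqE /=; have [ij|_] := eqVneq (i : nat) j; last by rewrite mul0n.
by rewrite -ij ltnn in ji.
Qed.

Lemma face_irrelevant : face (fun j => (j < d)%N) `<=` M.
Proof.
move=> _ [f [Sf /face_map_eq0 h] <-]; apply/irrelevant_phi; split=> //.
apply: memN_msupp_eq0; apply/negP => /h[j _]; by rewrite mnm0E.
Qed.

Lemma indep0 P (u : 'I_0 -> F) : prime_ideal A P -> indep iota P u.
Proof.
move=> pP p; rewrite (nvar0_mpolyC p) mmapC => h.
case: (eqVneq (p@_0%MM) 0) => [->|p0]; first by rewrite mpolyC0.
case: (prime1 pP); rewrite -(rmorph1 iota) -(mulVf p0) rmorphM.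
by apply: (primeMl pP) => //; apply: KS_iota.
Qed.

Lemma KS_chain_bound n r p (u : 'I_r -> F) : prime_chain A n p ->
  (forall i, A (u i)) -> indep iota (p n) u -> (n + r <= d)%N.
Proof.
move=> ch Au; apply: (chain_bound (psi := phi) KS_subring KS_iota) => //.
by move=> x [f _ <-]; exists f.
Qed.

Lemma KS_chain_le n p : prime_chain A n p -> (n <= d)%N.
Proof.
move=> ch; rewrite -(addn0 n).
apply: (@KS_chain_bound n 0 p (fun=> 0) ch) => [i|]; first by case: i.
by apply: indep0; apply: ch.1.
Qed.

Lemma KS_krull_dim : krull_dim A = d.
Proof.
apply: krull_dimE; split; first by eexists; exact: face_chain.
exact: KS_chain_le.
Qed.

Lemma KS_local_krull_dim : has_krull_dim (localization A M) d.
Proof.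
apply: (localization_krull_dim KS_subring KS_irrelevant_prime).
  by eexists; [exact: face_chain|exact: face_irrelevant].
by move=> k p ch _; apply: KS_chain_le ch.
Qed.

Lemma codimKSE : codimKS K alpha a = c.
Proof. by rewrite /codimKS KS_krull_dim addnK. Qed.

Lemma radicalD I0 (x y : F) : (forall u v, I0 u -> I0 v -> I0 (u + v)) ->
  (forall u v, A u -> I0 v -> I0 (u * v)) -> I0 0 -> A x -> A y ->
  (exists k, I0 (x ^+ k)) -> (exists k, I0 (y ^+ k)) -> exists k, I0 ((x + y) ^+ k).
Proof.
move=> ID IM I00 Ax Ay [k hk] [l hl]; exists (k + l)%N; rewrite exprDn.
have sA := KS_subring.
have In z n : I0 z -> I0 (z *+ n).
  by move=> Iz; elim: n => [|n IH]; rewrite ?mulr0n ?mulrS //; apply: ID.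
apply: (big_ind I0) => // i _; apply: In.
case: (leqP k (k + l - i)) => h.
  rewrite -(subnK h) exprD mulrAC; apply: IM => //.
  by apply: (subringM sA); apply: (subringX _ sA).
have hi : (l <= i)%N by lia.
rewrite -(subnK hi) exprD mulrA; apply: IM => //.
by apply: (subringM sA); apply: (subringX _ sA).
Qed.

Lemma semigroup_vertexM N j : S (U_(j) *+ (N * alpha))%MM.
Proof.
have -> : (U_(j) *+ (N * alpha) = U_(j) *+ alpha *+ N)%MM.
  by apply/mnmP=> k; rewrite !mnm_simpl -mulnA [(N * _)%N]mulnC.
exact/semigroupM/semigroup_vertex.
Qed.

(** At a coordinate j with m_j > 0, the vector alpha N m exceeds N e_j, and what remains is
    divisible by alpha, hence a sum of vertices. *)
Lemma monomial_radical N (m : 'X_{1..d}) : (0 < N)%N -> S m -> m != 0%MM ->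
  exists j, exists2 t, S t & (m *+ (alpha * N) = t + U_(j) *+ (N * alpha))%MM.
Proof.
move=> N0 Sm /mnm_neq0[j mj]; exists j; exists ((m *+ N - U_(j) *+ N) *+ alpha)%MM; first exact: semigroup_mulalpha.
apply/mnmP=> k; rewrite !mnm_simpl mulnBl.
rewrite [((j == k) * (N * alpha))%N]mulnA subnK; first by rewrite -mulnA [(N * _)%N]mulnC.
apply: leq_mul => //; apply: leq_mul => //.
by case: eqP => [<-|]; rewrite ?lt0n.
Qed.

(** All the y_k^N form a system of parameters by [monomial_radical]. Putting y_j^N first and y_i^N
    second makes the weak-sequence condition at index 1 one about the colon ideal (y_j^N) :
    y_i^N. *)
Lemma parameters N (i j : 'I_d) : i != j -> (0 < N)%N -> exists r : seq F,
  system_of_parameters (localization A M) (localization_ideal A M)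
    [:: phi 'X_[U_(j) *+ (N * alpha)], phi 'X_[U_(i) *+ (N * alpha)] & r].
Proof.
move=> ij N0; have sA := KS_subring; have pM := KS_irrelevant_prime.
pose y (k : 'I_d) := phi 'X_[U_(k) *+ (N * alpha)].
pose ks := [:: j, i & [seq k <- enum 'I_d | (k != i) && (k != j)]].
have uks : perm_eq ks (enum 'I_d).
  apply: uniq_perm; [|exact: enum_uniq|].
    rewrite /= inE !mem_filter eqxx /= !eqxx /= andbF /= negb_or eq_sym ij /=.
    exact/filter_uniq/enum_uniq.
  move=> k; rewrite !inE mem_filter mem_enum inE andbT.
  by case: (k == j); case: (k == i).
exists [seq y k | k <- [seq k <- enum 'I_d | (k != i) && (k != j)]].
rewrite -[X in system_of_parameters _ _ X]/(map y ks).
have yM k : M (y k).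
  apply/irrelevant_phi; split.
    exact/semigroup_ringX/semigroup_vertexM.
  rewrite mcoeffX; case: eqP => // /mnmP/(_ k); rewrite !mnm_simpl eqxx mul1n => e.
  by move: (muln_gt0 N alpha); rewrite e N0 alpha_gt0.
split.
- by rewrite size_map (perm_size uks) size_enum_ord; exact: KS_local_krull_dim.
- by move=> x /mapP[k _ ->]; apply: (extension_incl sA pM); apply: yM.
move=> _ [x [z [Mx Az nz ->]]].
pose I0 := ideal_span A [set` map y ks].
have rad : exists k, I0 (x ^+ k).
  case: Mx => f [Sf f0] <-; rewrite [f]mpolyE rmorph_sum big_seq.
  have ID u v : I0 u -> I0 v -> I0 (u + v) by apply: spanD.
  have IM u v : A u -> I0 v -> I0 (u * v) by apply: spanM.
  have I00 : I0 0 by apply: span0.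
  apply: (@proj2 (A (\sum_(m <- msupp f | m \in msupp f) phi (f@_m *: 'X_[m])))).
  apply: (big_ind (fun x => A x /\ exists k, I0 (x ^+ k))).
  + by split; [exact: subring0|exists 1%N; rewrite expr1].
  + move=> u v [Au hu] [Av hv]; split; first exact: subringD.
    exact: (radicalD ID IM I00).
  + move=> m mf; have m0 : m != 0%MM by apply: contraTneq mf => ->; rewrite mcoeff_msupp f0 eqxx.
    have Sm := Sf m mf.
    split; first exact/KS_phi/semigroup_ringZ/semigroup_ringX.
    exists (alpha * N)%N; have [l [t St e]] := monomial_radical N0 Sm m0.
    rewrite -mul_mpolyC rmorphM exprMn -rmorphXn -[X in _ * X]rmorphXn mpolyXn e mpolyXD rmorphM mulrA.
    apply: IM.
      by rewrite -rmorphM; apply/KS_phi/semigroup_ringM/semigroup_ringX => //;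
         rewrite -rmorphXn; apply: semigroup_ringC.
    apply: span_in; first exact: subring1.
    have lks : l \in ks by rewrite (perm_mem uks) mem_enum.
    exact: (map_f y lks).
case: rad => k hk; exists k; rewrite expr_div_n mulrC.
apply: spanM; first exact: localization_subring.
  exists 1, (z ^+ k); split; [exact: subring1|exact: subringX|exact: (prime_nX sA pM)|].
  by rewrite div1r.
by apply: spanS hk => // v Av; apply: extension_incl.
Qed.

Lemma buchsbaum_semigroupP : graded_buchsbaum A M -> buchsbaum_semigroup alpha a.
Proof.
move=> hB i j N f f' s ij N0 Sf Sf' e Ss s0.
have sA := KS_subring; have pM := KS_irrelevant_prime.
have [r /hB/(_ 1%N isT) h] := parameters ij N0.
have {h} := h (phi 'X_[s]) (phi 'X_[f]); rewrite /= ?take0.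
case.
- apply: (extension_incl sA pM); apply/irrelevant_phi; split; first exact: semigroup_ringX.
  by rewrite mcoeffX (negbTE s0).
- by apply: (extension_incl sA pM); apply: KS_phiX.
- rewrite -rmorphM -mpolyXD e mpolyXD rmorphM; apply: spanM.
  + exact: localization_subring.
  + by apply: (extension_incl sA pM); apply: KS_phiX.
  + apply: span_in; last by rewrite /= inE.
    by apply: subring1; apply: localization_subring.
move=> t [ht et].
have {ht et} [w Lw ew] : exists2 w, localization A M w &
    phi 'X_[s] * phi 'X_[f] = w * phi 'X_[U_(j) *+ (N * alpha)].
  exists (\sum_(u <- t) u.1).
    by apply: subring_sum; [exact: localization_subring|move=> u /ht[]].
  rewrite et mulr_suml big_seq [RHS]big_seq; apply: eq_bigr => u /ht[_].
  by rewrite /= inE => /eqP ->.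
case: Lw => _ [_ [[g Sg <-] [h Sh <-] nh ew']].
have h0 : phi h != 0 by apply: (prime_neq0 pM).
have e2 : 'X_[s + f] * h = g * 'X_[U_(j) *+ (N * alpha)].
  apply: phi_inj; rewrite !rmorphM mpolyXD rmorphM ew ew'.
  by rewrite mulrAC divfK.
(* The denominator [h] has a nonzero constant term, so the monomial s + f survives on the left. On
   the right it must be y_j^N times a monomial of [g], whose exponent is in S. *)
have : ('X_[s + f] * h)@_(s + f)%MM != 0.
  rewrite mulrC -[X in _@_X]addm0 mcoeffMX; apply/eqP => hz; apply: nh.
  by apply/irrelevant_phi.
rewrite e2 -mcoeff_msupp (perm_mem (msuppMX _ _)) => /mapP[m /Sg Sm em].
by exists m => //; rewrite [RHS]addmC em addmC.
Qed.

End SemigroupRing.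

(** * Isolated singularities *)

Section Overring.
Variables (F : fieldType) (A A' P : set F) (y : F).
Hypotheses (sA : subring A) (sA' : subring A') (pP : prime_ideal A P).
Hypotheses (AA' : A `<=` A') (Ay : A y) (nPy : ~ P y).
Hypothesis clear : forall x, A' x -> exists n, A (y ^+ n * x).

(** The prime of A' lying over P when A' is between A and A[1/y] and y is outside P. *)
Definition overring_prime : set F := [set x | A' x /\ exists n, P (y ^+ n * x)].
Local Notation P' := overring_prime.

Let AX n : A (y ^+ n). Proof. exact: subringX. Qed.
Let y0 : y != 0. Proof. exact: prime_neq0 pP _ nPy. Qed.

Let clear2 x w : A' x -> A' w -> exists n, A (y ^+ n * x) /\ A (y ^+ n * w).
Proof.
move=> /clear[n hn] /clear[m hm]; exists (n + m)%N.
by split; rewrite exprD -mulrA; [rewrite mulrCA|]; apply: subringM.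
Qed.

Lemma overring_prime_ideal : prime_ideal A' P'.
Proof.
split.
- split.
  + by move=> x [].
  + by split; [exact: subring0|exists 0%N; rewrite mulr0; exact: prime0 pP].
  + move=> x w [A'x [n hn]] [A'w [m hm]]; split; first exact: subringD.
    exists (n + m)%N; rewrite mulrDr; apply: (primeD pP).
      by rewrite exprD mulrAC; apply: (primeMr pP).
    by rewrite exprD -mulrA; apply: (primeMl pP).
  + move=> b x A'b [A'x [n hn]]; split; first exact: subringM.
    have [m hm] := clear A'b; exists (m + n)%N; rewrite exprD mulrACA.
    exact: (primeMl pP).
- case=> _ [n]; rewrite mulr1; exact: (prime_nX sA pP Ay nPy).
- move=> x w A'x A'w [_ [n h]]; have [m [hx hw]] := clear2 A'x A'w.
  have : P ((y ^+ m * x) * (y ^+ m * w)).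
    have : P (y ^+ n * ((y ^+ m * x) * (y ^+ m * w))).
      rewrite (_ : _ * _ = (y ^+ m * y ^+ m) * (y ^+ n * (x * w))); last by ring.
      by apply: (primeMl pP) => //; apply: subringM.
    case/(primeM pP) => //; first exact: subringM.
    by move/(prime_nX sA pP Ay nPy).
  by case/(primeM pP hx hw) => hP; [left|right]; split=> //; exists m.
Qed.

Let frac n x w : (y ^+ n * x) / (y ^+ n * w) = x / w.
Proof. by rewrite invfM mulrACA divff ?mul1r // expf_neq0. Qed.

Lemma overring_localization : localization A P = localization A' P'.
Proof.
apply/seteqP; split=> [_ [x [w [Ax Aw nw ->]]]|_ [x [w [Ax Aw nw ->]]]].
  exists x, w; split; rewrite // ?(AA' Ax) ?(AA' Aw); try exact: AA'.
  by case=> _ [n /(primeM pP (AX n) Aw)[/(prime_nX sA pP Ay nPy)|]].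
have [n [hx hw]] := clear2 Ax Aw; exists (y ^+ n * x), (y ^+ n * w); rewrite frac; split=> //.
by move=> h; apply: nw; split=> //; exists n.
Qed.

Lemma overring_localization_ideal : localization_ideal A P = localization_ideal A' P'.
Proof.
apply/seteqP; split=> [_ [x [w [Px Aw nw ->]]]|_ [x [w [[Ax [m hm]] Aw nw ->]]]].
  exists x, w; split=> //; last 2 first.
  - exact: AA'.
  - by case=> _ [n /(primeM pP (AX n) Aw)[/(prime_nX sA pP Ay nPy)|]].
  by split; [exact/AA'/(primeS pP)|exists 0%N; rewrite mul1r].
have [n hw] := clear Aw; exists (y ^+ (m + n) * x), (y ^+ (m + n) * w); rewrite frac; split=> //.
- by rewrite addnC exprD -mulrA; apply: (primeMl pP).
- by rewrite exprD -mulrA; apply: subringM.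
- by move=> h; apply: nw; split=> //; exists (m + n)%N.
Qed.

End Overring.

Lemma mulf_cancel (F : fieldType) (x y z p : F) : x != 0 ->
  y * x * (z * (p / x)) = z * y * p.
Proof. by move=> x0; field. Qed.

(** * Points near the vertices imply regularity *)

Section NearToRegular.
Variables (K : fieldType) (c d alpha : nat) (a : 'I_c -> 'X_{1..d}).
Hypothesis alpha_gt1 : (1 < alpha)%N.
Hypothesis hA : simplicial_config alpha a.
Hypothesis near : contains_all_near_vertices alpha a.

Local Notation R := {mpoly K[d]}.
Local Notation F := {fraction R}.
Local Notation phi := (@tofrac R).
Local Notation S := (semigroup alpha a).
Local Notation SR := (semigroup_ring (K := K) alpha a).
Local Notation A := (KS K alpha a).
Local Notation M := (KS_irrelevant K alpha a).
Local Notation iota := (@iota K d).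

Let alpha_gt0 : (0 < alpha)%N. Proof. exact: ltnW. Qed.

(** A prime with all vertices contains every monomial other than 1, some power of which is a
    multiple of a vertex; so it contains M. It equals M because a nonzero constant term would put a
    unit into it. *)
Lemma prime_vertex P : prime_ideal A P -> P <> M ->
  exists j, ~ P (phi 'X_[U_(j) *+ alpha]).
Proof.
move=> pP nPM; apply: contrapT => hn.
have sA := KS_subring K alpha a; have pM := KS_irrelevant_prime K alpha a.
have Pv j : P (phi 'X_[U_(j) *+ alpha]).
  by apply: contrapT => h; apply: hn; exists j.
have Pm m : S m -> m != 0%MM -> P (phi 'X_[m]).
  move=> Sm m0; apply: (@primeX _ _ _ sA pP _ (alpha * 1)); first exact: KS_phiX.
  have [j [t St e]] := monomial_radical (ltnSn 0) Sm m0.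
  rewrite -rmorphXn /= mpolyXn e mpolyXD rmorphM /= mul1n.
  by apply: (primeMl pP) => //; apply: KS_phiX.
have MP x : M x -> P x.
  case=> f [Sf f0] <-; rewrite [f]mpolyE rmorph_sum; apply: (prime_sum pP) => m mf /=.
  rewrite -mul_mpolyC rmorphM; apply: (primeMl pP); first exact: KS_iota.
  apply: Pm; first exact: Sf.
  by apply: contraTneq mf => ->; rewrite mcoeff_msupp f0 eqxx.
apply: nPM; apply/seteqP; split=> // x Px.
have [f Sf ef] := primeS pP Px; rewrite -ef; apply/irrelevant_phi; split=> //.
apply/eqP/negPn/negP => f0; apply: (prime1 pP).
have : P (phi (f@_0%MM)%:MP).
  have -> : (f@_0%MM)%:MP = f - (f - (f@_0%MM)%:MP) by rewrite subKr.
  rewrite rmorphB; have Pf : P (phi f) by rewrite ef.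
  apply: (primeB sA pP); first exact: Pf.
  apply/MP/irrelevant_phi; split; first exact/semigroup_ringB/semigroup_ringC.
  by rewrite mcoeffB mcoeffC eqxx mulr1 subrr.
move=> h; rewrite -(rmorph1 iota) -(mulVf f0) rmorphM.
by apply: (primeMl pP) => //; apply: KS_iota.
Qed.

Section Chart.
Variable j : 'I_d.

(* Coordinates t_j^alpha and t_i / t_j on the chart y_j <> 0. *)
Definition chart (i : 'I_d) : F :=
  if i == j then phi 'X_[U_(j) *+ alpha] else phi 'X_i / phi 'X_j.

(** The exponent of t_j^N times the chart monomial [m]: y_j contributes alpha m_j to the j-th
    coordinate, and each t_i / t_j lowers it by one. For N >= deg m the subtraction does not
    truncate. *)
Definition chart_exponent N (m : 'X_{1..d}) : 'X_{1..d} :=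
  [multinom if i == j then (alpha * m j + N - \sum_(l | l != j) m l)%N else m i | i < d].

Let X_neq0 m : phi 'X_[m] != 0.
Proof.
rewrite tofrac_eq0; apply/eqP => /(congr1 (mcoeff m))/eqP.
by rewrite mcoeffX eqxx mcoeff0 oner_eq0.
Qed.

Lemma chart_monomial N m : (mdeg m <= N)%N ->
  phi 'X_j ^+ N * mmap iota chart 'X_[m] = phi 'X_[chart_exponent N m].
Proof.
rewrite mdegE (bigD1 j) //= => le; set s := (\sum_(l | l != j) m l)%N in le *.
have sN : (s <= N)%N by apply: leq_trans le; rewrite leq_addl.
rewrite mmapX /mmap1 (bigD1 j) //= {1}/chart eqxx.
rewrite (eq_bigr (fun i => phi ('X_i ^+ m i) * (phi 'X_j ^+ m i)^-1)); last first.
  by move=> i ne; rewrite /chart (negbTE ne) expr_div_n rmorphXn.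
rewrite big_split /= prodfV prodrXr -/s [in RHS]mpolyXE_id [in RHS](bigD1 j) //= mnmE eqxx -/s.
rewrite [X in _ = phi (_ * X)](eq_bigr (fun i => 'X_i ^+ m i)); last first.
  by move=> i ne; rewrite mnmE (negbTE ne).
rewrite [in RHS]rmorphM [X in _ = _ * X]rmorph_prod rmorphXn /=.
have -> : phi 'X_[U_(j) *+ alpha] = phi 'X_j ^+ alpha by rewrite -mpolyXn rmorphXn.
rewrite -exprM -addnBA // exprD -{1}(subnK sN) exprD.
exact: mulf_cancel (expf_neq0 s (X_neq0 U_(j)%MM)).
Qed.

Lemma chart_exponent_inj N (m m' : 'X_{1..d}) : (mdeg m <= N)%N -> (mdeg m' <= N)%N ->
  chart_exponent N m = chart_exponent N m' -> m = m'.
Proof.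
rewrite !mdegE (bigD1 j) //= => le; rewrite (bigD1 j) //= => le' /mnmP e.
have eq i : i != j -> m i = m' i by move=> /negbTE ne; have := e i; rewrite !mnmE ne.
have es : (\sum_(l | l != j) m l = \sum_(l | l != j) m' l)%N by apply: eq_bigr.
apply/mnmP=> i; have [->|/eq//] := eqVneq i j; have := e j; rewrite !mnmE eqxx -es.
rewrite -es in le'; move: (\sum_(l | _) _)%N le le' => s le le'.
rewrite -!addnBA; [|lia|lia]; move/addIn/eqP; rewrite eqn_pmul2l // => /eqP; exact.
Qed.

(** After multiplication by one power of t_j, distinct chart monomials become distinct monomials of
    K[t]. *)
Lemma chart_indep : indep iota [set 0] chart.
Proof.
move=> p /= e; pose N := msize p.
have hN m : m \in msupp p -> (mdeg m <= N)%N by move=> /msize_mdeg_lt /ltnW.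
pose q := \sum_(m <- msupp p) p@_m *: 'X_[chart_exponent N m].
have q0 : q = 0.
  apply: (@phi_inj K d); rewrite rmorph0 -(mulr0 (phi 'X_j ^+ N)) -e /q /mmap.
  rewrite mulr_sumr rmorph_sum /= big_seq [RHS]big_seq; apply: eq_bigr => m /hN le.
  by rewrite -mul_mpolyC rmorphM /= mulrCA -(chart_monomial le) mmapX.
apply/mpolyP => m; rewrite mcoeff0; apply/eqP; rewrite mcoeff_eq0; apply/negP => mp.
have : q@_(chart_exponent N m) = p@_m.
  rewrite /q (bigD1_seq m) ?msupp_uniq //= mcoeffD raddf_sum /= mcoeffZ mcoeffX eqxx mulr1.
  rewrite big_seq_cond big1 ?addr0 // => m' /andP[m'p ne].
  rewrite mcoeffZ mcoeffX; case: eqP => [/chart_exponent_inj em|]; last by rewrite mulr0.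
  by rewrite em ?hN ?eqxx // in ne.
rewrite q0 mcoeff0 => /esym/eqP; rewrite mcoeff_eq0; by rewrite mp.
Qed.

(** Each s in S has degree alpha k for some k, so t^s is y_j^k times the product of the (t_i /
    t_j)^(s_i). *)
Lemma KS_chart : A `<=` polynomials iota chart.
Proof.
have sB := polynomials_subring iota chart.
move=> _ [f Sf <-]; rewrite [f]mpolyE rmorph_sum; apply: subring_sum => // s /Sf Ss /=.
rewrite -mul_mpolyC rmorphM; apply: subringM => //; first exact: polynomials_constant.
have /dvdnP[k ek] := dvdn_mdeg hA Ss.
pose m : 'X_{1..d} := [multinom if i == j then k else s i | i < d].
exists 'X_[m]; have le : (mdeg m <= mdeg m)%N by [].
apply: (mulfI (expf_neq0 (mdeg m) (X_neq0 U_(j)%MM))); rewrite chart_monomial //.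
rewrite -rmorphXn -rmorphM /= mpolyXn -mpolyXD; congr (phi 'X_[_]).
apply/mnmP=> i; rewrite !mnmE; case: (eqVneq i j) => [->|ne]; last first.
  by rewrite mulmnE mnm1E eq_sym (negbTE ne) mul0n.
rewrite mulmnE mnm1E eqxx mul1n (eq_bigr s) => [|l ne]; last by rewrite mnmE (negbTE ne).
move: ek; rewrite mdegE (bigD1 j) //=; move: (\sum_(l | _) _)%N => t ek.
by rewrite mulnC -ek; lia.
Qed.

(** The elements with a denominator y_j^n form a subring, and y_j t_i / t_j is the monomial of the
    point (alpha - 1, 1) near the j-th vertex, hence in K[S]. *)
Lemma chart_clear x : polynomials iota chart x ->
  exists n, A (phi 'X_[U_(j) *+ alpha] ^+ n * x).
Proof.
have sA := KS_subring K alpha a; set y := phi _.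
have Ay : A y by apply/KS_phiX/semigroup_vertex.
pose D := [set x | exists n, A (y ^+ n * x)].
have sD : subring D.
  split.
  - by exists 0%N; rewrite mulr1; apply: subringX.
  - move=> u v [n hn] [m hm]; exists (n + m)%N; rewrite mulrBr; apply: subringB => //.
      by rewrite exprD mulrAC; apply: subringM => //; apply: subringX.
    by rewrite exprD -mulrA; apply: subringM => //; apply: subringX.
  - move=> u v [n hn] [m hm]; exists (n + m)%N; rewrite exprD mulrACA.
    exact: subringM.
have AD u : A u -> D u by exists 0%N; rewrite mul1r.
move=> [p ->]; apply: (ev_in (A := D)) => // [k|i].
  exact/AD/KS_iota.
rewrite /chart; case: eqVneq => [_|ne]; first exact: AD.
exists 1%N; rewrite eq_sym in ne; have [k' ek'] := near ne.
suff -> : y ^+ 1 * (phi 'X_i / phi 'X_j) = phi 'X_[U_(j) *+ (alpha - 1) + U_(i)].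
  by apply: KS_phiX; rewrite -ek'; apply: semigroup_gens.
rewrite mpolyXD rmorphM /= expr1 mulrCA [LHS]mulrC; congr (_ * _).
have e1 : ((U_(j) : 'X_{1..d}) *+ alpha = U_(j) *+ (alpha - 1) + U_(j))%MM.
  by apply/mnmP=> l; rewrite !mnm_simpl; case: eqP => _; lia.
by rewrite /y e1 mpolyXD rmorphM mulfK ?X_neq0.
Qed.

End Chart.
Lemma near_isolated : isolated_singularity A M.
Proof.
move=> P pP /(prime_vertex pP)[j nPj].
have sA := KS_subring K alpha a.
have sB := polynomials_subring iota (chart j).
have Ay : A (phi 'X_[U_(j) *+ alpha]) by apply/KS_phiX/semigroup_vertex.
have AB := @KS_chart j; have clr := @chart_clear j.
rewrite (overring_localization sA pP AB Ay nPj clr).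
rewrite (overring_localization_ideal sA pP AB Ay nPj clr).
apply: polynomials_regular; first exact: chart_indep.
exact: (overring_prime_ideal sA sB pP Ay nPj clr).
Qed.

End NearToRegular.

(** * Regularity at the rays implies the points near the vertices *)

Lemma span_coords (F : fieldType) (A : set F) (f : seq F) x : subring A ->
  ideal_span A [set` f] x ->
  exists b : 'I_(size f) -> F, (forall l, A (b l)) /\ x = \sum_l b l * f`_l.
Proof.
move=> sA [s [hs ->]]; elim: s hs => [|u s IH] hs.
  exists (fun=> 0); split; first by move=> _; apply: subring0.
  by rewrite big_nil big1 // => l _; rewrite mul0r.
have [|b [Ab e]] := IH; first by move=> v vs; apply: hs; rewrite inE vs orbT.
have [Au fu] := hs u (mem_head _ _).
have lt : (index u.2 f < size f)%N by rewrite index_mem.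
exists (fun l => b l + (if l == Ordinal lt then u.1 else 0)); split.
  move=> l; apply: subringD => //; case: ifP => // _; exact: subring0.
rewrite big_cons e [RHS](eq_bigr (fun l => b l * f`_l + (if l == Ordinal lt then u.1 else 0) * f`_l)).
  rewrite big_split /= addrC; congr (_ + _).
  rewrite (bigD1 (Ordinal lt)) //= eqxx nth_index // big1 ?addr0 // => l /negbTE ->.
  by rewrite mul0r.
by move=> l _; rewrite mulrDl.
Qed.

Lemma common_denominator (F : fieldType) (A P : set F) n (b : 'I_n -> F) :
  subring A -> prime_ideal A P -> (forall l, localization A P (b l)) ->
  exists D, [/\ A D, ~ P D & forall l, A (D * b l)].
Proof.
move=> sA pP; elim: n b => [|n IH] b hb.
  exists 1; split; [exact: subring1|exact: prime1 pP|by case].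
have [D [AD nD hD]] := IH (fun l => b (lift ord0 l)) (fun l => hb _).
have [y [Ay ny Ab]] := localization_clear sA pP (hb ord0).
exists (D * y); split; [exact: subringM|exact: (prime_nM pP)|].
move=> l; case: (unliftP ord0 l) => [l' ->|->].
  by rewrite mulrAC; apply: subringM.
by rewrite -mulrA [y * _]mulrC; apply: subringM.
Qed.

Section RegularToNear.
Variables (K : fieldType) (c d alpha : nat) (a : 'I_c -> 'X_{1..d}).
Hypothesis c_gt1 : (1 < c)%N.
Hypothesis alpha_gt1 : (1 < alpha)%N.
Hypothesis hA : simplicial_config alpha a.

Local Notation R := {mpoly K[d]}.
Local Notation F := {fraction R}.
Local Notation phi := (@tofrac R).
Local Notation S := (semigroup alpha a).
Local Notation SR := (semigroup_ring (K := K) alpha a).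
Local Notation A := (KS K alpha a).
Local Notation M := (KS_irrelevant K alpha a).
Local Notation iota := (@iota K d).

Let alpha_gt0 : (0 < alpha)%N. Proof. exact: ltnW. Qed.

Section Vertex.
Variable j : 'I_d.

(* The exponent modulo Z e_j. *)
Definition proj (s : 'X_{1..d}) : 'X_{1..d} := [multinom if i == j then 0%N else s i | i < d].

Definition irreducible_proj t :=
  [/\ t != 0%MM, exists2 s, S s & proj s = t &
    forall s1 s2, S s1 -> S s2 -> (proj s1 + proj s2)%MM = t ->
      proj s1 = 0%MM \/ proj s2 = 0%MM].

Local Notation P := (face alpha a (fun i => i != j) : set F).

Lemma projD s t : proj (s + t)%MM = (proj s + proj t)%MM.
Proof. by apply/mnmP=> i; rewrite !mnmE; case: eqP; rewrite ?mnmE. Qed.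

Lemma proj_eq0 s : (proj s == 0%MM) = [forall i, (i != j) ==> (s i == 0%N)].
Proof.
apply/eqP/forallP => [/mnmP h i|h].
  by apply/implyP => /negbTE ij; have := h i; rewrite mnmE ij mnm0E => ->.
apply/mnmP=> i; rewrite mnmE mnm0E; case: eqVneq => // ij.
by have := h i; rewrite ij => /eqP.
Qed.

(** The component of degree [t] in the grading by exponents modulo Z e_j. *)
Definition part t (f : R) : R := \sum_(m <- msupp f | proj m == t) f@_m *: 'X_[m].

Lemma part_coef t f m : (part t f)@_m = if proj m == t then f@_m else 0.
Proof.
rewrite /part raddf_sum /=; case: (boolP (m \in msupp f)) => mf.
  rewrite big_mkcond (bigD1_seq m) ?msupp_uniq //= big1 ?addr0.
    by rewrite mcoeffZ mcoeffX eqxx mulr1.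
  move=> m' ne; case: ifP => // _; by rewrite mcoeffZ mcoeffX (negbTE ne) mulr0.
rewrite big_seq_cond big1 => [|m' /andP[m'f _]].
  by rewrite memN_msupp_eq0 // if_same.
rewrite mcoeffZ mcoeffX; case: eqP => [e|]; last by rewrite mulr0.
by rewrite -e m'f in mf.
Qed.

Lemma partD t f g : part t (f + g) = part t f + part t g.
Proof.
by apply/mpolyP=> m; rewrite mcoeffD !part_coef mcoeffD; case: ifP; rewrite ?addr0.
Qed.

Lemma part_sum t (I : Type) (r : seq I) (f : I -> R) :
  part t (\sum_(i <- r) f i) = \sum_(i <- r) part t (f i).
Proof.
apply: (big_morph (part t) (partD t)).
by apply/mpolyP=> m; rewrite part_coef mcoeff0 if_same.
Qed.

Lemma partX t m : part t 'X_[m] = if proj m == t then 'X_[m] else 0.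
Proof.
apply/mpolyP=> m'; rewrite part_coef mcoeffX; case: (eqVneq m m') => [<-|ne].
  by case: ifP; rewrite ?mcoeffX ?eqxx ?mcoeff0.
by rewrite if_same; case: ifP; rewrite ?mcoeffX ?(negbTE ne) ?mcoeff0.
Qed.

Lemma faceP f : P (phi f) <-> SR f /\ forall m, m \in msupp f -> proj m != 0%MM.
Proof.
have e m : proj m != 0%MM <-> exists2 i, i != j & m i != 0%N.
  rewrite proj_eq0 negb_forall; split=> [/existsP[i]|[i ij mi]].
    by rewrite negb_imply => /andP[ij mi]; exists i.
  by apply/existsP; exists i; rewrite negb_imply ij.
split=> [/face_phi[Sf /face_map_eq0 h]|[Sf h]].
  by split=> // m /h/e.
by apply/face_phi; split=> //; apply/face_map_eq0 => m /h/e.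
Qed.

(* Taking the part of an irreducible degree modulo Z e_j is semilinear over
   restriction to the ray N e_j. *)
Lemma part_mul t f g : irreducible_proj t -> SR f -> P (phi g) ->
  part t (f * g) = part 0%MM f * part t g.
Proof.
move=> [t0 _ irr] Sf /faceP[Sg hg].
have supp1 u h m : m \in msupp (part u h) -> m \in msupp h /\ proj m = u.
  by rewrite !mcoeff_msupp part_coef; case: (eqVneq (proj m) u) => [->|_]; rewrite ?eqxx.
have supp2 u h m : m \in msupp (h - part u h) -> m \in msupp h /\ proj m != u.
  by rewrite !mcoeff_msupp mcoeffB part_coef; case: (eqVneq (proj m) u) => _; rewrite ?subrr ?eqxx ?subr0.
have partM u (x y : R) (b : bool) : (forall m1 m2, m1 \in msupp x -> m2 \in msupp y ->
    (proj (m1 + m2)%MM == u) = b) -> part u (x * y) = if b then x * y else 0.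
  move=> h; apply/mpolyP=> m; rewrite part_coef.
  case: (boolP (m \in msupp (x * y))) => [/[dup] mxy|nm].
    move/msuppM_le/allpairsP => [[m1 m2] /= [h1 h2 em]].
    by rewrite em h // -em; case: b {h}; rewrite ?mcoeff0.
  by rewrite memN_msupp_eq0 // if_same; case: b {h}; rewrite ?mcoeff0 ?memN_msupp_eq0.
(* Only the first product has degree t. In the second the degree of the right factor differs from t;
   in the third t would split into two nonzero degrees, against irreducibility. *)
have -> : f * g = part 0%MM f * part t g + part 0%MM f * (g - part t g) + (f - part 0%MM f) * g.
  by rewrite -mulrDr [part t g + _]addrC subrK -mulrDl [part _ f + _]addrC subrK.
rewrite !partD (partM _ _ _ true) => [|m1 m2 /supp1[_ e1] /supp1[_ e2]]; last first.
  by rewrite projD e1 e2 add0m eqxx.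
rewrite (partM _ _ _ false) => [|m1 m2 /supp1[_ e1] /supp2[_ e2]]; last first.
  by rewrite projD e1 add0m (negbTE e2).
rewrite (partM _ _ _ false) => [|m1 m2 /supp2[m1f e1] m2g]; first by rewrite !addr0.
apply/eqP; rewrite projD => /(irr _ _ (Sf _ m1f) (Sg _ m2g))[]; apply/eqP => //.
exact: hg.
Qed.

(* d irreducible degrees would be linearly independent in the cotangent space of
   K[S] at P, whose dimension is at most d - 1 if the localization is regular. *)
Lemma regular_irreducible (t : 'I_d -> 'X_{1..d}) :
  regular_local (localization A P) (localization_ideal A P) -> injective t ->
  ~ (forall i, irreducible_proj (t i)).
Proof.
move=> [s [dim_s span_s]] inj_t irr.
have sA := KS_subring K alpha a; have pP : prime_ideal A P by apply: face_prime.
(* y_j stays transcendental modulo P, because P consists of the elements vanishing on the ray; one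
   independent element leaves at most d - 1 for the dimension. *)
have lt : (size s < d)%N.
  case: dim_s => [[q ch] _].
  have [ch' qP] := localization_unchain sA pP ch.
  rewrite -addn1.
  apply: (@KS_chain_bound K c d alpha a (size s) 1 _ (fun=> phi 'X_[U_(j) *+ alpha]) ch').
    by move=> _; apply/KS_phiX/semigroup_vertex.
  move=> p /qP; pose g := \sum_(m <- msupp p) p@_m *: 'X_[K, U_(j) *+ alpha *+ m ord0].
  have -> : mmap iota (fun=> phi 'X_[U_(j) *+ alpha]) p = phi g.
    rewrite /mmap /g rmorph_sum /=; apply: eq_bigr => m _.
    by rewrite -mul_mpolyC rmorphM /mmap1 big_ord1 -[in RHS]mpolyXn [in RHS]rmorphXn.
  move/faceP => [_ hg]; have {}hg m : g@_m = 0.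
    case: (boolP (m \in msupp g)) => [/[dup] mg /hg|]; last exact: memN_msupp_eq0.
    have := mg => /msupp_sum_le /flatten_mapP[m' _ /msuppZ_le]; rewrite msuppX inE => /eqP ->.
    case/negP; apply/eqP/mnmP=> i; rewrite mnmE mnm0E.
    by case: eqVneq => // ij; rewrite !mnm_simpl eq_sym (negbTE ij).
  apply/mpolyP=> m; rewrite mcoeff0.
  case: (boolP (m \in msupp p)) => mp; last exact: memN_msupp_eq0.
  rewrite -(hg (U_(j) *+ alpha *+ m ord0)%MM).
  rewrite /g raddf_sum /= (bigD1_seq m) ?msupp_uniq //= mcoeffZ mcoeffX eqxx mulr1.
  rewrite big1 ?addr0 // => m' ne; rewrite mcoeffZ mcoeffX; case: eqP; last by rewrite mulr0.
  move/mnmP/(_ j); rewrite !mnm_simpl eqxx mul1n => /eqP; rewrite eqn_pmul2l // => /eqP e.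
  by case/eqP: ne; apply/mnmP=> i; rewrite ord1.
have sL := localization_subring sA pP.
have hs l : exists g h, [/\ P (phi g), A (phi h), ~ P (phi h) & s`_l = phi g / phi h].
  case: (ltnP l (size s)) => hl; last first.
    exists 0, 1; rewrite rmorph0 rmorph1 mul0r nth_default //.
    by split=> //; [exact: prime0 pP|exact: subring1|exact: prime1 pP].
  have : localization_ideal A P s`_l.
    by rewrite span_s; apply: span_in; [exact: subring1|apply: mem_nth].
  case=> x [y [Px Ay ny e]]; have [g Sg eg] := primeS pP Px; have [h Sh eh] := Ay.
  by exists g, h; rewrite eg eh; split.
have [g hg] := boolp.choice hs; have {hs hg} [h hg] := boolp.choice hg.
have su k : exists2 u, S u & proj u = t k by case: (irr k).
have [u hu] := boolp.choice (fun k => let: ex_intro2 u Su pu := su k in ex_intro _ u (conj Su pu)).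
have Pu k : P (phi 'X_[u k]).
  apply/faceP; split; first exact/semigroup_ringX/(hu k).1.
  by move=> m; rewrite msuppX inE => /eqP ->; rewrite (hu k).2; case: (irr k).
have hb k : exists b : 'I_(size s) -> F, (forall l, localization A P (b l)) /\
    phi 'X_[u k] = \sum_l b l * phi (g l).
  have : localization_ideal A P (phi 'X_[u k]) by apply: extension_incl.
  rewrite span_s => /(span_coords sL)[b [Lb eb]].
  exists (fun l => b l / phi (h l)); split.
    move=> l; apply: subringM => //; have [_ Ah nh _] := hg l.
    exact: localization_inv.
  by rewrite eb; apply: eq_bigr => l _; have [_ _ _ ->] := hg l; rewrite mulrA mulrAC.
have [b hb'] := boolp.choice hb.
have hD k : exists D (B : 'I_(size s) -> R), [/\ SR D, ~ P (phi D), forall l, SR (B l) &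
    D * 'X_[u k] = \sum_l B l * g l].
  have [Lb eb] := hb' k; have [D [AD nD hD]] := common_denominator sA pP Lb.
  have [D' SD' eD'] := AD.
  have [B hB] := boolp.choice (fun l => let: ex_intro2 B SB eB := hD l in
    ex_intro (fun B => SR B /\ phi B = D * b k l) B (conj SB eB)).
  exists D', B; split=> //; first by rewrite eD'.
    by move=> l; case: (hB l).
  apply: (@phi_inj K d); rewrite rmorphM /= eD' eb mulr_sumr rmorph_sum /=.
  by apply: eq_bigr => l _; rewrite rmorphM /= (hB l).2 mulrA.
have [D hD'] := boolp.choice hD; have {hD hD'} [B hB] := boolp.choice hD'.
(* Coefficients restricted to the ray: d rows and fewer columns, hence a relation between the
   rows. *)
pose N := \matrix_(k < d, l < size s) phi (part 0%MM (B k l)).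
have [v v0 vN] := exists_left_kernel N lt.
case/negP: v0; apply/eqP/rowP => k; rewrite mxE.
have key i : phi (part 0%MM (D i)) * phi (part (t k) 'X_[u i]) =
    \sum_l phi (part 0%MM (B i l)) * phi (part (t k) (g l)).
  have [SD nD SB eD] := hB i.
  rewrite -rmorphM -part_mul // eD part_sum rmorph_sum; apply: eq_bigr => l _.
  by rewrite -rmorphM -part_mul //; case: (hg l).
(* In degree t k the relation retains only the summand i = k, as [t] is injective. [D k] is outside
   P, so its restriction to the ray is nonzero and v_k = 0. *)
have : \sum_i v 0 i * (phi (part 0%MM (D i)) * phi (part (t k) 'X_[u i])) = 0.
  under eq_bigr => i _ do rewrite key mulr_sumr.
  rewrite exchange_big /= big1 // => l _.
  under eq_bigr => i _ do rewrite mulrA.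
  rewrite -mulr_suml; move/rowP/(_ l): vN; rewrite !mxE => e.
  rewrite [X in X * _](_ : _ = 0) ?mul0r // -[RHS]e.
  by apply: eq_bigr => i _; rewrite mxE.
rewrite (bigD1 k) //= big1 ?addr0 => [|i ik]; last first.
  by rewrite partX (hu i).2 (inj_eq inj_t) (negbTE ik) rmorph0 !mulr0.
rewrite partX (hu k).2 eqxx => /eqP; rewrite !mulf_eq0 => /orP[/eqP//|/orP[]].
  rewrite tofrac_eq0 => /eqP D0; have [SD nD _ _] := hB k; case: nD; apply/faceP.
  split=> // m mD; apply: contraTneq mD => pm.
  have := congr1 (mcoeff m) D0; rewrite part_coef pm eqxx mcoeff0 => /eqP.
  by rewrite mcoeff_eq0.
rewrite tofrac_eq0 => /eqP/(congr1 (mcoeff (u k)))/eqP.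
by rewrite mcoeffX eqxx mcoeff0 oner_eq0.
Qed.

(** N i is the first positive point on the i-th axis modulo Z e_j, hence irreducible. If some
    element violates divisibility, one of least degree modulo Z e_j is irreducible too, which makes
    d irreducible elements. *)
Lemma ray_divisors : regular_local (localization A P) (localization_ideal A P) ->
  exists N : 'I_d -> nat, forall i, i != j ->
    [/\ exists2 s, S s & proj s = (U_(i) *+ N i)%MM & forall s, S s -> N i %| s i]%N.
Proof.
move=> reg.
have hN i : exists n, i != j -> [/\ (0 < n)%N, exists2 s, S s & proj s = (U_(i) *+ n)%MM &
    forall k s, (0 < k)%N -> S s -> proj s = (U_(i) *+ k)%MM -> (n <= k)%N].
  have [->|ij] := eqVneq i j; first by exists 0%N.
  have ex : exists n, `[< (0 < n)%N /\ exists2 s, S s & proj s = (U_(i) *+ n)%MM >].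
    exists alpha; apply/asboolP; split=> //; exists (U_(i) *+ alpha)%MM.
      exact: semigroup_vertex.
    apply/mnmP=> l; rewrite mnmE; case: eqP => // ->.
    by rewrite !mnm_simpl (negbTE ij).
  case: (ex_minnP ex) => n /asboolP[n0 hs] hmin; exists n => _; split=> // k s k0 Ss ps.
  by apply: hmin; apply/asboolP; split=> //; exists s.
have [N hN'] := boolp.choice hN; exists N => i0 ij0.
split; first by case: (hN' i0 ij0).
move=> s0 Ss0; apply: contrapT => /negP ndv.
(* The violated coordinate is left free, so both summands of a minimal bad element satisfy
   divisibility in every coordinate. *)
pose bad s := S s /\ exists2 i, i != j & ~~ (N i %| s i)%N.
have ex : exists n, `[< exists2 s, bad s & mdeg (proj s) = n >].
  by exists (mdeg (proj s0)); apply/asboolP; exists s0 => //; split=> //; exists i0.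
case: (ex_minnP ex) => n /asboolP[s [Ss [i1 ij1 nd1]] es] hmin.
have hdiv s' : S s' -> (mdeg (proj s') < n)%N -> forall i, i != j -> (N i %| s' i)%N.
  move=> Ss' lt i ij; apply/negPn/negP => nd; move: lt; rewrite ltnNge => /negP; apply.
  by apply: hmin; apply/asboolP; exists s' => //; split=> //; exists i.
have projE s' i : i != j -> proj s' i = s' i by move=> /negbTE ij; rewrite mnmE ij.
have deg_gt0 (m : 'X_{1..d}) : m != 0%MM -> (0 < mdeg m)%N by rewrite lt0n mdeg_eq0.
apply: (@regular_irreducible (fun i => if i == j then proj s else (U_(i) *+ N i)%MM) reg).
  have sN i : i != j -> proj s != (U_(i) *+ N i)%MM.
    move=> ij; apply: contraNneq nd1 => /mnmP e; have := e i1; rewrite projE // => ->.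
    by rewrite !mnm_simpl; case: eqP => [->|_]; rewrite ?mul1n // mul0n dvdn0.
  move=> i i'; case: (eqVneq i j) => [->|ij]; case: (eqVneq i' j) => [->|ij'] //.
  - by move=> e; have := sN _ ij'; rewrite e eqxx.
  - by move=> e; have := sN _ ij; rewrite e eqxx.
  - move=> /mnmP/(_ i); rewrite !mnm_simpl eqxx mul1n; case: eqVneq => // _.
    by case: (hN' i ij) => N0 _ _; rewrite mul0n => e; rewrite e in N0.
move=> i; case: (eqVneq i j) => [_|ij].
  split; [|by exists s|].
    apply: contraNneq nd1 => /mnmP/(_ i1); rewrite projE // mnm0E => ->.
    exact: dvdn0.
  move=> s1 s2 Ss1 Ss2 e; apply: contrapT => /not_orP[/eqP n1 /eqP n2].
  have ed : (mdeg (proj s1) + mdeg (proj s2) = n)%N by rewrite -mdegD e.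
  case/negP: nd1; have := congr1 (fun m : 'X_{1..d} => m i1) e.
  rewrite /= mnmDE !projE // => <-; have := deg_gt0 _ n1; have := deg_gt0 _ n2 => *.
  by apply: dvdn_add; apply: hdiv => //; lia.
have [N0 [u Su pu] Nmin] := hN' i ij; split; [|by exists u|].
  by rewrite -mdeg_eq0 mdegMn mdeg1 mul1n -lt0n.
move=> s1 s2 Ss1 Ss2 /mnmP e.
have ray s' : (forall l, l != i -> proj s' l = 0%N) -> proj s' = (U_(i) *+ proj s' i)%MM.
  by move=> h; apply/mnmP=> l; rewrite !mnm_simpl; case: eqVneq => [<-|li];
    rewrite ?mul1n // mul0n h // eq_sym.
have z l : l != i -> proj s1 l = 0%N /\ proj s2 l = 0%N.
  move=> li; have := e l; rewrite !mnm_simpl eq_sym (negbTE li) mul0n => /eqP.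
  by rewrite addn_eq0 => /andP[/eqP ? /eqP].
have r1 := ray s1 (fun l li => (z l li).1); have r2 := ray s2 (fun l li => (z l li).2).
have ei := e i; rewrite !mnm_simpl eqxx mul1n in ei.
have [p1|p1] := posnP (proj s1 i).
  by left; rewrite r1 p1; apply/mnmP=> l; rewrite !mnm_simpl muln0.
have [p2|p2] := posnP (proj s2 i).
  by right; rewrite r2 p2; apply/mnmP=> l; rewrite !mnm_simpl muln0.
by have := Nmin _ _ p1 Ss1 r1; have := ei; move: (proj s1 i) (proj s2 i) p2 => x y; lia.
Qed.

End Vertex.

(** Let n j i be the divisor on the i-th axis modulo Z e_j. These numbers all coincide and divide
    every coordinate of the a_k, so the gcd hypothesis makes them 1. *)
Lemma isolated_near : isolated_singularity A M -> contains_all_near_vertices alpha a.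
Proof.
move=> iso.
have hn j : exists N : 'I_d -> nat, forall i, i != j ->
    [/\ exists2 s, S s & proj j s = (U_(i) *+ N i)%MM & forall s, S s -> N i %| s i]%N.
  apply: ray_divisors; apply: iso; first exact: face_prime.
  move=> e; have : M (phi 'X_[U_(j) *+ alpha]).
    apply/irrelevant_phi; split; first exact/semigroup_ringX/semigroup_vertex.
    rewrite mcoeffX; case: eqP => // /mnmP/(_ j); rewrite !mnm_simpl eqxx mul1n => e'.
    by have := alpha_gt0; rewrite e'.
  rewrite -e => /faceP[_ h].
  have := h (U_(j) *+ alpha)%MM; rewrite msuppX inE eqxx => /(_ isT)/eqP; apply.
  by apply/mnmP=> i; rewrite mnmE mnm0E; case: eqVneq => // ij;
    rewrite !mnm_simpl eq_sym (negbTE ij).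
have [n hn'] := boolp.choice hn.
have ray j i : i != j -> exists2 s, S s & [/\ s i = n j i,
    forall l, l != i -> l != j -> s l = 0%N & (alpha %| s i + s j)%N].
  move=> ij; have [[s Ss /mnmP ps] _] := hn' j i ij; exists s => //.
  have sl l : l != i -> l != j -> s l = 0%N.
    move=> li lj; have := ps l; rewrite mnmE (negbTE lj) !mnm_simpl => ->.
    by rewrite eq_sym (negbTE li).
  split=> //; first by have := ps i; rewrite mnmE (negbTE ij) !mnm_simpl eqxx mul1n.
  have := dvdn_mdeg hA Ss; rewrite mdegE (bigD1 i) //= (bigD1 j) /= 1?eq_sym // big1 ?addn0 //.
  by move=> l /andP[]; apply: sl.
have div j i s : i != j -> S s -> (n j i %| s i)%N by move=> ij; case: (hn' j i ij) => _; apply.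
have dva j i : i != j -> (n j i %| alpha)%N.
  by move=> ij; have := div j i _ ij (semigroup_vertex alpha a i); rewrite !mnm_simpl eqxx mul1n.
(* The ray element has i-th coordinate n j i, and its only other coordinate is s_j. As n i j divides
   s_j and alpha, and alpha divides the degree, n i j divides n j i. *)
have sym_dv j i : i != j -> (n i j %| n j i)%N.
  move=> ij; have ji : j != i by rewrite eq_sym.
  have [s Ss [<- _ dv]] := ray j i ij.
  have h : (n i j %| s i + s j)%N by apply: dvdn_trans dv; apply: dva.
  by move: h; rewrite dvdn_addl //; apply: div.
have sym j i : i != j -> n i j = n j i.
  by move=> ij; apply/eqP; rewrite eqn_dvd !sym_dv // eq_sym.
have row_dv j l i : i != j -> i != l -> (n l i %| n j i)%N.
  by move=> ij il; have [s Ss [<- _ _]] := ray j i ij; apply: div.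
have row j l i : i != j -> i != l -> n l i = n j i.
  by move=> ij il; apply/eqP; rewrite eqn_dvd !row_dv.
have d2 := dim_gt1 c_gt1 alpha_gt1 hA.
pose o : 'I_d := Ordinal (ltnW d2); pose o' : 'I_d := Ordinal d2.
have oo : o' != o by rewrite -val_eqE.
have n_const j i : i != j -> n j i = n o o'.
  move=> ij; have [ei|io'] := eqVneq i o'; first by rewrite ei in ij *; apply: row.
  rewrite (row o' j i) // sym 1?eq_sym //.
  by apply: row; rewrite // eq_sym.
have other (i : 'I_d) : exists j, i != j.
  by have [->|io] := eqVneq i o; [exists o'; rewrite eq_sym|exists o].
have n1 : n o o' = 1%N.
  apply/eqP; rewrite -dvdn1; case: hA => _ _ <-.
  apply: (big_ind (fun m => n o o' %| m)%N) => [//|x y|k _]; first by rewrite dvdn_gcd => -> ->.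
  apply: (big_ind (fun m => n o o' %| m)%N) => [//|x y|i _]; first by rewrite dvdn_gcd => -> ->.
  have [j ij] := other i; rewrite -(n_const j i ij); apply: div => //.
  exact: semigroup_config.
move=> i j ij; have ji : j != i by rewrite eq_sym.
have [s Ss [s1 s0 _]] := ray i j ji.
rewrite n_const // n1 in s1.
case/semigroupP: Ss => m es.
(* An element with j-th coordinate 1 uses a generator with j-th coordinate 1; this one is supported
   on i and j as well, and its degree alpha leaves alpha - 1 for i. *)
have [k mk gk] : exists2 k, m k != 0%N & gens alpha a k j != 0%N.
  apply: contrapT => h; move: s1; rewrite es mvalE big1 // => k _; apply/eqP.
  by rewrite muln_eq0; apply/negPn/negP; rewrite negb_or => /andP[gk mk]; apply: h; exists k.
have le l : (gens alpha a k l <= s l)%N.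
  rewrite es mvalE (bigD1 k) //=; apply: leq_trans (leq_addr _ _).
  by rewrite leq_pmulr // lt0n.
have gj : gens alpha a k j = 1%N by have := le j; rewrite s1; lia.
have gl l : l != i -> l != j -> gens alpha a k l = 0%N.
  by move=> li lj; have := le l; rewrite s0 //; lia.
exists k; have := mdeg_gens hA k; rewrite mdegE (bigD1 i) //= (bigD1 j) /= 1?eq_sym //.
rewrite big1 => [|l /andP[li lj]]; last exact: gl.
rewrite gj addn0 => dg; apply/mnmP=> l; rewrite !mnm_simpl.
case: (eqVneq i l) => [<-|il]; first by rewrite eq_sym (negbTE ij) mul1n; lia.
case: (eqVneq j l) => [<-|jl]; first by rewrite gj.
by rewrite gl // eq_sym.
Qed.

End RegularToNear.

Theorem corollary2p3 (K : fieldType) (c d alpha : nat)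
    (a : 'I_c -> 'X_{1..d}) (hc : (2 <= c)%N) (halpha : (2 <= alpha)%N)
    (hA : simplicial_config alpha a) :
  (isolated_singularity (KS K alpha a) (KS_irrelevant K alpha a) <->
     contains_all_near_vertices alpha a) /\
  (d = 2%N \/
   graded_buchsbaum (KS K alpha a) (KS_irrelevant K alpha a) \/
   isolated_singularity (KS K alpha a) (KS_irrelevant K alpha a) ->
   groebner_degree_at_most (toric_ideal K alpha a)
     ((degKS K alpha a)%:Z - (codimKS K alpha a)%:Z + 1)).
Proof.
have isoP : isolated_singularity (KS K alpha a) (KS_irrelevant K alpha a) <->
    contains_all_near_vertices alpha a.
  by split; [apply: isolated_near|apply: near_isolated].
split=> // hcase m /minimal_toric_generator hm.
rewrite (degKS_residues K hc halpha hA) codimKSE; last exact: ltnW.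
suff : (mdeg m + c <= size (residues alpha a) + 1)%N by lia.
case: hcase => [d2|[/buchsbaum_semigroupP hB|/isoP near]].
- exact: crit_dim2.
- by apply: crit_buchsbaum => //; apply: hB; apply: ltnW.
- exact: crit_near.
Qed.
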